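(* Let $\mathcal{M}$ be a closed non-zero subspace of $L^2[0,1]$. Then $\mathcal{M}$ is invariant for the Hardy operator $H$ (that is, $H\mathcal{M}\subseteq\mathcal{M}$) if and only if $\mathcal{M}$ is a monomial space.
   Context: $L^2[0,1]$ is the complex Hilbert space of square-integrable functions on $[0,1]$. The Hardy operator $H$ on $L^2[0,1]$ is the bounded operator $Hf(x)=\frac1x\int_0^x f(t)\,dt$. Let $\mathbb{S}=\{s\in\mathbb{C}:\operatorname{Re}(s)>-\frac12\}$; for $s\in\mathbb{S}$ the monomial function $x^s$ lies in $L^2[0,1]$. For a finite subset $S\subset\mathbb{S}$ let $\mathcal{M}(S)=\{\sum_{s\in S}a(s)x^s : a:S\to\mathbb{C}\}$. A subspace of $L^2[0,1]$ of the form $\mathcal{M}(S)$ for some finite $S\subset\mathbb{S}$ is called a finite monomial space. If $\mathcal{M}$ is a subspace of a Hilbert space $\mathcal{H}$ and $\{\mathcal{M}_n\}$ is a sequence of closed subspaces, then $\{\mathcal{M}_n\}$ tends to $\mathcal{M}$ (written $\mathcal{M}_n\to\mathcal{M}$) if $\mathcal{M}=\{f\in\mathcal{H} : \lim_{n\to\infty}\operatorname{dist}(f,\mathcal{M}_n)=0\}$. A subspace $\mathcal{M}$ of $L^2[0,1]$ is called a monomial space if there exists a sequence $\{\mathcal{M}_n\}$ of finite monomial spaces such that $\mathcal{M}_n\to\mathcal{M}$. *)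

(* Defs.v *)
From HB Require Import structures.
From mathcomp Require Import all_boot all_order all_algebra finmap.
From mathcomp Require Import complex.
From mathcomp Require Import all_classical all_reals all_analysis.

Set Implicit Arguments.
Unset Strict Implicit.
Unset Printing Implicit Defensive.

Import Order.TTheory GRing.Theory Num.Theory.
Import numFieldNormedType.Exports.
Import Normc.

Local Open Scope classical_set_scope.
Local Open Scope ring_scope.
Local Open Scope complex_scope.

(* Elements of L^2[0,1] are handled through representatives f : R -> R[i]: only
   the values on [0,1] matter, functions equal almost everywhere on [0,1] are
   identified, and a subset of L^2[0,1] is the set of all representatives of
   its elements (hence the closure under eqL2 in subspaceL2). *)
Section Defs.
Variable R : realType.
Local Notation mu := (@lebesgue_measure R).
Implicit Types (f g : R -> R[i]) (M : set (R -> R[i])).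

Definition unit_itv : set R := `[0, 1]%classic.

Definition eqL2 f g := ae_eq mu unit_itv f g.

Definition L2 : set (R -> R[i]) := [set f : R -> R[i] |
  [/\ measurable_fun unit_itv (fun x => complex.Re (f x)),
      measurable_fun unit_itv (fun x => complex.Im (f x)) &
      mu.-integrable unit_itv (fun x : R => (normc (f x) ^+ 2)%:E)]].

Definition normL2 f : R :=
  Num.sqrt (\int[mu]_(x in unit_itv) (normc (f x) ^+ 2)).

Definition distL2 f M : R := inf [set normL2 (f - g) | g in M].

Definition subspaceL2 M : Prop :=
  [/\ M `<=` L2,
      forall f g, M f -> L2 g -> eqL2 f g -> M g,
      M 0,
      forall f g, M f -> M g -> M (f + g) &
      forall (c : R[i]) f, M f -> M (fun x => c * f x)].

(* norm-closed in L^2[0,1] *)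
Definition closedL2 M : Prop :=
  forall f, L2 f ->
    (forall e : R, 0 < e -> exists2 g, M g & normL2 (f - g) < e) -> M f.

(* The value at x = 0 is irrelevant. *)
Definition hardy f (x : R) : R[i] :=
  (x^-1)%:C *
  ((\int[mu]_(t in `[0, x]) complex.Re (f t)) +i*
   (\int[mu]_(t in `[0, x]) complex.Im (f t))).

Definition hardy_invariant M : Prop := forall f, M f -> M (hardy f).

(* x ^ s = exp (s * ln x) for 0 < x; the value at x = 0 is irrelevant. *)
Definition monomial (s : R[i]) (x : R) : R[i] :=
  (x `^ complex.Re s)%:C *
  (cos (complex.Im s * ln x) +i* sin (complex.Im s * ln x)).

Definition half_plane : set R[i] := [set s | - 2^-1 < complex.Re s].

Definition monomial_span (S : {fset R[i]}) : set (R -> R[i]) :=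
  [set f : R -> R[i] | L2 f /\ exists a : S -> R[i],
     eqL2 f (fun x => \sum_(s : S) a s * monomial (val s) x)].

Definition finite_monomial_space M : Prop :=
  exists2 S : {fset R[i]},
    (forall s, s \in S -> half_plane s) & M = monomial_span S.

Definition tends_to (Mn : nat -> set (R -> R[i])) M : Prop :=
  M = [set f : R -> R[i] | L2 f /\ distL2 f (Mn n) @[n --> \oo] --> (0 : R)].

Definition monomial_space M : Prop :=
  subspaceL2 M /\
  exists2 Mn : nat -> set (R -> R[i]),
    (forall n, finite_monomial_space (Mn n)) & tends_to Mn M.

End Defs.

(* Main.v *)
Require Import Defs.
From mathcomp Require Import all_boot all_order all_algebra finmap.
From mathcomp Require Import complex separable.
From mathcomp Require Import all_classical all_reals all_analysis.
From mathcomp Require Import measurable_realfun.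
From mathcomp Require Import ring lra zify.

(* Let B = 1 - H, let A f be the mean of f over [0,1], and expand f by the
   coefficients A (B^k f).  On polynomials |B f|^2 = |f|^2 - |A f|^2, which
   extends to L^2 by density; since B x^n = n/(n+1) x^n, B^k f tends to 0, so the
   coefficients embed L^2[0,1] isometrically in l^2, turning B into the backward
   shift and x^s into a multiple of (w^k)_k with w = s/(s+1), |w| < 1.
     Monomial spaces are invariant because H is bounded and each M(S) is
   invariant.  Conversely, take a closed subspace M of l^2 invariant under the
   backward shift.  Unless it is everything, its orthogonal complement contains a
   unit vector theta orthogonal to its own shifts, and M is the set of f with
   <B^k f, theta> = 0 for all k (Beurling's theorem); moreover the Toeplitz
   operator f |-> <B^k f, theta>_k is a contraction.
     M is then the limit of the solution spaces of the order n recurrences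
     g(k+n) + sum_(j < n) q_j g(k+j) = 0,  q_j = (1 - j/n) conj(theta_j) / 4,
   with q_0 perturbed slightly so that the characteristic polynomial has n distinct
   roots w, which makes the solutions the combinations of the (w^k)_k.  The
   Toeplitz operator of symbol q has norm at most 1/2, so the tail of a solution is
   bounded by the Toeplitz image of its first n terms.  Hence |w| < 1, and a
   solution sharing its first n terms with f in M converges to f, whereas if
   solutions converge to f the recurrences force <B^k f, theta> = 0. *)

Set Implicit Arguments.
Unset Strict Implicit.
Unset Printing Implicit Defensive.

Import Order.TTheory GRing.Theory Num.Theory.
Import numFieldNormedType.Exports.

Local Open Scope classical_set_scope.
Local Open Scope ring_scope.

(** * Square-integrable real functions on [0,1] *)

(** The factor 1/4 and the weights 1 - j/n serve one estimate. The tail of a solution is minus the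
    Toeplitz image of head plus tail, so it can be absorbed into the left side only if that operator
    has norm well below 1. Cutting theta off after n coefficients may increase the operator norm,
    whereas the weights 1 - j/n amount to averaging over restrictions to windows of length n and
    cannot. The scaled symbol then has squared norm at most 1/16, the perturbation of q_0 is allowed
    as much, and |x + y|^2 <= 2 |x|^2 + 2 |y|^2 leaves 1/4, that is, norm 1/2. Scaling does not
    affect the limit condition, since <B^k f, theta> / 4 vanishes together with <B^k f, theta>.
    Estimates on Toeplitz operators concern finite sums, uniformly in the cut-off, so that no
    operator on l^2 has to be constructed; they compare squared norms, hence the recurring factors 2
    and 4. On the function side, A and H preserve real functions, so real and imaginary parts are
    studied separately and recombined at the end. *)

Lemma measurable_unit_itv (R : realType) : measurable (@unit_itv R).
Proof. exact: measurable_itv. Qed.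
#[local] Hint Extern 0 (measurable _) => solve [exact: measurable_unit_itv] : core.

Section RealL2.
Variable R : realType.
Local Notation mu := (@lebesgue_measure R).
Local Notation I := (@unit_itv R).
Implicit Types (f g : R -> R) (p : {poly R}).

Definition rL2 g := measurable_fun I g /\
  mu.-integrable I (EFin \o (fun x => g x ^+ 2)).

Definition sq g : R := \int[mu]_(x in I) (g x ^+ 2).

Definition ip f g : R := \int[mu]_(x in I) (f x * g x).

Lemma mu_unit_itv : mu I = 1%E.
Proof. by rewrite /unit_itv lebesgue_measure_itv/= lte_fin ltr01 -EFinB subr0. Qed.

Lemma integrable_lin (A : set R) f g (a b : R) : measurable A ->
  mu.-integrable A (EFin \o f) -> mu.-integrable A (EFin \o g) ->
  mu.-integrable A (EFin \o (fun x => a * f x + b * g x)).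
Proof.
move=> mA jf jg.
have : mu.-integrable A (fun x => a%:E * (f x)%:E + b%:E * (g x)%:E)%E.
  by apply: integrableD => //; apply: integrableZl.
by apply: eq_integrable => // x _ /=; rewrite -!EFinM -EFinD.
Qed.

Lemma Rintegral_lin (A : set R) f g (a b : R) : measurable A ->
  mu.-integrable A (EFin \o f) -> mu.-integrable A (EFin \o g) ->
  \int[mu]_(x in A) (a * f x + b * g x) =
  a * \int[mu]_(x in A) f x + b * \int[mu]_(x in A) g x.
Proof.
move=> mA jf jg; rewrite RintegralD ?RintegralZl//.
- have := integrable_lin a 0 mA jf jg.
  by apply: eq_integrable => // x _ /=; rewrite mul0r addr0.
- have := integrable_lin 0 b mA jf jg.
  by apply: eq_integrable => // x _ /=; rewrite mul0r add0r.
Qed.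

Lemma rL2_mul_integrable f g : rL2 f -> rL2 g ->
  mu.-integrable I (EFin \o (fun x => f x * g x)).
Proof.
move=> [mf f2] [mg g2].
have := integrable_lin 1 1 (@measurable_unit_itv R) f2 g2.
apply: le_integrable => //.
- by apply/measurable_EFinP; apply: measurable_funM.
- move=> x Ix; rewrite /= lee_fin [leRHS]ger0_norm ?mul1r ?addr_ge0 ?sqr_ge0//.
  by rewrite ler_norml; apply/andP; split; nra.
Qed.

Lemma rL2_cst (c : R) : rL2 (fun=> c).
Proof.
split; first exact: measurable_cst.
apply: measurable_bounded_integrable => //.
- by rewrite [ltLHS]mu_unit_itv ltry.
- exists (c ^+ 2); split; first exact: num_real.
  by move=> y cy x _ /=; rewrite ger0_norm ?sqr_ge0// ltW.
Qed.

Lemma rL2_integrable f : rL2 f -> mu.-integrable I (EFin \o f).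
Proof.
move=> /rL2_mul_integrable /(_ (rL2_cst 1)).
by apply: eq_integrable => // x _; rewrite /= mulr1.
Qed.

Lemma rL2_lin f g (a b : R) : rL2 f -> rL2 g -> rL2 (fun x => a * f x + b * g x).
Proof.
move=> Lf Lg; split.
  by case: Lf => mf _; case: Lg => mg _; apply: measurable_funD => //;
    apply: measurable_funM => //; exact: measurable_cst.
have fg := rL2_mul_integrable Lf Lg.
case: Lf => mf f2; case: Lg => mg g2.
have := integrable_lin 1 (2 * a * b) (@measurable_unit_itv R)
  (integrable_lin (a ^+ 2) (b ^+ 2) (@measurable_unit_itv R) f2 g2) fg.
by apply: eq_integrable => // x _ /=; congr EFin; ring.
Qed.

Lemma sq_lin f g (a b : R) : rL2 f -> rL2 g ->
  sq (fun x => a * f x + b * g x) =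
  a ^+ 2 * sq f + 2 * a * b * ip f g + b ^+ 2 * sq g.
Proof.
move=> Lf Lg.
have fg := rL2_mul_integrable Lf Lg.
case: Lf => mf f2; case: Lg => mg g2.
rewrite addrAC /sq -Rintegral_lin// -[X in X + _]mul1r -Rintegral_lin//; last first.
  exact: integrable_lin.
by apply: eq_Rintegral => x _; ring.
Qed.

Lemma sq_ge0 f : 0 <= sq f.
Proof. by apply: Rintegral_ge0 => x _; exact: sqr_ge0. Qed.

Lemma cauchy_schwarz f g : rL2 f -> rL2 g -> ip f g ^+ 2 <= sq f * sq g.
Proof.
move=> Lf Lg; have [sg0|sg0] := eqVneq (sq g) 0.
  rewrite sg0 mulr0; have [->|ip0] := eqVneq (ip f g) 0; first by rewrite expr0n.
  (* With [sq g = 0] the expansion is affine in the coefficient of [g]; this coefficient makes it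
     equal to -1. *)
  have := sq_ge0 (fun x => 1 * f x + (- (sq f + 1) / (2 * ip f g)) * g x).
  rewrite sq_lin// sg0 => H.
  suff : 0 <= -1 :> R by rewrite oppr_ge0 ler10.
  by move: H; congr (_ <= _); field.
have sgp : 0 < sq g by rewrite lt_neqAle eq_sym sg0 sq_ge0.
have := sq_ge0 (fun x => sq g * f x + (- ip f g) * g x).
rewrite sq_lin// => H.
have : 0 <= sq g * (sq f * sq g - ip f g ^+ 2) by move: H; congr (_ <= _); ring.
by rewrite pmulr_rge0// subr_ge0.
Qed.

(** Parallelogram law: the two sides differ by the squared norm of [a f - b g]. *)
Lemma sq_add_le f g (a b : R) : rL2 f -> rL2 g ->
  sq (fun x => a * f x + b * g x) <= 2 * a ^+ 2 * sq f + 2 * b ^+ 2 * sq g.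
Proof.
move=> Lf Lg; have := sq_ge0 (fun x => a * f x + (- b) * g x).
rewrite !sq_lin//; lra.
Qed.

Lemma eq_sq f g : {in I, f =1 g} -> sq f = sq g.
Proof. by move=> fg; apply: eq_Rintegral => x /fg ->. Qed.

Lemma eq_rL2 f g : {in I, f =1 g} -> rL2 f -> rL2 g.
Proof.
move=> fg [mf f2]; split; first exact: eq_measurable_fun mf.
by apply: eq_integrable f2 => // x xI; rewrite /= fg.
Qed.

Lemma ae_eq_integrable (A : set R) f g : measurable A ->
  mu.-integrable A (EFin \o f) -> measurable_fun A g -> ae_eq mu A f g ->
  mu.-integrable A (EFin \o g).
Proof.
move=> mA /integrableP[/measurable_EFinP mf fy] mg fg.
apply/integrableP; split; first exact/measurable_EFinP.
suff -> : (\int[mu]_(x in A) `|(EFin \o g) x| = \int[mu]_(x in A) `|(f x)%:E|)%E.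
  by [].
apply: ae_eq_integral => //.
- by apply: measurableT_comp => //; exact/measurable_EFinP.
- by apply: measurableT_comp => //; exact/measurable_EFinP.
- by apply: filterS fg => x /= H Ax; rewrite H.
Qed.

Lemma ae_eq_Rintegral (A : set R) f g : measurable A ->
  measurable_fun A f -> measurable_fun A g -> ae_eq mu A f g ->
  \int[mu]_(x in A) f x = \int[mu]_(x in A) g x.
Proof.
move=> mA mf mg fg; rewrite /Rintegral; congr fine; apply: ae_eq_integral => //.
- exact/measurable_EFinP.
- exact/measurable_EFinP.
- by apply: filterS fg => x /= H Ax; rewrite H.
Qed.

Lemma sq_ae_eq f g : rL2 f -> measurable_fun I g -> ae_eq mu I f g ->
  rL2 g /\ sq g = sq f.
Proof.
move=> [mf f2] mg fg.
have fg2 : ae_eq mu I (fun x => f x ^+ 2) (fun x => g x ^+ 2).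
  by apply: filterS fg => x /= H Ix; rewrite H.
have mg2 : measurable_fun I (fun x => g x ^+ 2) by exact: measurable_funX.
split; first by split => //; exact: (ae_eq_integrable _ f2).
by symmetry; apply: ae_eq_Rintegral => //; exact: measurable_funX.
Qed.

End RealL2.

(** * Density of the polynomials *)

Section Density.
Variable R : realType.
Local Notation mu := (@lebesgue_measure R).
Local Notation I := (@unit_itv R).
Implicit Types (f g : R -> R) (p : {poly R}).

Lemma le_rL2 f h : measurable_fun I f -> rL2 h ->
  (forall x, I x -> `|f x| <= h x) -> rL2 f.
Proof.
move=> mf [mh h2] fh; split => //.
apply: le_integrable h2 => //; first by apply/measurable_EFinP; exact: measurable_funX.
move=> x Ix; rewrite /= lee_fin !ger0_norm ?sqr_ge0//.
by rewrite -real_normK ?num_real// lerXn2r ?nnegrE ?fh// (le_trans _ (fh x Ix)).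
Qed.

Lemma sq_dominated (u : nat -> R -> R) h : rL2 h ->
  (forall n, measurable_fun I (u n)) ->
  (forall n x, I x -> `|u n x| <= h x) ->
  {ae mu, forall x, I x -> u n x @[n --> \oo] --> (0 : R)} ->
  sq (u n) @[n --> \oo] --> (0 : R).
Proof.
move=> Lh mun uh u0.
have [|||||_ _] := @dominated_convergence _ _ R mu I (@measurable_unit_itv R)
  (fun n => EFin \o (fun x => u n x ^+ 2)) (cst 0%E) (EFin \o (fun x => h x ^+ 2)).
- by move=> n; apply/measurable_EFinP; exact: (measurable_funX 2 (mun n)).
- exact: measurable_cst.
- move: u0 => /=; apply: (@filterS _ _ (ae_filter_ringOfSetsType mu)) => x H Ix; apply/cvg_EFin; first exact: nearW.
  by rewrite -[X in _ --> X](mulr0 (0 : R)); apply: cvgM; exact: H.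
- by case: Lh.
- apply: aeW => x n Ix; rewrite /= lee_fin ger0_norm ?sqr_ge0//.
  by rewrite -real_normK ?num_real// lerXn2r ?nnegrE ?uh// (le_trans _ (uh n x Ix)).
by rewrite integral0 => H; apply: fine_cvg.
Qed.

Lemma measurable_horner (D : set R) p : measurable_fun D (horner p).
Proof. by apply: measurable_funTS; apply: continuous_measurable_fun; exact: continuous_horner. Qed.

Lemma horner_integrable (a b : R) p : mu.-integrable `[a, b] (EFin \o horner p).
Proof.
apply: continuous_compact_integrable; first exact: segment_compact.
by apply: continuous_subspaceT; exact: continuous_horner.
Qed.

Lemma horner_rL2 p : rL2 (horner p).
Proof.
split; first exact: measurable_horner.
have := horner_integrable 0 1 (p ^+ 2).
by apply: eq_integrable => // x _; rewrite /= horner_exp.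
Qed.

(** This property survives linear combinations, limits in L^2 and dominated limits almost
    everywhere, so it spreads from polynomials to indicators, to simple functions and to all of
    L^2. *)
Definition poly_approx g := rL2 g /\
  forall e, 0 < e -> exists p, sq (fun x => g x - p.[x]) <= e.

Lemma poly_approx_horner p : poly_approx (horner p).
Proof.
split=> [|e e0]; first exact: horner_rL2.
exists p; rewrite [sq _](_ : _ = 0) ?ltW// /sq.
under eq_Rintegral do rewrite subrr expr0n/=.
by rewrite Rintegral_cst// mul0r.
Qed.

Lemma rL2B f g : rL2 f -> rL2 g -> rL2 (fun x => f x - g x).
Proof.
move=> Lf Lg; have := rL2_lin 1 (-1) Lf Lg.
by apply: eq_rL2 => x _; rewrite mul1r mulN1r.
Qed.

Lemma poly_approx_lin f g a b : poly_approx f -> poly_approx g ->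
  poly_approx (fun x => a * f x + b * g x).
Proof.
move=> [Lf Hf] [Lg Hg]; split=> [|e e0]; first exact: rL2_lin.
pose c := a ^+ 2 + b ^+ 2 + 1.
have c0 : 0 < c by rewrite ltr_wpDl// addr_ge0 ?sqr_ge0.
have d0 : 0 < e / (2 * c) by rewrite divr_gt0// mulr_gt0.
have [p Hp] := Hf _ d0; have [q Hq] := Hg _ d0.
exists (a *: p + b *: q).
rewrite (@eq_sq _ _ (fun x => a * (f x - p.[x]) + b * (g x - q.[x]))); last first.
  by move=> x _; rewrite hornerD !hornerZ; ring.
apply: (le_trans (sq_add_le _ _ _ _)); [exact/rL2B/horner_rL2..|].
apply: (@le_trans _ _ (2 * a ^+ 2 * (e / (2 * c)) + 2 * b ^+ 2 * (e / (2 * c)))).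
  by apply: lerD; apply: ler_wpM2l => //; rewrite mulr_ge0 ?sqr_ge0.
rewrite -mulrDl -mulrDr mulrA ler_pdivrMr ?mulr_gt0// [leRHS]mulrCA -!mulrA ler_pM2l//.
by rewrite mulrC ler_pM2l// ler_wpDr.
Qed.

Lemma poly_approx_lim g : rL2 g ->
  (forall e, 0 < e -> exists2 f, poly_approx f & sq (fun x => g x - f x) <= e) ->
  poly_approx g.
Proof.
move=> Lg H; split=> // e e0.
have e4 : 0 < e / 4 by rewrite divr_gt0.
have [f [Lf Hf] gf] := H _ e4; have [p Hp] := Hf _ e4; exists p.
rewrite (@eq_sq _ _ (fun x => 1 * (g x - f x) + 1 * (f x - p.[x]))); last first.
  by move=> x _; ring.
apply: (le_trans (sq_add_le _ _ _ _)); [exact: rL2B|exact/rL2B/horner_rL2|lra].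
Qed.

Lemma poly_approx_cvg g (f : nat -> R -> R) h : rL2 g -> rL2 h ->
  (forall n, poly_approx (f n)) ->
  (forall n x, I x -> `|g x - f n x| <= h x) ->
  {ae mu, forall x, I x -> f n x @[n --> \oo] --> g x} -> poly_approx g.
Proof.
move=> Lg Lh Hf fh fg; apply: poly_approx_lim => // e e0.
have : sq (fun x => g x - f n x) @[n --> \oo] --> (0 : R).
  apply: (sq_dominated Lh) => //.
    by move=> n; have [[mf _] _] := Hf n; have [mg _] := Lg; exact: measurable_funB.
  move: fg; apply: (@filterS _ _ (ae_filter_ringOfSetsType mu)) => x H Ix; rewrite -[X in _ --> X](subrr (g x)).
  by apply: cvgB; [exact: cvg_cst|exact: H].
move=> /cvgrPdist_le /(_ e e0) [N _ /(_ N (leqnn N))] /=.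
rewrite sub0r normrN ger0_norm ?sq_ge0// => sN.
by exists (f N).
Qed.

Lemma poly_approx_eq f g : {in I, f =1 g} -> poly_approx f -> poly_approx g.
Proof.
move=> fg [Lf Hf]; split; first exact: eq_rL2 Lf.
move=> e /Hf[p pe]; exists p; rewrite (le_trans _ pe)// le_eqVlt; apply/orP; left.
by apply/eqP/eq_sq => x /fg ->.
Qed.

Lemma indic_rL2 (A : set R) : measurable A -> rL2 (\1_A : R -> R).
Proof.
move=> mA; apply: (le_rL2 _ (rL2_cst 1)); first exact: measurable_indic.
by move=> x _; rewrite indicE; case: (_ \in _); rewrite ?normr1 ?normr0.
Qed.

End Density.

(** * Indicators of rays as limits of polynomials *)

Section RayApproximation.
Variable R : realType.
Local Notation I := (@unit_itv R).
Implicit Types (f g : R -> R) (p : {poly R}).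

Lemma bernoulli_ineq (t : R) n : -1 <= t -> 1 + t *+ n <= (1 + t) ^+ n.
Proof.
move=> t1; elim: n => [|n IH]; first by rewrite mulr0n addr0 expr0.
rewrite exprS mulrS; have : 0 <= 1 + t by lra.
move=> /ler_wpM2l /(_ _ _ IH); apply: le_trans.
have : 0 <= t ^+ 2 *+ n by rewrite mulrn_wge0// sqr_ge0.
move=> H0; rewrite -subr_ge0; congr (_ <= _): H0.
by rewrite -[t *+ n]mulr_natr -[t ^+ 2 *+ n]mulr_natr; ring.
Qed.

(** Bernoulli gives [t *+ n <= (1 + t) ^+ n], and the product of [(1 - t) ^+ n] and [(1 + t) ^+ n]
    is a power of [1 - t ^+ 2]. *)
Lemma bernoulli_ineq_inv (t : R) n : 0 <= t <= 1 -> (1 - t) ^+ n * (t *+ n) <= 1.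
Proof.
move=> /andP[t0 t1].
have h1 : t *+ n <= (1 + t) ^+ n.
  by apply: le_trans (bernoulli_ineq n _); [rewrite lerDr|lra].
have h2 : 0 <= (1 - t) ^+ n by rewrite exprn_ge0// subr_ge0.
apply: (le_trans (ler_wpM2l h2 h1)); rewrite -exprMn exprn_ile1//; nra.
Qed.

Lemma poly_approx_ray (a : R) : 0 < a < 1 -> poly_approx (\1_(`]a, +oo[) : R -> R).
Proof.
move=> /andP[a0 a1].
(* As [N n] is about [a ^- n], [N n * x ^+ n] tends to 0 for [x < a] and to
   infinity for [x > a]; hence so do [p n] to 0 and 1. *)
pose N n := (Num.trunc (a ^- n)).+1.
have N1 n : a ^- n <= (N n)%:R by rewrite ltW// truncnS_gt.
have N2 n : (N n)%:R <= a ^- n + 1.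
  by rewrite -natr1 lerD2r truncn_le invr_ge0 exprn_ge0 ?ltW.
pose p n : {poly R} := 1 - (1 - 'X^n) ^+ N n.
have pE n x : (p n).[x] = 1 - (1 - x ^+ n) ^+ N n.
  by rewrite /p !hornerE.
have xn n x : I x -> 0 <= x ^+ n <= 1.
  rewrite /unit_itv /= in_itv /= => /andP[x0 x1].
  by rewrite exprn_ge0// exprn_ile1.
have p01 n x : I x -> 0 <= (p n).[x] <= 1.
  move=> /(xn n) /andP[y0 y1]; rewrite pE subr_ge0 lerBlDr lerDl.
  by rewrite exprn_ge0 ?subr_ge0// exprn_ile1// ?subr_ge0// lerBlDr lerDl.
apply: (@poly_approx_cvg _ _ (fun n => horner (p n)) (cst 1)).
- exact: indic_rL2.
- exact: rL2_cst.
- by move=> n; exact: poly_approx_horner.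
- move=> n x Ix; have /andP[] := p01 n x Ix.
  rewrite indicE ler_norml; case: (_ \in _) => /=; lra.
(* The point [a] is discarded: there [p n] tends to 1 - 1/e and not to the value 0 of the
   indicator. *)
exists [set a]; split => //; first by rewrite lebesgue_measure_set1.
move=> x /= /not_implyP[Ix]; apply: contra_notP => /eqP xa.
move: (Ix); rewrite /unit_itv /= in_itv /= => /andP[x0 x1].
have [xa'|ax] := ltP x a.
  rewrite indicE memNset /=; last by rewrite in_itv /= andbT; apply/negP; rewrite -leNgt ltW.
  apply: (@squeeze_cvgr _ _ _ _ (cst 0) (fun n => (x / a) ^+ n + x ^+ n)).
  - apply: nearW => n; have /andP[-> _] := p01 n x Ix; rewrite /= pE.
    have /andP[y0 y1] := xn n x Ix.
    (* For [x < a], Bernoulli bounds [(p n).[x]] by [N n] times [x ^+ n], hence by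
       [(x / a) ^+ n + x ^+ n]. *)
    have := @bernoulli_ineq (- x ^+ n) (N n).
    rewrite lerN2 => /(_ y1) H.
    apply: (@le_trans _ _ (x ^+ n *+ N n)).
      by rewrite lerBlDr -lerBlDl -mulNrn.
    rewrite -mulr_natr (le_trans (ler_wpM2l y0 (N2 n)))//.
    by rewrite mulrDr mulr1 exprMn exprVn.
  - exact: cvg_cst.
  - rewrite -[X in _ --> X](addr0 (0 : R)); apply: cvgD; apply: cvg_expr.
      by rewrite ger0_norm ?divr_ge0 ?(ltW a0)// ltr_pdivrMr// mul1r.
    by rewrite ger0_norm// (lt_trans xa').
have {}ax : a < x by rewrite lt_neqAle eq_sym xa.
have xp : 0 < x by exact: lt_trans ax.
rewrite indicE mem_set /=; last by rewrite in_itv /= andbT.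
apply: (@squeeze_cvgr _ _ _ _ (fun n => 1 - (a / x) ^+ n) (cst 1)).
- apply: nearW => n; have /andP[_ ->] := p01 n x Ix; rewrite andbT /= pE lerD2l lerN2.
  (* For [x > a], the defect [1 - (p n).[x]] is at most the inverse of [N n] times [x ^+ n], hence
     at most [(a / x) ^+ n]. *)
  have := bernoulli_ineq_inv (N n) (xn n x Ix).
  rewrite -mulr_natr => H.
  have xn0 : 0 < x ^+ n by exact: exprn_gt0.
  have an0 : 0 < a ^+ n by exact: exprn_gt0.
  rewrite exprMn exprVn ler_pdivlMr// -[leRHS]mulr1 -ler_pdivrMl//.
  apply: le_trans H; rewrite [leRHS]mulrA [leLHS]mulrC ler_wpM2l//.
    by have /andP[y0 y1] := xn n x Ix; rewrite mulr_ge0 ?exprn_ge0 ?subr_ge0.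
- rewrite -[X in _ --> X]subr0; apply: cvgB; first exact: cvg_cst.
  by apply: cvg_expr; rewrite ger0_norm ?divr_ge0 ?(ltW a0) ?(ltW xp)// ltr_pdivrMr// mul1r.
- exact: cvg_cst.
Qed.

End RayApproximation.

(** * From indicators to all square-integrable functions *)

Section PolynomialDensity.
Variable R : realType.
Local Notation I := (@unit_itv R).
Implicit Types (f g : R -> R) (p : {poly R}).

Lemma poly_approx_cst (c : R) : poly_approx (fun=> c).
Proof.
by apply: poly_approx_eq (poly_approx_horner c%:P) => x _; rewrite hornerC.
Qed.

(** Open rays are stable under intersection and generate the Borel sets, so Dynkin's theorem leaves
    rays, complements and countable disjoint unions. On [0,1] a ray starting at or below 0 is almost
    everywhere 1, and one starting at or above 1 is 0. *)
Lemma poly_approx_indic (A : set R) : measurable A -> poly_approx (\1_A : R -> R).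
Proof.
move=> mA.
have sA : (@RGenOInfty.G R).-sigma.-measurable A by rewrite -RGenOInfty.measurableE.
apply: (@dynkin_induction _ _ (@RGenOInfty.G R)
  (fun A : set R => poly_approx (\1_A : R -> R)) (RGenOInfty.measurableE R)) sA.
- move=> _ _ [x ->] [y ->]; exists (Num.max x y); apply/seteqP; split=> z /=.
    by rewrite !in_itv /= !andbT gt_max => -[-> ->].
  by rewrite !in_itv /= !andbT gt_max => /andP[-> ->].
- by rewrite indicT; exact: poly_approx_cst.
- move=> _ [a ->]; have [a0|a0] := leP a 0; last first.
    have [a1|a1] := ltP a 1; first by apply: poly_approx_ray; rewrite a0.
    apply: poly_approx_eq (poly_approx_cst 0) => x.
    rewrite inE /unit_itv /= in_itv /= => /andP[_ x1].
    rewrite indicE memNset //= in_itv /= andbT; apply/negP.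
    by rewrite -leNgt (le_trans x1).
  apply: (@poly_approx_cvg _ _ (fun _ => cst 1) (cst 1)).
  + exact: indic_rL2.
  + exact: rL2_cst.
  + by move=> _; exact: poly_approx_cst.
  + move=> _ x _; rewrite indicE /=; case: (_ \in _) => /=; rewrite ?subrr ?normr0//.
    by rewrite sub0r normrN normr1.
  exists [set 0]; split => //; first by rewrite lebesgue_measure_set1.
  move=> x /= /not_implyP[+ H]; rewrite /unit_itv /= in_itv /= => /andP[x0 _].
  apply: contra_notP H => /eqP x1; rewrite indicE mem_set /=; first exact: cvg_cst.
  by rewrite in_itv /= andbT (le_lt_trans a0)// lt_neqAle eq_sym x1.
- move=> S mS PS; apply: poly_approx_eq (poly_approx_lin 1 (-1) (poly_approx_cst 1) PS).
  move=> x _; rewrite !indicE in_setC; case: (_ \in _) => /=; ring.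
- move=> F mF tF PF.
  have FE x k n : F k x -> \sum_(i < n) \1_(F i) x = (k < n)%:R :> R.
    move=> Fkx; elim: n => [|n IH]; first by rewrite big_ord0.
    rewrite big_ord_recr /= IH indicE [in RHS]ltnS [in RHS]leq_eqVlt.
    have [<-|kn] := eqVneq k n; first by rewrite mem_set// ltnn add0r.
    rewrite memNset ?addr0//= => Fnx.
    by move/eqP: kn; apply; apply: (tF k n) => //; exists x.
  have FN x n : ~ (\bigcup_k F k) x -> \sum_(i < n) \1_(F i) x = 0 :> R.
    move=> Ux; apply: big1 => i _; rewrite indicE memNset// => Fix.
    by apply: Ux; exists i.
  apply: (@poly_approx_cvg _ _ (fun n x => \sum_(i < n) \1_(F i) x) (cst 1)).
  + by apply: indic_rL2; exact: bigcup_measurable.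
  + exact: rL2_cst.
  + elim=> [|n IH].
      by apply: poly_approx_eq (poly_approx_cst 0) => x _; rewrite big_ord0.
    apply: poly_approx_eq (poly_approx_lin 1 1 IH (PF n)) => x _.
    by rewrite big_ord_recr /= !mul1r.
  + move=> n x _; rewrite indicE; have [[k _ Fkx]|Ux] := pselect ((\bigcup_k F k) x).
      rewrite mem_set ?(FE x k)//=; last by exists k.
      by case: (k < n)%N; rewrite /= ?subrr ?normr0 ?subr0 ?normr1.
    by rewrite memNset// FN//= subrr normr0.
  apply: aeW => x _; rewrite indicE.
  have [[k _ Fkx]|Ux] := pselect ((\bigcup_k F k) x).
    rewrite mem_set /=; last by exists k.
    apply: cvg_near_cst; exists k.+1 => // n /= kn.
    by rewrite (FE x k)// kn.
  rewrite memNset//=; apply: cvg_near_cst; apply: nearW => n; exact: FN.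
Qed.

Import HBSimple HBNNSimple.

Lemma poly_approx_nnsfun (h : {nnsfun R >-> R}) : poly_approx h.
Proof.
have H x : h x = \sum_(y \in range h) (y * \1_(h @^-1` [set y]) x) by exact: fimfunE.
have {}H x : h x = \sum_(y <- fset_set (range h)) (y * \1_(h @^-1` [set y]) x).
  by rewrite H fsbig_finite//=.
apply: (@poly_approx_eq _ (fun x => \sum_(y <- fset_set (range h)) (y * \1_(h @^-1` [set y]) x))).
  by move=> x _; rewrite H.
elim: (finmap.enum_fset _) => [|y r IH].
  by apply: poly_approx_eq (poly_approx_cst 0) => x _; rewrite big_nil.
apply: poly_approx_eq (poly_approx_lin y 1 (poly_approx_indic _) IH).
  by move=> x _; rewrite big_cons mul1r.
exact: measurable_sfunP.
Qed.

(** Simple functions increase to [g], so the errors are dominated by [g] itself. *)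
Lemma poly_approx_ge0 g : rL2 g -> (forall x, I x -> 0 <= g x) -> poly_approx g.
Proof.
move=> Lg g0; case: (Lg) => mg _.
have mg' : measurable_fun I (EFin \o g) by exact/measurable_EFinP.
pose f n : R -> R := nnsfun_approx (@measurable_unit_itv R) mg' n.
have g0' x : I x -> (0 <= (EFin \o g) x)%E by move=> Ix; rewrite lee_fin g0.
apply: (@poly_approx_cvg _ g f g) => //.
- by move=> n; exact: poly_approx_nnsfun.
- move=> n x Ix; rewrite /f nnsfun_approxE.
  have := le_approx n g0' Ix.
  rewrite lee_fin => fg; rewrite ger0_norm ?subr_ge0// gerBl.
  by rewrite -nnsfun_approxE.
- apply: aeW => x Ix.
  have := cvg_nnsfun_approx (@measurable_unit_itv R) mg' g0' Ix.
  by move=> /fine_cvg.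
Qed.

Lemma rL2_poly_approx g : rL2 g -> poly_approx g.
Proof.
move=> Lg; have [mg g2] := Lg.
have mn : measurable_fun I (fun x => `|g x|) by exact: measurableT_comp.
have Ln : rL2 (fun x => `|g x|).
  split => //; apply: eq_integrable g2 => // x _.
  by rewrite /= real_normK ?num_real.
have H1 : poly_approx (fun x => 1 * `|g x| + 1 * g x).
  apply: poly_approx_ge0; first exact: rL2_lin.
  by move=> x _; rewrite !mul1r -[X in _ + X]opprK subr_ge0 -normrN ler_norm.
have H2 : poly_approx (fun x => `|g x|) by apply: poly_approx_ge0.
apply: poly_approx_eq (poly_approx_lin 1 (-1) H1 H2) => x _; ring.
Qed.

End PolynomialDensity.

(** * The Hardy operator on real functions *)

Section Hardy.
Variable R : realType.
Local Notation mu := (@lebesgue_measure R).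
Local Notation I := (@unit_itv R).
Implicit Types (f g : R -> R) (p : {poly R}).

Definition hop g (x : R) : R := x^-1 * \int[mu]_(t in `[0, x]) g t.
Definition Bop g (x : R) : R := g x - hop g x.
Definition avg g : R := \int[mu]_(t in I) g t.

Lemma sub_unit_itv x : I x -> (`[0, x] : set R) `<=` I.
Proof.
rewrite /unit_itv /= in_itv /= => /andP[_ x1] t /=; rewrite !in_itv /=.
by move=> /andP[-> /le_trans ->].
Qed.

Lemma rL2_integrable_sub g x : rL2 g -> I x -> mu.-integrable `[0, x] (EFin \o g).
Proof.
move=> /rL2_integrable jg Ix.
by apply: integrableS jg => //; exact: sub_unit_itv.
Qed.

(** Cauchy-Schwarz against the indicator of [[0, x]], whose squared norm is [x]. This makes
    [hop g x] continuous in [g] for the L^2 norm at each point. *)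
Lemma Rintegral_prefix_sqr g x : rL2 g -> I x ->
  (\int[mu]_(t in `[0, x]) g t) ^+ 2 <= x * sq g.
Proof.
move=> Lg Ix.
have x0 : 0 <= x by move: Ix; rewrite /unit_itv /= in_itv /= => /andP[].
have E f : \int[mu]_(t in `[0, x]) f t = ip f (\1_(`[0, x])).
  have := setIidr (sub_unit_itv Ix); set J := (X in _ `&` X) => IJ.
  rewrite -[X in Rintegral _ X]IJ Rintegral_mkcondr /ip.
  apply: eq_Rintegral => t _; rewrite patchE indicE.
  by case: (_ \in _); rewrite ?mulr1 ?mulr0.
rewrite E (le_trans (cauchy_schwarz _ _))//; first exact: indic_rL2.
rewrite mulrC ler_wpM2r ?sq_ge0// le_eqVlt; apply/orP; left; apply/eqP.
transitivity (ip (fun=> 1) (\1_(`[0, x]) : R -> R)).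
  by apply: eq_Rintegral => t _; rewrite indicE; case: (_ \in _); rewrite /= ?expr1n ?expr0n ?mulr1 ?mulr0.
have mx : mu `[0, x] = x%:E.
  rewrite lebesgue_measure_itv /= lte_fin; case: ltP => [_|x0'].
    by rewrite -EFinB subr0.
  by congr EFin; apply/eqP; rewrite eq_le x0 x0'.
by rewrite -E Rintegral_cst// mul1r; exact: (congr1 fine mx).
Qed.

Lemma avg_sqr g : rL2 g -> (avg g) ^+ 2 <= sq g.
Proof.
move=> Lg; have := @Rintegral_prefix_sqr g 1 Lg; rewrite mul1r; apply.
by rewrite /unit_itv /= in_itv /= ler01 lexx.
Qed.

Lemma avg_lin f g a b : rL2 f -> rL2 g ->
  avg (fun x => a * f x + b * g x) = a * avg f + b * avg g.
Proof. by move=> Lf Lg; apply: Rintegral_lin => //; exact: rL2_integrable. Qed.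

Lemma hop_lin f g a b x : rL2 f -> rL2 g -> I x ->
  hop (fun x => a * f x + b * g x) x = a * hop f x + b * hop g x.
Proof.
move=> Lf Lg Ix; rewrite /hop Rintegral_lin//; first by ring.
- exact: rL2_integrable_sub.
- exact: rL2_integrable_sub.
Qed.

Lemma Bop_lin f g a b x : rL2 f -> rL2 g -> I x ->
  Bop (fun x => a * f x + b * g x) x = a * Bop f x + b * Bop g x.
Proof. by move=> Lf Lg Ix; rewrite /Bop hop_lin//; ring. Qed.

Lemma Rintegral_deriv_horner p x : 0 <= x ->
  \int[mu]_(t in `[0, x]) (p^`()).[t] = p.[x] - p.[0].
Proof.
rewrite le_eqVlt => /orP[/eqP <-|x0].
  by rewrite set_itv1 Rintegral_set1 subrr.
rewrite /Rintegral (@continuous_FTC2 _ (horner p^`()) (horner p))//.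
- exact/continuous_subspaceT/continuous_horner.
- split; first by move=> ? _; exact: derivable_horner.
    by apply: cvg_at_right_filter; exact: continuous_horner.
  by apply: cvg_at_left_filter; exact: continuous_horner.
- by move=> t _; rewrite derivE.
Qed.

(** The Hardy image of [p]: multiplied by ['X] it is the primitive of [p] that vanishes at 0. *)
Definition Kp p : {poly R} := \poly_(j < size p) (p`_j / j.+1%:R).

Lemma deriv_XKp p : ('X * Kp p)^`() = p.
Proof.
apply/polyP => j; rewrite coef_deriv coefXM /= coef_poly.
case: ltnP => [_|jp]; last by rewrite mul0rn nth_default.
by rewrite -[LHS]mulr_natr divfK// pnatr_eq0.
Qed.

Lemma hop_horner p x : 0 < x -> hop (horner p) x = (Kp p).[x].
Proof.
move=> x0; rewrite /hop -{1}(deriv_XKp p) Rintegral_deriv_horner ?ltW//.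
by rewrite !hornerE ?mul0r ?subr0 mulKf// gt_eqF.
Qed.

Lemma hop0 g : hop g 0 = 0.
Proof. by rewrite /hop invr0 mul0r. Qed.

(** As the inverse of 0 is 0, [hop] vanishes at 0, where [Kp p] may not; the indicator accounts for
    this and gives measurability. *)
Lemma hop_horner_unit p x : I x -> hop (horner p) x = (Kp p).[x] * \1_(~` [set 0]) x.
Proof.
rewrite /unit_itv /= in_itv /= => /andP[+ _]; rewrite le_eqVlt => /orP[/eqP <-|x0].
  by rewrite hop0 indicE memNset ?mulr0//=; apply.
rewrite hop_horner// indicE mem_set ?mulr1//= => x0'.
by rewrite x0' ltxx in x0.
Qed.

Lemma measurable_hop_horner p : measurable_fun I (hop (horner p)).
Proof.
apply: (@eq_measurable_fun _ _ _ _ _ (fun x => (Kp p).[x] * \1_(~` [set 0]) x)).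
  by move=> x; rewrite inE => /hop_horner_unit ->.
apply: measurable_funM; first exact: measurable_horner.
by apply: measurable_indic; apply: measurableC.
Qed.

Lemma ae_eq_unit f g : (forall x, I x -> x != 0 -> f x = g x) -> ae_eq mu I f g.
Proof.
move=> fg; exists [set 0]; split => //; first exact: lebesgue_measure_set1.
by move=> x /= /not_implyP[Ix]; apply: contra_notP => /eqP; exact: fg.
Qed.

Lemma Bop_horner p : rL2 (Bop (horner p)) /\
  sq (Bop (horner p)) = sq (horner ('X * (Kp p)^`())).
Proof.
apply: sq_ae_eq; first exact: horner_rL2.
  by apply: measurable_funB; [exact: measurable_horner|exact: measurable_hop_horner].
apply: ae_eq_unit => x Ix x0; rewrite /Bop hop_horner; last first.
  by move: Ix; rewrite /unit_itv /= in_itv /= lt_neqAle eq_sym x0 => /andP[].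
have -> : p.[x] = (Kp p + 'X * (Kp p)^`()).[x].
  by rewrite -{1}[Kp p]mul1r -derivX -derivM deriv_XKp.
by rewrite hornerD; ring.
Qed.

(** With [K = Kp p], the polynomial is [p = K + x K'] and its image under [Bop] is [x K'] off 0. The
    difference of the squares is [K^2 + 2 x K K'], the derivative of [x K^2], whose integral is
    [K(1)^2], the square of the mean of [p]. *)
Lemma sq_Bop_horner p : sq (Bop (horner p)) = sq (horner p) - avg (horner p) ^+ 2.
Proof.
have [_ ->] := Bop_horner p; set K := Kp p.
have pE : p = K + 'X * K^`() by rewrite -{1}[K]mul1r -derivX -derivM deriv_XKp.
have -> : avg (horner p) = K.[1].
  by rewrite /avg -[in LHS](deriv_XKp p) Rintegral_deriv_horner// !hornerE ?mul0r ?subr0.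
have -> : K.[1] ^+ 2 = avg (horner ('X * K ^+ 2)^`()).
  by rewrite /avg Rintegral_deriv_horner// !hornerE ?mul0r ?subr0.
apply/eqP; rewrite eq_sym subr_eq addrC -[X in _ == X + _]mul1r -[X in _ == _ + X]mul1r.
rewrite /sq /avg -Rintegral_lin//; first last.
- exact: (horner_rL2 _).2.
- exact/rL2_integrable/horner_rL2.
apply/eqP; apply: eq_Rintegral => x _.
rewrite {1}pE derivM derivX mul1r expr2 derivM !hornerE; ring.
Qed.

(** Fatou's lemma delivers both membership in L^2 and the bound. It is how [hop g] and the unbounded
    powers are shown to be square-integrable. *)
Lemma sq_fatou (u : nat -> R -> R) g (C : R) : measurable_fun I g ->
  (forall n, rL2 (u n)) -> (forall n, sq (u n) <= C) ->
  (forall x, I x -> u n x @[n --> \oo] --> g x) -> rL2 g /\ sq g <= C.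
Proof.
move=> mg Lu uC ug.
have mu2 n : measurable_fun I (EFin \o (fun x => u n x ^+ 2)).
  by apply/measurable_EFinP; apply: measurable_funX; case: (Lu n).
have := @fatou _ _ R mu I (@measurable_unit_itv R) (fun n => EFin \o (fun x => u n x ^+ 2)) mu2.
have -> : (\int[mu]_(x in I) limn_einf (fun n => (u n x ^+ 2)%:E) =
  \int[mu]_(x in I) (g x ^+ 2)%:E)%E.
  apply: eq_integral => x; rewrite inE => Ix.
  have H : (u n x ^+ 2)%:E @[n --> \oo] --> (g x ^+ 2)%:E.
    apply/cvg_EFin; first exact: nearW.
    by rewrite expr2; apply: cvgM; exact: ug.
  by rewrite is_cvg_limn_einfE; [exact: cvg_lim|apply/cvg_ex; exists (g x ^+ 2)%:E].
move=> H.
have iC : (\int[mu]_(x in I) (g x ^+ 2)%:E <= C%:E)%E.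
  apply: (le_trans (H _)); first by move=> n x _; rewrite lee_fin sqr_ge0.
  rewrite limn_einf_lim; apply: lime_le; first exact: is_cvg_einfs.
  apply: nearW => n.
  have uC' : (\int[mu]_(x in I) (u n x ^+ 2)%:E <= C%:E)%E.
    rewrite -[leLHS]fineK ?lee_fin; first exact: uC.
    by apply: integrable_fin_num => //; case: (Lu n).
  by apply: le_trans uC'; apply: ereal_inf_lbound; exists n => /=.
have Lg : rL2 g.
  split => //; apply/integrableP; split.
    by apply/measurable_EFinP; exact: measurable_funX.
  apply: le_lt_trans (ltry C); apply: le_trans iC.
  rewrite le_eqVlt; apply/orP; left; apply/eqP; apply: eq_integral => x _ /=.
  by rewrite ger0_norm ?sqr_ge0.
split => //; rewrite -lee_fin /sq /Rintegral fineK//.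
by apply: integrable_fin_num => //; case: Lg.
Qed.

End Hardy.

(** * Boundedness of the Hardy operator and the norm identity on L^2 *)

Section HardyPowers.
Variable R : realType.
Local Notation mu := (@lebesgue_measure R).
Local Notation I := (@unit_itv R).
Implicit Types (f g : R -> R) (p : {poly R}).

Lemma sqr_cvg0 (a : nat -> R) : a n ^+ 2 @[n --> \oo] --> (0 : R) ->
  a n @[n --> \oo] --> (0 : R).
Proof.
move=> /cvgrPdist_lt H; apply/cvgrPdist_lt => e e0.
have := H (e ^+ 2) (exprn_gt0 _ e0); apply: filterS => n.
rewrite !sub0r !normrN normrX => h.
by rewrite -(@ltr_pXn2r _ 2)// nnegrE// ltW.
Qed.

Lemma sq_cvg (u : nat -> R -> R) g : rL2 g -> (forall n, rL2 (u n)) ->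
  sq (fun x => g x - u n x) @[n --> \oo] --> (0 : R) ->
  sq (u n) @[n --> \oo] --> sq g.
Proof.
move=> Lg Lu H.
have E n : sq (u n) = sq g - 2 * ip g (fun x => g x - u n x) + sq (fun x => g x - u n x).
  have := sq_lin 1 (-1) Lg (rL2B Lg (Lu n)).
  rewrite (@eq_sq _ _ (u n)) => [->|x _]; ring.
have H2 : ip g (fun x => g x - u n x) @[n --> \oo] --> (0 : R).
  apply: sqr_cvg0; apply: (@squeeze_cvgr _ _ _ _ (cst 0)
      (fun n => sq g * sq (fun x => g x - u n x))).
  - by apply: nearW => n; rewrite sqr_ge0 cauchy_schwarz//; exact: rL2B.
  - exact: cvg_cst.
  - by rewrite -[X in _ --> X](mulr0 (sq g)); apply: cvgM => //; exact: cvg_cst.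
under eq_fun do rewrite E.
have -> : sq g = sq g - 2 * 0 + 0 by rewrite mulr0 subr0 addr0.
apply: cvgD => //; apply: cvgB; first by rewrite mulr0 subr0 addr0; exact: cvg_cst.
by apply: cvgM => //; exact: cvg_cst.
Qed.

(** H is the identity minus the contraction B, hence the factor 4 = 2 + 2. *)
Lemma rL2_hop_horner p : rL2 (hop (horner p)) /\ sq (hop (horner p)) <= 4 * sq (horner p).
Proof.
have [LB _] := Bop_horner p; have Lp := horner_rL2 p.
have E : {in I, (fun x => 1 * p.[x] + (-1) * Bop (horner p) x) =1 hop (horner p)}.
  by move=> x _; rewrite /Bop; ring.
split; first exact: eq_rL2 E (rL2_lin 1 (-1) Lp LB).
rewrite -(eq_sq E); apply: (le_trans (sq_add_le _ _ Lp LB)).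
rewrite sq_Bop_horner; have := sqr_ge0 (avg (horner p)).
rewrite sqrrN; lra.
Qed.

Lemma harmonic_cvg0 (c : R) : c / n.+1%:R @[n --> \oo] --> (0 : R).
Proof.
rewrite -[X in _ --> X](mulr0 c); apply: cvgM; first exact: cvg_cst.
exact: cvg_harmonic.
Qed.

Lemma hop_cvg g (u : nat -> R -> R) x : I x -> rL2 g -> (forall n, rL2 (u n)) ->
  sq (fun x => g x - u n x) @[n --> \oo] --> (0 : R) ->
  hop (u n) x @[n --> \oo] --> hop g x.
Proof.
move=> Ix Lg Lu H; have [->|x0] := eqVneq x 0.
  by under eq_fun do rewrite hop0; rewrite hop0; exact: cvg_cst.
apply: cvgM; first exact: cvg_cst.
apply/subr_cvg0.
apply: sqr_cvg0; apply: (@squeeze_cvgr _ _ _ _ (cst 0)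
      (fun n => x * sq (fun x => g x - u n x))).
- apply: nearW => n; rewrite sqr_ge0 /=.
  have -> : \int[mu]_(t in `[0, x]) u n t - \int[mu]_(t in `[0, x]) g t =
      - \int[mu]_(t in `[0, x]) (g t - u n t).
    by rewrite RintegralB ?opprB//; exact: rL2_integrable_sub.
  by rewrite sqrrN; apply: Rintegral_prefix_sqr => //; exact: rL2B.
- exact: cvg_cst.
- by rewrite -[X in _ --> X](mulr0 x); apply: cvgM => //; exact: cvg_cst.
Qed.

(** Choose polynomials [q n] tending to [g], all within [e]. Then [q n - p] has squared norm at most
    4 e, its Hardy image at most 4 times that, and these images tend pointwise to [hop g - hop p];
    Fatou gives 16 e. *)
Lemma hop_approx g (e : R) : rL2 g -> 0 < e -> rL2 (hop g) /\
  forall p, sq (fun x => g x - p.[x]) <= e -> sq (fun x => hop g x - hop (horner p) x) <= 16 * e.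
Proof.
move=> Lg e0; have [_ Hg] := rL2_poly_approx Lg.
have e0' n : 0 < e / n.+1%:R by rewrite divr_gt0.
pose q n := sval (cid (Hg _ (e0' n))).
have qP n : sq (fun x => g x - (q n).[x]) <= e / n.+1%:R := svalP (cid (Hg _ (e0' n))).
have qe n : sq (fun x => g x - (q n).[x]) <= e.
  by rewrite (le_trans (qP n))// ler_pdivrMr// ler_pMr// ler1n.
have q0 : sq (fun x => g x - (q n).[x]) @[n --> \oo] --> (0 : R).
  apply: (@squeeze_cvgr _ _ _ _ (cst 0) (fun n => e / n.+1%:R)).
  - by apply: nearW => n; rewrite sq_ge0 qP.
  - exact: cvg_cst.
  - exact: harmonic_cvg0.
have qx x : I x -> hop (horner (q n)) x @[n --> \oo] --> hop g x.
  by move=> Ix; apply: hop_cvg => // n; exact: horner_rL2.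
have mh : measurable_fun I (hop g).
  apply/measurable_EFinP.
  apply: (emeasurable_fun_cvg (fun n x => (hop (horner (q n)) x)%:E)).
    by move=> n; apply/measurable_EFinP; exact: measurable_hop_horner.
  by move=> x Ix; apply/cvg_EFin; [exact: nearW|exact: qx].
have key p : sq (fun x => g x - p.[x]) <= e ->
    rL2 (fun x => hop g x - hop (horner p) x) /\ sq (fun x => hop g x - hop (horner p) x) <= 16 * e.
  move=> pe; apply: (@sq_fatou _ (fun n => hop (horner (q n - p)))).
  - by apply: measurable_funB => //; exact: measurable_hop_horner.
  - by move=> n; have [] := rL2_hop_horner (q n - p).
  - move=> n; have [_ /le_trans] := rL2_hop_horner (q n - p); apply.
    have -> : 16 * e = 4 * (4 * e) by ring.
    rewrite ler_pM2l//.
    rewrite (@eq_sq _ _ (fun x => 1 * (g x - p.[x]) + (-1) * (g x - (q n).[x]))); last first.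
      by move=> x _; rewrite !hornerE; ring.
    apply: (le_trans (sq_add_le _ _ _ _)); [exact/rL2B/horner_rL2..|].
    have := qe n; lra.
  - move=> x Ix.
    have E n : hop (horner (q n - p)) x = hop (horner (q n)) x - hop (horner p) x.
      have := hop_lin 1 (-1) (horner_rL2 (q n)) (horner_rL2 p) Ix.
      rewrite mul1r mulN1r => <-; rewrite /hop; congr (_ * _).
      by apply: eq_Rintegral => t _; rewrite hornerD hornerN mul1r mulN1r.
    by under eq_fun do rewrite E; apply: cvgB; [exact: qx|exact: cvg_cst].
split; last by move=> p /key[].
have [L1 _] := key _ (qe 0%N); have [L2 _] := rL2_hop_horner (q 0%N).
have := rL2_lin 1 1 L1 L2; apply: eq_rL2 => x _; ring.
Qed.

Lemma rL2_hop g : rL2 g -> rL2 (hop g).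
Proof. by move=> Lg; have [] := hop_approx Lg ltr01. Qed.

Lemma rL2_Bop g : rL2 g -> rL2 (Bop g).
Proof. by move=> Lg; apply: rL2B => //; exact: rL2_hop. Qed.

Lemma poly_seq g : rL2 g -> exists q : nat -> {poly R},
  forall n, sq (fun x => g x - (q n).[x]) <= 1 / n.+1%:R.
Proof.
move=> /rL2_poly_approx[_ Hg].
have e0 n : 0 < 1 / n.+1%:R :> R by rewrite divr_gt0.
by exists (fun n => sval (cid (Hg _ (e0 n)))) => n; exact: (svalP (cid (Hg _ (e0 n)))).
Qed.

(** Each of the three terms is continuous for the L^2 norm, so the identity passes from polynomials
    to their limits. *)
Lemma sq_Bop g : rL2 g -> sq (Bop g) = sq g - avg g ^+ 2.
Proof.
move=> Lg; have [q qP] := poly_seq Lg.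
have Lq n := horner_rL2 (q n).
have q0 : sq (fun x => g x - (q n).[x]) @[n --> \oo] --> (0 : R).
  apply: (@squeeze_cvgr _ _ _ _ (cst 0) (fun n => 1 / n.+1%:R)).
  - by apply: nearW => n; rewrite sq_ge0 qP.
  - exact: cvg_cst.
  - exact: harmonic_cvg0.
have c1 : sq (Bop (horner (q n))) @[n --> \oo] --> sq (Bop g).
  apply: sq_cvg; [exact: rL2_Bop|by move=> n; exact: rL2_Bop|].
  (* Here 34 = 2 + 2 * 16: the error on [g] plus the error on [hop g]. *)
  apply: (@squeeze_cvgr _ _ _ _ (cst 0) (fun n => 34 / n.+1%:R)).
  - apply: nearW => n; rewrite sq_ge0 /=.
    have e0 : 0 < 1 / n.+1%:R :> R by rewrite divr_gt0.
    have [Lh /(_ _ (qP n)) H] := hop_approx Lg e0.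
    rewrite (@eq_sq _ _ (fun x => 1 * (g x - (q n).[x]) +
       (-1) * (hop g x - hop (horner (q n)) x))); last by move=> x _; rewrite /Bop; ring.
    apply: (le_trans (sq_add_le _ _ _ _)); [exact: rL2B|apply: rL2B => //; exact: rL2_hop|].
    have := qP n; have -> : 34 / n.+1%:R = 34 * (1 / n.+1%:R) :> R by rewrite mulrA mulr1.
    move: H; rewrite sqrrN; set d := 1 / _; set s1 := sq _; set s2 := sq _; lra.
  - exact: cvg_cst.
  - exact: harmonic_cvg0.
have c2 : sq (horner (q n)) @[n --> \oo] --> sq g by apply: sq_cvg.
have c3 : avg (horner (q n)) @[n --> \oo] --> avg g.
  apply/subr_cvg0.
  apply: sqr_cvg0; apply: (@squeeze_cvgr _ _ _ _ (cst 0) (fun n => sq (fun x => g x - (q n).[x]))) => //.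
  - apply: nearW => n; rewrite sqr_ge0 /=.
    have -> : avg (horner (q n)) - avg g = - avg (fun x => g x - (q n).[x]).
      by rewrite /avg RintegralB ?opprB//; exact: rL2_integrable.
    by rewrite sqrrN avg_sqr//; exact: rL2B.
  - exact: cvg_cst.
rewrite -(cvg_lim (@Rhausdorff R) c1); apply: cvg_lim; first exact: Rhausdorff.
under eq_fun do rewrite sq_Bop_horner.
by apply: cvgB => //; rewrite !expr2; apply: cvgM.
Qed.

Lemma sq_Bop_le g : rL2 g -> sq (Bop g) <= sq g.
Proof. by move=> Lg; rewrite sq_Bop// gerBl sqr_ge0. Qed.

Lemma sq_hop_le g : rL2 g -> sq (hop g) <= 4 * sq g.
Proof.
move=> Lg; rewrite (@eq_sq _ _ (fun x => 1 * g x + (-1) * Bop g x)); last first.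
  by move=> x _; rewrite /Bop; ring.
apply: (le_trans (sq_add_le _ _ Lg (rL2_Bop Lg))).
have := sq_Bop_le Lg; rewrite sqrrN; lra.
Qed.

End HardyPowers.

(** * Coefficients and Parseval's identity *)

Section Coefficients.
Variable R : realType.
Local Notation mu := (@lebesgue_measure R).
Local Notation I := (@unit_itv R).
Implicit Types (f g : R -> R) (p : {poly R}).

Lemma ae_eq_hop f g x : rL2 f -> rL2 g -> ae_eq mu I f g -> I x -> hop f x = hop g x.
Proof.
move=> [mf _] [mg _] fg Ix; congr (_ * _).
apply: ae_eq_Rintegral => //.
- by apply: measurable_funS mf => //; exact: sub_unit_itv.
- by apply: measurable_funS mg => //; exact: sub_unit_itv.
- by apply: filterS fg => t H Dt; apply: H; exact: sub_unit_itv Dt.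
Qed.

Lemma ae_eq_avg f g : rL2 f -> rL2 g -> ae_eq mu I f g -> avg f = avg g.
Proof. by move=> [mf _] [mg _] fg; exact: ae_eq_Rintegral. Qed.

Lemma ae_eq_Bop f g : rL2 f -> rL2 g -> ae_eq mu I f g -> ae_eq mu I (Bop f) (Bop g).
Proof.
move=> Lf Lg fg; have H := ae_eq_hop Lf Lg fg.
by apply: filterS fg => x fgx Ix; rewrite /Bop fgx// H.
Qed.

Lemma rL2_iter_Bop g n : rL2 g -> rL2 (iter n (@Bop R) g).
Proof. by move=> Lg; elim: n => //= n IH; exact: rL2_Bop. Qed.

Lemma ae_eq_iter_Bop f g n : rL2 f -> rL2 g -> ae_eq mu I f g ->
  ae_eq mu I (iter n (@Bop R) f) (iter n (@Bop R) g).
Proof.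
by move=> Lf Lg fg; elim: n => //= n IH; apply: ae_eq_Bop => //; exact: rL2_iter_Bop.
Qed.

Lemma eq_in_ae_eq f g : {in I, f =1 g} -> ae_eq mu I f g.
Proof. by move=> fg; apply: ae_eq_unit => x Ix _; apply: fg; rewrite inE. Qed.

Lemma iter_Bop_lin f g a b n : rL2 f -> rL2 g ->
  ae_eq mu I (iter n (@Bop R) (fun x => a * f x + b * g x))
     (fun x => a * iter n (@Bop R) f x + b * iter n (@Bop R) g x).
Proof.
move=> Lf Lg; elim: n => [|n IH] /=; first exact: eq_in_ae_eq.
apply: (ae_eq_trans (ae_eq_Bop _ _ IH)).
- by apply: rL2_iter_Bop; exact: rL2_lin.
- by apply: rL2_lin; exact: rL2_iter_Bop.
by apply: eq_in_ae_eq => x; rewrite inE => Ix; rewrite Bop_lin//; exact: rL2_iter_Bop.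
Qed.

Definition rc g k : R := avg (iter k (@Bop R) g).

Lemma ae_eq_rc f g k : rL2 f -> rL2 g -> ae_eq mu I f g -> rc f k = rc g k.
Proof.
move=> Lf Lg fg; apply: ae_eq_avg; [exact: rL2_iter_Bop..|exact: ae_eq_iter_Bop].
Qed.

Lemma rc_lin f g a b k : rL2 f -> rL2 g ->
  rc (fun x => a * f x + b * g x) k = a * rc f k + b * rc g k.
Proof.
move=> Lf Lg; rewrite /rc -avg_lin; [|exact: rL2_iter_Bop..].
apply: ae_eq_avg; last exact: iter_Bop_lin.
- by apply: rL2_iter_Bop; exact: rL2_lin.
- by apply: rL2_lin; exact: rL2_iter_Bop.
Qed.

Lemma rc_Bop g k : rc (Bop g) k = rc g k.+1.
Proof. by rewrite /rc iterSr. Qed.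

Lemma rc_hop g k : rL2 g -> rc (hop g) k = rc g k - rc g k.+1.
Proof.
move=> Lg; rewrite -rc_Bop.
have := rc_lin 1 (-1) k Lg (rL2_Bop Lg); rewrite mul1r mulN1r => <-.
congr rc; apply/funext => x; rewrite /Bop; ring.
Qed.

Lemma sq_iter_Bop g n : rL2 g -> sq g = \sum_(k < n) rc g k ^+ 2 + sq (iter n (@Bop R) g).
Proof.
move=> Lg; elim: n => [|n IH]; first by rewrite big_ord0 add0r.
rewrite big_ord_recr /= sq_Bop; last exact: rL2_iter_Bop.
by rewrite {1}IH /rc; ring.
Qed.

Definition Bstable0 g := rL2 g /\ sq (iter n (@Bop R) g) @[n --> \oo] --> (0 : R).

Lemma Bstable0_lin f g a b : Bstable0 f -> Bstable0 g ->
  Bstable0 (fun x => a * f x + b * g x).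
Proof.
move=> [Lf f0] [Lg g0]; split; first exact: rL2_lin.
apply: (@squeeze_cvgr _ _ _ _ (cst 0) (fun n => 2 * a ^+ 2 * sq (iter n (@Bop R) f)
   + 2 * b ^+ 2 * sq (iter n (@Bop R) g))).
- apply: nearW => n; rewrite sq_ge0 /=.
  have Lfn := rL2_iter_Bop n Lf; have Lgn := rL2_iter_Bop n Lg.
  apply: le_trans (sq_add_le a b Lfn Lgn).
  have L1 := rL2_iter_Bop n (rL2_lin a b Lf Lg).
  have [_ ->//] := sq_ae_eq L1 (rL2_lin a b Lfn Lgn).1 (iter_Bop_lin a b n Lf Lg).
- exact: cvg_cst.
- rewrite [X in _ --> X](_ : 0 = 2 * a ^+ 2 * 0 + 2 * b ^+ 2 * 0); last by ring.
  by apply: cvgD; (apply: cvgM; first exact: cvg_cst).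
Qed.

Lemma iter_Bop_eigen f (l : R) n : rL2 f -> ae_eq mu I (Bop f) (fun x => l * f x) ->
  ae_eq mu I (iter n (@Bop R) f) (fun x => l ^+ n * f x).
Proof.
move=> Lf H; elim: n => [|n IH] /=.
  by apply: eq_in_ae_eq => x _; rewrite expr0 mul1r.
have Ll : rL2 (fun x => l ^+ n * f x).
  by have := rL2_lin (l ^+ n) 0 Lf Lf; apply: eq_rL2 => x _; rewrite mul0r addr0.
apply: (ae_eq_trans (ae_eq_Bop (rL2_iter_Bop n Lf) Ll IH)).
have E : ae_eq mu I (Bop (fun x => l ^+ n * f x)) (fun x => l ^+ n * Bop f x).
  apply: eq_in_ae_eq => x; rewrite inE => Ix.
  rewrite -[RHS]addr0 -(mul0r (Bop f x)) -Bop_lin//; congr (Bop _ x).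
  by apply/funext => t; rewrite mul0r addr0.
apply: (ae_eq_trans E).
by apply: filterS H => x Hx Ix; rewrite Hx// exprSr mulrA.
Qed.

Lemma Bstable0_eigen f (l : R) : rL2 f -> `|l| < 1 ->
  ae_eq mu I (Bop f) (fun x => l * f x) -> Bstable0 f.
Proof.
move=> Lf l1 H; split=> //.
have E n : sq (iter n (@Bop R) f) = (l ^+ 2) ^+ n * sq f.
  have L2 : rL2 (fun x => l ^+ n * f x + 0 * f x) by exact: rL2_lin.
  have H2 : ae_eq mu I (iter n (@Bop R) f) (fun x => l ^+ n * f x + 0 * f x).
    apply: (ae_eq_trans (iter_Bop_eigen n Lf H)).
    by apply: eq_in_ae_eq => x _; rewrite mul0r addr0.
  have [_ <-] := sq_ae_eq (rL2_iter_Bop n Lf) L2.1 H2.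
  by rewrite sq_lin// -exprM mulnC exprM mulr0 mul0r expr0n /= mul0r !addr0.
rewrite (eq_cvg _ _ E).
have l21 : `|l ^+ 2| < 1 by rewrite normrX exprn_ilt1.
have H0 : (l ^+ 2) ^+ n * sq f @[n --> \oo] --> 0 * sq f.
  by apply: cvgM; [exact: cvg_expr|exact: cvg_cst].
by rewrite mul0r in H0; exact: H0.
Qed.

Lemma Bop_Xn j : ae_eq mu I (Bop (horner 'X^j)) (fun x => j%:R / j.+1%:R * ('X^j).[x]).
Proof.
apply: ae_eq_unit => x Ix x0.
have xp : 0 < x by move: Ix; rewrite /unit_itv /= in_itv /= lt_neqAle eq_sym x0 => /andP[].
have -> : 'X^j = (j.+1%:R^-1 *: 'X^(j.+1))^`() :> {poly R}.
  by rewrite derivZ derivXn /= -scalerMnr scalerMnl -(mulr_natr (j.+1%:R^-1)) mulVf ?scale1r// pnatr_eq0.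
rewrite /Bop /hop Rintegral_deriv_horner ?ltW//.
rewrite derivZ derivXn /= !hornerE expr0n /= mulr0 subr0 hornerMn hornerXn.
rewrite -[x ^+ j *+ _]mulr_natr exprS -natr1; field.
by rewrite natr1 pnatr_eq0 x0.
Qed.

Lemma Bstable0_horner p : Bstable0 (horner p).
Proof.
have H0 : Bstable0 (fun=> 0).
  apply: (@Bstable0_eigen _ 0); [exact: rL2_cst|by rewrite normr0|].
  apply: eq_in_ae_eq => x _; rewrite /Bop /hop mul0r sub0r.
  by rewrite /Rintegral integral0 mulr0 oppr0.
rewrite -(coefK p) poly_def.
elim: (size p) => [|n IH].
  by rewrite big_ord0 horner0_ext.
rewrite big_ord_recr /=.
have H1 : Bstable0 (horner ('X^n : {poly R})).
  apply: Bstable0_eigen (Bop_Xn n); first exact: horner_rL2.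
  by rewrite ger0_norm ?divr_ge0// ltr_pdivrMr// mul1r ltr_nat.
have := Bstable0_lin 1 p`_n IH H1.
rewrite (_ : (fun x => _) = horner (\sum_(i < n) p`_i *: 'X^i + p`_n *: 'X^n))//.
by apply/funext => x; rewrite hornerD hornerZ mul1r.
Qed.

(** The iterates of B are contractions, so convergence to 0 extends from the dense polynomials to
    every [g]. *)
Lemma iter_Bop_cvg0 g : rL2 g -> sq (iter n (@Bop R) g) @[n --> \oo] --> (0 : R).
Proof.
move=> Lg; apply/cvgrPdist_le => e e0.
have e4 : 0 < e / 4 by rewrite divr_gt0.
have [_ /(_ _ e4)[p pe]] := rL2_poly_approx Lg.
have [Lp /cvgrPdist_le /(_ _ e4)] := Bstable0_horner p.
apply: filterS => n; rewrite !sub0r !normrN !ger0_norm ?sq_ge0// => H.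
have Lr : rL2 (fun x => g x - p.[x]) by exact: rL2B.
have gE : g = fun x => 1 * p.[x] + 1 * (g x - p.[x]) by apply/funext => x; ring.
rewrite gE.
have Lpn := rL2_iter_Bop n Lp; have Lrn := rL2_iter_Bop n Lr.
have [_ <-] := sq_ae_eq (rL2_iter_Bop n (rL2_lin 1 1 Lp Lr))
  (rL2_lin 1 1 Lpn Lrn).1 (iter_Bop_lin 1 1 n Lp Lr).
apply: (le_trans (sq_add_le _ _ Lpn Lrn)).
have : sq (iter n (@Bop R) (fun x => g x - p.[x])) <= sq (fun x => g x - p.[x]).
  by rewrite [leRHS](sq_iter_Bop n)// lerDr sumr_ge0// => k _; exact: sqr_ge0.
by move: H pe; set s1 := sq _; set s2 := sq _; set s3 := sq _; lra.
Qed.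

Lemma rc_parseval g : rL2 g -> \sum_(k < n) rc g k ^+ 2 @[n --> \oo] --> sq g.
Proof.
move=> Lg; have E n : \sum_(k < n) rc g k ^+ 2 = sq g - sq (iter n (@Bop R) g).
  by rewrite (sq_iter_Bop n Lg) addrK.
rewrite (eq_cvg _ _ E).
have H0 : sq g - sq (iter n (@Bop R) g) @[n --> \oo] --> sq g - 0.
  by apply: cvgB; [exact: cvg_cst|exact: iter_Bop_cvg0].
by rewrite subr0 in H0; exact: H0.
Qed.

End Coefficients.

(** * Powers and oscillating powers *)

Section Oscillating.
Variable R : realType.
Local Notation mu := (@lebesgue_measure R).
Local Notation I := (@unit_itv R).
Implicit Types (a b c p q t x : R).

(** Real form of the power with exponent c + i b: its real part is [p = 1, q = 0] and its imaginary
    part [p = 0, q = 1]. The family is closed under derivation, which lowers [c] by one and acts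
    linearly on [(p, q)]. *)
Definition osc c b p q t : R := t `^ c * (p * cos (b * ln t) + q * sin (b * ln t)).

Lemma is_derive_osc c b p q t : 0 < t ->
  is_derive t 1 (osc c b p q) (osc (c - 1) b (c * p + b * q) (c * q - b * p) t).
Proof.
move=> t0.
have dl : is_derive t 1 (fun x => b * ln x) (b * t^-1).
  have := @is_deriveZ _ _ _ (@ln R) b t 1 _ (is_derive1_ln t0); exact.
have dc : is_derive t 1 (fun x => cos (b * ln x)) (- sin (b * ln t) * (b * t^-1)).
  exact: (@is_derive1_comp _ cos (fun x => b * ln x) t _ _ _ dl).
have ds : is_derive t 1 (fun x => sin (b * ln x)) (cos (b * ln t) * (b * t^-1)).
  exact: (@is_derive1_comp _ sin (fun x => b * ln x) t _ _ _ dl).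
have dp := is_derive1_powR c t0.
have dcs : is_derive t 1 (fun x => p * cos (b * ln x) + q * sin (b * ln x))
    (p * (- sin (b * ln t) * (b * t^-1)) + q * (cos (b * ln t) * (b * t^-1))).
  by apply: is_deriveD; apply: is_deriveZ.
have H := @is_deriveM _ _ _ _ t 1 _ _ dp dcs.
apply: (is_derive_eq H).
have -> : t `^ c = t * t `^ (c - 1).
  rewrite -{2}(powRr1 (ltW t0)) -powRD ?(gt_eqF t0) ?implybT//.
  by congr (_ `^ _); ring.
rewrite /osc; change (fun x : R => x `^ c) with (powR ^~ c).
rewrite -![_ *: _]/(_ * _).
by field; rewrite gt_eqF.
Qed.

(** The interval starts at [e > 0] because powers of negative exponent are singular at 0; the left
    end is sent to 0 afterwards. *)
Lemma ftc_pos (F f : R -> R) e x : (forall t, 0 < t -> is_derive t 1 F (f t)) ->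
  (forall t, 0 < t -> derivable f t 1) -> 0 < e -> e < x ->
  \int[mu]_(t in `[e, x]) f t = F x - F e.
Proof.
move=> dF df e0 ex.
have cont (g : R -> R) t : derivable g t 1 -> {for t, continuous g}.
  by move=> /derivable1_diffP /differentiable_continuous.
have dF' t : 0 < t -> derivable F t 1 by move=> /dF[].
rewrite /Rintegral (@continuous_FTC2 _ f F)//.
- apply: continuous_in_subspaceT => t; rewrite inE /= in_itv /= => /andP[et _].
  by apply: cont; apply: df; exact: lt_le_trans et.
- split.
  + move=> t; rewrite in_itv /= => /andP[et _]; apply: dF'; exact: lt_trans et.
  + by apply: cvg_at_right_filter; apply: cont; exact: dF'.
  + by apply: cvg_at_left_filter; apply: cont; apply: dF'; exact: lt_trans ex.
- move=> t; rewrite in_itv /= => /andP[et _].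
  by rewrite derive1E; have [_ ->] := dF t (lt_trans e0 et).
Qed.

Lemma cont_pos_integrable (f : R -> R) e x : (forall t, 0 < t -> derivable f t 1) -> 0 < e ->
  mu.-integrable `[e, x] (EFin \o f).
Proof.
move=> df e0; apply: continuous_compact_integrable; first exact: segment_compact.
apply: continuous_in_subspaceT => t; rewrite inE /= in_itv /= => /andP[et _].
by apply/differentiable_continuous/derivable1_diffP/df; exact: lt_le_trans et.
Qed.

(** Cut off to [[d n, 1]], the integral of the square is at most 1 / (2 a + 1), which is positive
    exactly because [a > -1/2]; Fatou removes the cut-off. *)
Lemma powR_rL2 a : - 2^-1 < a -> rL2 (fun x : R => x `^ a).
Proof.
move=> a2; have c0 : 0 < 2 * a + 1 by lra.
pose d n : R := n.+2%:R^-1.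
have d0 n : 0 < d n by rewrite invr_gt0.
have d1 n : d n < 1 by rewrite invf_lt1// ltr1n.
pose D n : set R := `[d n, 1]%classic.
(* The cut-off functions vanish at 0, but the zeroth power of 0 is 1; the indicator makes their
   limit correct there too. *)
pose g x : R := x `^ a * \1_(~` [set 0]) x.
pose u n x : R := x `^ a * \1_(D n) x.
have mD n : measurable (D n) by exact: measurable_itv.
have mpow (A : set R) : measurable_fun A (fun x => x `^ a).
  by apply: measurable_funTS; exact: measurable_powR.
have ID n : I `&` D n = D n.
  apply/setIidr => x; rewrite /D /unit_itv /= !in_itv /= => /andP[dx ->]; rewrite andbT.
  by rewrite ltW// (lt_le_trans (d0 n)).
have dpow t : 0 < t -> derivable (fun x => x `^ (2 * a)) t 1.
  by move=> t0; have [] := is_derive1_powR (2 * a) t0.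
have uE n : (fun x => u n x ^+ 2) = (fun x => x `^ (2 * a)) \_ (D n).
  apply/funext => x; rewrite /u patchE indicE.
  have [xD|xD] := boolP (x \in D n); last by rewrite mulr0 expr0n.
  have xp : 0 < x.
    by move: xD; rewrite inE /D /= in_itv /= => /andP[dx _]; exact: lt_le_trans (d0 n) dx.
  rewrite mulr1 expr2 -powRD ?(gt_eqF xp) ?implybT//.
  by congr (_ `^ _); ring.
have Lu n : rL2 (u n).
  split; first by apply: measurable_funM => //; exact: measurable_indic.
  rewrite uE -restrict_EFin; apply/integrable_restrict; [exact: mD|done|].
  rewrite ID.
  exact: cont_pos_integrable.
have [||||Lg _] := @sq_fatou _ u g (2 * a + 1)^-1.
- by apply: measurable_funM => //; apply: measurable_indic; exact: measurableC.
- exact: Lu.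
- move=> n; rewrite /sq uE -Rintegral_mkcondr ID /D.
  pose F x := (2 * a + 1)^-1 * x `^ (2 * a + 1).
  have dF t : 0 < t -> is_derive t 1 F (t `^ (2 * a)).
    move=> t0; have H := @is_deriveZ _ _ _ _ (2 * a + 1)^-1 t 1 _ (is_derive1_powR (2 * a + 1) t0).
    apply: (is_derive_eq H).
    by rewrite -[_ *: _]/(_ * _) mulrA mulVf ?gt_eqF// mul1r addrK.
  have -> := ftc_pos dF dpow (d0 n) (d1 n).
  by rewrite /F powR1 mulr1 gerBl mulr_ge0 ?powR_ge0// invr_ge0 ltW.
- move=> x; rewrite /unit_itv /= in_itv /= => /andP[x0 x1].
  have [->|xn0] := eqVneq x 0.
    apply: cvg_near_cst; apply: nearW => n.
    have h1 : ~ D n 0 by rewrite /D /= in_itv /= leNgt d0.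
    have h2 : ~ (~` [set 0]) (0 : R) by apply.
    by rewrite /u /g !indicE !memNset.
  have xp : 0 < x by rewrite lt_neqAle eq_sym xn0.
  apply: cvg_near_cst; exists (Num.trunc x^-1) => // n /= xn.
  have h1 : D n x.
    rewrite /D /= in_itv /= x1 andbT /d -[leRHS]invrK lef_pV2 ?posrE ?invr_gt0// ltW//.
    by rewrite (lt_le_trans (truncnS_gt _))// ler_nat ltnS leqW.
  have h2 : (~` [set 0]) x by exact/eqP.
  by rewrite /u /g !indicE !mem_set.
have [] := @sq_ae_eq _ g (fun x => x `^ a) Lg (mpow _) => //.
apply: ae_eq_unit => x _ x0; rewrite /g indicE mem_set ?mulr1//=.
exact/eqP.
Qed.

End Oscillating.

(** * Square-summable complex sequences *)

Local Open Scope complex_scope.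

Section SquareSummable.
Variable R : realType.
Local Notation C := (R[i]).
Local Notation Re := (@complex.Re R).
Local Notation Im := (@complex.Im R).
Implicit Types (z w a b : C) (u v : nat -> C).

(** The squared modulus, valued in [R] and polynomial in the two parts, so that real arithmetic
    applies directly and no square root occurs. *)
Definition nq z : R := Re z ^+ 2 + Im z ^+ 2.

Lemma nq_normc z : nq z = Normc.normc z ^+ 2.
Proof. by case: z => x y; rewrite /nq /= sqr_sqrtr// addr_ge0 ?sqr_ge0. Qed.

Lemma nq_ge0 z : 0 <= nq z.
Proof. by rewrite addr_ge0 ?sqr_ge0. Qed.

Lemma nqM z w : nq (z * w) = nq z * nq w.
Proof. by case: z w => [x y] [s t]; rewrite /nq /=; ring. Qed.

Lemma nq0 : nq 0 = 0.
Proof. by rewrite /nq /= expr0n addr0. Qed.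

Lemma nq1 : nq 1 = 1.
Proof. by rewrite /nq /= expr1n expr0n addr0. Qed.

Lemma nq_real (x : R) : nq x%:C = x ^+ 2.
Proof. by rewrite /nq /= expr0n addr0. Qed.

Lemma nqN z : nq (- z) = nq z.
Proof. by case: z => x y; rewrite /nq /=; ring. Qed.

Lemma nqJ z : nq (conjc z) = nq z.
Proof. by case: z => x y; rewrite /nq /=; ring. Qed.

Lemma nqX z n : nq (z ^+ n) = nq z ^+ n.
Proof. by elim: n => [|n IH]; rewrite ?expr0 ?nq1// !exprS nqM IH. Qed.

Lemma nq_eq0 z : nq z = 0 -> z = 0.
Proof.
case: z => x y /eqP; rewrite /nq /= paddr_eq0 ?sqr_ge0// !sqrf_eq0.
by move=> /andP[/eqP-> /eqP->].
Qed.

Lemma nqD_le z w : nq (z + w) <= 2 * nq z + 2 * nq w.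
Proof.
case: z w => [x y] [s t]; rewrite /nq /=.
have := sqr_ge0 (x - s); have := sqr_ge0 (y - t); rewrite !sqrrB !sqrrD; lra.
Qed.

Lemma mulJ_nq z : z * conjc z = (nq z)%:C.
Proof. by case: z => x y; rewrite /nq; simpc; congr (_ +i* _) => /=; ring. Qed.

Lemma cReD z w : Re (z + w) = Re z + Re w. Proof. by case: z w => [? ?] []. Qed.
Lemma cImD z w : Im (z + w) = Im z + Im w. Proof. by case: z w => [? ?] []. Qed.
Lemma cReM z w : Re (z * w) = Re z * Re w - Im z * Im w. Proof. by case: z w => [? ?] []. Qed.
Lemma cImM z w : Im (z * w) = Re z * Im w + Im z * Re w. Proof. by case: z w => [? ?] []. Qed.
Lemma cReJ z : Re (conjc z) = Re z. Proof. by case: z. Qed.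
Lemma cImJ z : Im (conjc z) = - Im z. Proof. by case: z. Qed.

Lemma C_eqP z w : Re z = Re w -> Im z = Im w -> z = w.
Proof. by case: z w => [? ?] [? ?] /= -> ->. Qed.

Lemma nqD z w : nq (z + w) = nq z + nq w + 2 * Re (z * conjc w).
Proof. by case: z w => [x y] [s t]; rewrite /nq /=; ring. Qed.

Lemma sqr_Re_le_nq z : Re z ^+ 2 <= nq z.
Proof. by rewrite lerDl sqr_ge0. Qed.

Lemma sqr_Im_le_nq z : Im z ^+ 2 <= nq z.
Proof. by rewrite lerDr sqr_ge0. Qed.

Lemma geometric_mean_le (t x y : R) : 0 <= x -> 0 <= y -> t ^+ 2 <= x * y -> 2 * t <= x + y.
Proof.
move=> x0 y0 txy; rewrite leNgt; apply/negP => H.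
have : (x + y) ^+ 2 < (2 * t) ^+ 2.
  by rewrite ltr_pXn2r// nnegrE ?addr_ge0// ltW// (le_lt_trans _ H)// addr_ge0.
have := sqr_ge0 (x - y); have -> : (x - y) ^+ 2 = (x + y) ^+ 2 - 4 * (x * y) by ring.
have -> : (2 * t) ^+ 2 = 4 * t ^+ 2 by ring.
lra.
Qed.

(** Cauchy-Schwarz by induction: by the inequality of arithmetic and geometric means, the new cross
    term is at most [nq (F i) * B + A * nq (G i)], with [A] and [B] the remaining sums. *)
Lemma nq_sum_mul_le (I : Type) (r : seq I) (F G : I -> C) :
  nq (\sum_(i <- r) F i * G i) <= (\sum_(i <- r) nq (F i)) * (\sum_(i <- r) nq (G i)).
Proof.
elim: r => [|i r IH]; first by rewrite !big_nil nq0 mul0r.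
rewrite !big_cons; move: IH.
set s := \sum_(j <- r) F j * G j; set A := \sum_(j <- r) _; set B := \sum_(j <- r) _.
move=> IH; rewrite nqD nqM.
have A0 : 0 <= A by apply: sumr_ge0 => j _; exact: nq_ge0.
have B0 : 0 <= B by apply: sumr_ge0 => j _; exact: nq_ge0.
have Fi := nq_ge0 (F i); have Gi := nq_ge0 (G i).
have : 2 * Re (F i * G i * conjc s) <= nq (F i) * B + A * nq (G i).
  apply: geometric_mean_le; [exact: mulr_ge0..|].
  apply: (le_trans (sqr_Re_le_nq _)); rewrite !nqM nqJ.
  have := ler_wpM2l (mulr_ge0 Fi Gi) IH.
  by move/le_trans; apply; rewrite le_eqVlt; apply/orP; left; apply/eqP; ring.
lra.
Qed.

Definition ccvg (s : nat -> C) z :=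
  Re (s n) @[n --> \oo] --> Re z /\ Im (s n) @[n --> \oo] --> Im z.

Lemma ccvg_unique s z w : ccvg s z -> ccvg s w -> z = w.
Proof.
move=> [a1 a2] [b1 b2]; apply: C_eqP.
  by rewrite -(cvg_lim (@Rhausdorff R) a1); apply: cvg_lim => //; exact: Rhausdorff.
by rewrite -(cvg_lim (@Rhausdorff R) a2); apply: cvg_lim => //; exact: Rhausdorff.
Qed.

Lemma ccvg_lin s t z w a b : ccvg s z -> ccvg t w ->
  ccvg (fun n => a * s n + b * t n) (a * z + b * w).
Proof.
have mc (c : R) (f : nat -> R) l : f n @[n --> \oo] --> l -> c * f n @[n --> \oo] --> c * l.
  by move=> H; apply: cvgM => //; exact: cvg_cst.
move=> [s1 s2] [t1 t2]; split.
  rewrite !(cReD, cReM).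
  by under eq_cvg do rewrite !(cReD, cReM); apply: cvgD; apply: cvgB; exact: mc.
rewrite !(cImD, cImM).
by under eq_cvg do rewrite !(cImD, cImM); apply: cvgD; apply: cvgD; exact: mc.
Qed.

Lemma ccvgJ s z : ccvg s z -> ccvg (fun n => conjc (s n)) (conjc z).
Proof.
move=> [s1 s2]; split.
  by under eq_cvg do rewrite cReJ; rewrite cReJ.
by under eq_cvg do rewrite cImJ; rewrite cImJ; exact: cvgN.
Qed.

Lemma ccvg_nq s z : ccvg s z -> nq (s n) @[n --> \oo] --> nq z.
Proof. by move=> [s1 s2]; apply: cvgD; rewrite expr2; apply: cvgM. Qed.

Lemma ccvg_nq0 s z : nq (s n - z) @[n --> \oo] --> (0 : R) -> ccvg s z.
Proof.
move=> H; split; apply/subr_cvg0.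
  apply: sqr_cvg0; apply: (@squeeze_cvgr _ _ _ _ (cst 0) (fun n => nq (s n - z))) => //.
    by apply: nearW => n; rewrite sqr_ge0 (le_trans _ (sqr_Re_le_nq _))//; case: (s n) (z) => [? ?] [].
  exact: cvg_cst.
apply: sqr_cvg0; apply: (@squeeze_cvgr _ _ _ _ (cst 0) (fun n => nq (s n - z))) => //.
  by apply: nearW => n; rewrite sqr_ge0 (le_trans _ (sqr_Im_le_nq _))//; case: (s n) (z) => [? ?] [].
exact: cvg_cst.
Qed.

Lemma ccvg_shift s z k : ccvg s z -> ccvg (fun n => s (n + k)%N) z.
Proof.
move=> [s1 s2]; split.
  by have := s1; rewrite -(cvg_shiftn k).
by have := s2; rewrite -(cvg_shiftn k).
Qed.

End SquareSummable.

(** * The inner product of l^2 and the two shifts *)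

Section L2Sequences.
Variable R : realType.
Local Notation C := (R[i]).
Local Notation Re := (@complex.Re R).
Local Notation Im := (@complex.Im R).
Implicit Types (z a b : C) (u v w : nat -> C).

(** A bound on the squared norm that is meaningful for any sequence. The limit [n2] is informative
    only on [l2], whereas errors against finite sums of geometric sequences are estimated before
    their summability is known. *)
Definition n2le u (e : R) := forall n, \sum_(k < n) nq (u k) <= e.

Definition l2 u := exists e, n2le u e.

Definition lc a u b v : nat -> C := fun k => a * u k + b * v k.

Lemma n2le_trans u e e' : e <= e' -> n2le u e -> n2le u e'.
Proof. by move=> ee ue n; exact: le_trans ee. Qed.

Lemma n2le_ge0 u e : n2le u e -> 0 <= e.
Proof. by move=> /(_ 0%N); rewrite big_ord0. Qed.

Lemma n2le_coord u e k : n2le u e -> nq (u k) <= e.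
Proof.
move=> /(_ k.+1); rewrite big_ord_recr /=; apply: le_trans.
by rewrite lerDr sumr_ge0// => i _; exact: nq_ge0.
Qed.

Lemma n2le_lc u v a b e e' : n2le u e -> n2le v e' ->
  n2le (lc a u b v) (2 * nq a * e + 2 * nq b * e').
Proof.
move=> ue ve n; apply: (@le_trans _ _ (2 * nq a * \sum_(k < n) nq (u k)
   + 2 * nq b * \sum_(k < n) nq (v k))).
  rewrite !mulr_sumr -big_split /=; apply: ler_sum => k _.
  by rewrite /lc (le_trans (nqD_le _ _))// !nqM !mulrA.
by apply: lerD; apply: ler_wpM2l => //; rewrite mulr_ge0 ?nq_ge0.
Qed.

Lemma l2_lc u v a b : l2 u -> l2 v -> l2 (lc a u b v).
Proof. by move=> [e ue] [e' ve]; eexists; exact: n2le_lc. Qed.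

Definition bs k u : nat -> C := fun n => u (k + n)%N.

Lemma n2le_bs k u e : n2le u e -> n2le (bs k u) e.
Proof.
move=> ue n; apply: le_trans (ue (k + n)%N).
by rewrite big_split_ord /= lerDr sumr_ge0// => i _; exact: nq_ge0.
Qed.

Lemma l2_bs k u : l2 u -> l2 (bs k u).
Proof. by move=> [e ue]; exists e; exact: n2le_bs. Qed.

Definition fs u : nat -> C := fun n => if n is n'.+1 then u n' else 0.

Lemma n2le_fs u e : n2le u e -> n2le (fs u) e.
Proof.
move=> ue [|n]; first by rewrite big_ord0; exact: n2le_ge0 ue.
rewrite big_ord_recl /= nq0 add0r; exact: (ue n).
Qed.

Lemma l2_fs u : l2 u -> l2 (fs u).
Proof. by move=> [e ue]; exists e; exact: n2le_fs. Qed.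

Definition pdot u v n : C := \sum_(k < n) u k * conjc (v k).

Lemma cReN z : Re (- z) = - Re z. Proof. by case: z. Qed.
Lemma cImN z : Im (- z) = - Im z. Proof. by case: z. Qed.

Lemma Re_sum n (F : nat -> C) : Re (\sum_(k < n) F k) = \sum_(k < n) Re (F k).
Proof. by elim: n => [|n IH]; rewrite ?big_ord0// !big_ord_recr /= cReD IH. Qed.

Lemma Im_sum n (F : nat -> C) : Im (\sum_(k < n) F k) = \sum_(k < n) Im (F k).
Proof. by elim: n => [|n IH]; rewrite ?big_ord0// !big_ord_recr /= cImD IH. Qed.

Lemma conjcM z a : conjc (z * a) = conjc z * conjc a.
Proof. exact: (rmorphM (@conjc R)). Qed.

Lemma conjcD z a : conjc (z + a) = conjc z + conjc a.
Proof. exact: (rmorphD (@conjc R)). Qed.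

Lemma conjc_sum n (F : nat -> C) : conjc (\sum_(k < n) F k) = \sum_(k < n) conjc (F k).
Proof. exact: (raddf_sum (@conjc R)). Qed.

Lemma is_cvg_abs_bounded (x : nat -> R) (B : R) :
  (forall n, \sum_(k < n) `|x k| <= B) -> cvgn (fun n => \sum_(k < n) x k).
Proof.
move=> xB.
have E (y : nat -> R) : (fun n => \sum_(k < n) y k) = series y.
  by apply/funext => n; rewrite /series /= big_mkord.
rewrite E; apply: normed_cvg.
have -> : [normed series x] = (fun n => \sum_(k < n) `|x k|) by exact: (esym (E (fun k => `|x k|))).
apply: nondecreasing_is_cvgn.
  by apply/nondecreasing_seqP => n; rewrite big_ord_recr /= lerDl.
by exists B => _ [n _ <-].
Qed.

Definition dot u v : C :=
  limn (fun n => Re (pdot u v n)) +i* limn (fun n => Im (pdot u v n)).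

(** The real and imaginary parts of [z * conjc w] are at most [nq z + nq w] in absolute value, so
    both real series converge absolutely. *)
Lemma dotP u v : l2 u -> l2 v -> ccvg (pdot u v) (dot u v).
Proof.
move=> [e ue] [e' ve].
have B (f : C -> R) : (forall z w : C, `|f (z * conjc w)| <= nq z + nq w) ->
    cvgn (fun n => \sum_(k < n) f (u k * conjc (v k))).
  move=> fB; apply: (@is_cvg_abs_bounded (fun k => f (u k * conjc (v k))) (e + e')) => n.
  apply: (@le_trans _ _ (\sum_(k < n) (nq (u k) + nq (v k)))); first exact: ler_sum.
  by rewrite big_split /=; exact: (lerD (ue n) (ve n)).
have HR : cvgn (fun n => Re (pdot u v n)).
  have -> : (fun n => Re (pdot u v n)) = (fun n => \sum_(k < n) Re (u k * conjc (v k))).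
    by apply/funext => n; exact: (Re_sum n (fun k => u k * conjc (v k))).
  apply: (B Re) => z w.
  rewrite cReM cReJ cImJ /nq ler_norml; apply/andP.
  by have := sqr_ge0 (Re z + Re w); have := sqr_ge0 (Im z + Im w);
     have := sqr_ge0 (Re z - Re w); have := sqr_ge0 (Im z - Im w); split; nra.
have HI : cvgn (fun n => Im (pdot u v n)).
  have -> : (fun n => Im (pdot u v n)) = (fun n => \sum_(k < n) Im (u k * conjc (v k))).
    by apply/funext => n; exact: (Im_sum n (fun k => u k * conjc (v k))).
  apply: (B Im) => z w.
  rewrite cImM cReJ cImJ /nq ler_norml; apply/andP.
  by have := sqr_ge0 (Re z + Im w); have := sqr_ge0 (Im z + Re w);
     have := sqr_ge0 (Re z - Im w); have := sqr_ge0 (Im z - Re w); split; nra.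
by split; [exact: HR|exact: HI].
Qed.

Lemma dot_eq u v z : l2 u -> l2 v -> ccvg (pdot u v) z -> dot u v = z.
Proof. by move=> lu lv; apply: ccvg_unique; exact: dotP. Qed.

Lemma dot_lc u v w a b : l2 u -> l2 v -> l2 w ->
  dot (lc a u b v) w = a * dot u w + b * dot v w.
Proof.
move=> lu lv lw; apply: dot_eq => //; first exact: l2_lc.
have E : pdot (lc a u b v) w = fun n => a * pdot u w n + b * pdot v w n.
  apply/funext => n; rewrite /pdot !mulr_sumr -big_split /=.
  by apply: eq_bigr => k _; rewrite /lc mulrDl !mulrA.
by rewrite E; apply: ccvg_lin; exact: dotP.
Qed.

Lemma dotC u v : l2 u -> l2 v -> dot v u = conjc (dot u v).
Proof.
move=> lu lv; apply: dot_eq => //.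
have E : pdot v u = fun n => conjc (pdot u v n).
  apply/funext => n; rewrite /pdot (conjc_sum n (fun k => u k * conjc (v k))); apply: eq_bigr => k _.
  by rewrite conjcM conjcK mulrC.
by rewrite E; apply: ccvgJ; exact: dotP.
Qed.

Lemma dot_lcr u v w a b : l2 u -> l2 v -> l2 w ->
  dot w (lc a u b v) = conjc a * dot w u + conjc b * dot w v.
Proof.
move=> lu lv lw; rewrite dotC//; last exact: l2_lc.
by rewrite dot_lc// conjcD !conjcM -!dotC.
Qed.

Definition n2 u : R := Re (dot u u).

Lemma n2_cvg u : l2 u -> \sum_(k < n) nq (u k) @[n --> \oo] --> n2 u.
Proof.
move=> lu; have [H _] := dotP lu lu.
have E n : Re (pdot u u n) = \sum_(k < n) nq (u k).
  rewrite (Re_sum n (fun k => u k * conjc (u k))); apply: eq_bigr => k _.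
  by rewrite mulJ_nq.
by move: H; under eq_cvg do rewrite E.
Qed.

Lemma dot_n2 u : l2 u -> dot u u = (n2 u)%:C.
Proof.
move=> lu; rewrite /n2; have := dotC lu lu.
by case: (dot u u) => x y [] /eqP; rewrite -subr_eq0 opprK -mulr2n mulrn_eq0 => /eqP ->.
Qed.

Lemma n2leP u e : l2 u -> (n2le u e <-> n2 u <= e).
Proof.
move=> lu; split=> [ue|ue n].
  rewrite -(cvg_lim (@Rhausdorff R) (n2_cvg lu)); apply: limr_le.
    by apply/cvg_ex; exists (n2 u); exact: n2_cvg.
  by apply: nearW => n; exact: ue.
apply: le_trans ue.
rewrite -(cvg_lim (@Rhausdorff R) (n2_cvg lu)); apply: limr_ge.
  by apply/cvg_ex; exists (n2 u); exact: n2_cvg.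
exists n => // m /= nm.
rewrite -!(big_mkord xpredT (fun k => nq (u k))) (big_cat_nat (leq0n n) nm)//= lerDl.
by apply: sumr_ge0 => k _; exact: nq_ge0.
Qed.

Lemma n2le_n2 u : l2 u -> n2le u (n2 u).
Proof. by move=> lu; apply/n2leP. Qed.

Lemma n2_ge0 u : l2 u -> 0 <= n2 u.
Proof. by move=> lu; apply: (@n2le_ge0 u); apply/n2leP. Qed.

Lemma n2_lc u v a b : l2 u -> l2 v ->
  n2 (lc a u b v) = nq a * n2 u + nq b * n2 v + 2 * Re (a * conjc b * dot u v).
Proof.
move=> lu lv; rewrite {1}/n2 dot_lc ?dot_lcr//; try exact: l2_lc.
rewrite (dotC lu lv) !dot_n2//.
case: a b (dot u v) => [a1 a2] [b1 b2] [d1 d2]; rewrite /nq /=; ring.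
Qed.

Lemma cauchy_schwarz_dot u v : l2 u -> l2 v -> nq (dot u v) <= n2 u * n2 v.
Proof.
move=> lu lv; have H := ccvg_nq (dotP lu lv).
rewrite -(cvg_lim (@Rhausdorff R) H); apply: limr_le.
  by apply/cvg_ex; exists (nq (dot u v)).
apply: nearW => n; apply: (le_trans (nq_sum_mul_le _ _ _)).
under [X in _ * X <= _]eq_bigr do rewrite nqJ.
by apply: ler_pM; try (apply: sumr_ge0 => k _; exact: nq_ge0); exact: n2le_n2.
Qed.

Lemma dot_fs u v : l2 u -> l2 v -> dot (fs u) v = dot u (bs 1 v).
Proof.
move=> lu lv; apply: ccvg_unique (dotP lu (l2_bs 1 lv)).
have := ccvg_shift 1 (dotP (l2_fs lu) lv).
rewrite (_ : (fun n => _) = pdot u (bs 1 v))//.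
apply/funext => n; rewrite /pdot addn1 big_ord_recl /= mul0r add0r.
by apply: eq_bigr => k _.
Qed.

Definition delta j : nat -> C := fun n => (n == j)%:R.

Lemma sum_delta n j (F : nat -> R) : \sum_(k < n) nq (delta j k) * F k = if (j < n)%N then F j else 0.
Proof.
elim: n => [|n IH]; first by rewrite big_ord0.
rewrite big_ord_recr /= IH /delta; case: (ltngtP j n) => [jn|nj|->].
- by rewrite ltnS ltnW//= nq0 mul0r addr0.
- by rewrite ltnS leqNgt nj /= nq0 mul0r addr0.
- by rewrite /= ltnSn nq1 mul1r add0r.
Qed.

Lemma n2le_delta j : n2le (delta j) 1.
Proof.
move=> n; have := sum_delta n j (fun=> 1).
under eq_bigr do rewrite mulr1; by move=> ->; case: ifP.
Qed.

Lemma l2_delta j : l2 (delta j).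
Proof. by exists 1; exact: n2le_delta. Qed.

Lemma dot_delta u j : l2 u -> dot u (delta j) = u j.
Proof.
move=> lu; apply: dot_eq => //; first exact: l2_delta.
have E n : (j < n)%N -> pdot u (delta j) n = u j.
  move=> jn; rewrite /pdot (bigD1 (Ordinal jn))//= /delta eqxx conjc1 mulr1 big1 ?addr0// => k kj.
  by rewrite (_ : (k == j :> nat) = false) ?conjc0 ?mulr0//; apply/negbTE.
split; apply: cvg_near_cst; exists j.+1 => // n /= jn; by rewrite E.
Qed.

End L2Sequences.

(** * Completeness of l^2 and orthogonal projection *)

Section Projection.
Variable R : realType.
Local Notation C := (R[i]).
Local Notation Re := (@complex.Re R).
Local Notation Im := (@complex.Im R).
Implicit Types (z a b : C) (u v w : nat -> C) (M : set (nat -> C)).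

Lemma real_cauchy_cvg (x : nat -> R) :
  (forall e, 0 < e -> exists N, forall m p, (N <= m)%N -> (N <= p)%N -> (x m - x p) ^+ 2 <= e) ->
  cvgn x.
Proof.
move=> H; apply: cauchy_cvg; apply: cauchy_exP => e e0.
have [N HN] := H ((e / 2) ^+ 2) (exprn_gt0 _ (divr_gt0 e0 (ltr0Sn _ 1))).
exists (x N), N => // n /= Nn; rewrite /ball /=.
have e2 : 0 < e / 2 by rewrite divr_gt0.
have : `|x N - x n| ^+ 2 <= (e / 2) ^+ 2 by rewrite real_normK ?num_real//; exact: HN.
rewrite ler_pXn2r ?nnegrE ?(ltW e2)// => /le_lt_trans; apply.
by rewrite ltr_pdivrMr// ltr_pMr// ltr1n.
Qed.

(** The limit is taken entry by entry. The Cauchy bound on each finite sum survives the limit in one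
    of the two indices, which gives convergence in norm and then square-summability. *)
Lemma l2_complete (U : nat -> nat -> C) : (forall n, l2 (U n)) ->
  (forall e : R, 0 < e -> exists N, forall m p, (N <= m)%N -> (N <= p)%N ->
     n2 (lc 1 (U m) (-1) (U p)) <= e) ->
  exists2 u, l2 u & forall e : R, 0 < e -> exists N, forall m, (N <= m)%N ->
     n2 (lc 1 u (-1) (U m)) <= e.
Proof.
move=> LU HU.
have LUU m p : l2 (lc 1 (U m) (-1) (U p)) by exact: l2_lc.
have coord e k m p : n2 (lc 1 (U m) (-1) (U p)) <= e -> nq (U m k - U p k) <= e.
  move=> /(n2leP _ (LUU m p)).2 /n2le_coord => /(_ k).
  by rewrite /lc mul1r mulN1r.
have cR k : cvgn (fun n => Re (U n k)).
  apply: real_cauchy_cvg => e /HU[N HN]; exists N => m p Nm Np.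
  apply: le_trans (coord _ k _ _ (HN m p Nm Np)).
  by rewrite -cReN -cReD; exact: sqr_Re_le_nq.
have cI k : cvgn (fun n => Im (U n k)).
  apply: real_cauchy_cvg => e /HU[N HN]; exists N => m p Nm Np.
  apply: le_trans (coord _ k _ _ (HN m p Nm Np)).
  by rewrite -cImN -cImD; exact: sqr_Im_le_nq.
pose u k : C := limn (fun n => Re (U n k)) +i* limn (fun n => Im (U n k)).
have uP k : ccvg (fun n => U n k) (u k) by split; [exact: cR|exact: cI].
have key e : 0 < e -> exists N, forall m, (N <= m)%N -> n2le (lc 1 u (-1) (U m)) e.
  move=> /HU[N HN]; exists N => m Nm n.
  have H k : nq (lc 1 (U p) (-1) (U m) k) @[p --> \oo] --> nq (lc 1 u (-1) (U m) k).
    apply: ccvg_nq; apply: ccvg_lin; first exact: uP.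
    by split; exact: cvg_cst.
  have {}H : \sum_(k < n) nq (lc 1 (U p) (-1) (U m) k) @[p --> \oo] -->
      \sum_(k < n) nq (lc 1 u (-1) (U m) k).
    by elim: n => [|n IH]; [under eq_cvg do rewrite big_ord0; rewrite big_ord0; exact: cvg_cst
      |under eq_cvg do rewrite big_ord_recr /=; rewrite big_ord_recr /=; exact: cvgD].
  rewrite -(cvg_lim (@Rhausdorff R) H); apply: limr_le.
    by apply/cvg_ex; eexists; exact: H.
  exists N => // p /= Np; apply: ((n2leP _ (LUU p m)).2 _ n); exact: HN.
have lu : l2 u.
  have [N HN] := key 1 ltr01; have l1 : l2 (lc 1 u (-1) (U N)) by exists 1; exact: HN.
  have := l2_lc 1 1 l1 (LU N).
  rewrite (_ : lc _ _ _ _ = u)//; apply/funext => k; rewrite /lc; ring.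
exists u => // e /key[N HN]; exists N => m Nm.
by apply/n2leP; [exact: l2_lc|exact: HN].
Qed.

Definition subspace_l2 M := [/\ M `<=` @l2 R, M (fun=> 0) &
  forall u v a b, M u -> M v -> M (lc a u b v)].

Definition closed_l2 M := forall u, l2 u ->
  (forall e : R, 0 < e -> exists2 v, M v & n2 (lc 1 u (-1) v) <= e) -> M u.

Lemma conjcN z : conjc (- z) = - conjc z.
Proof. exact: (raddfN (@conjc R)). Qed.

Lemma parallelogram u v : l2 u -> l2 v ->
  n2 (lc 1 u (-1) v) = 2 * n2 u + 2 * n2 v - n2 (lc 1 u 1 v).
Proof.
move=> lu lv; rewrite !n2_lc// nqN nq1 !mul1r; set d := dot u v.
by rewrite conjcN !conjc1 mulN1r mul1r cReN; ring.
Qed.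

Lemma n2Z u a : l2 u -> n2 (fun k => a * u k) = nq a * n2 u.
Proof.
move=> lu; have := n2_lc a 0 lu lu; rewrite nq0 mul0r conjc0 mulr0 mul0r /= mulr0 !addr0.
by move=> <-; congr n2; apply/funext => k; rewrite /lc mul0r addr0.
Qed.

(** A minimizing sequence for the distance is Cauchy by the parallelogram law, its midpoints being
    in [M]; at the minimum, moving along [v] cannot decrease the distance, which forces
    orthogonality. *)
Lemma projection_exists M g : subspace_l2 M -> closed_l2 M -> l2 g ->
  exists2 m, M m & forall v, M v -> dot (lc 1 g (-1) m) v = 0.
Proof.
move=> [Ml M0 Mlc] Mc lg.
pose D : set R := [set n2 (lc 1 g (-1) v) | v in M].
have lgv v : M v -> l2 (lc 1 g (-1) v) by move=> /Ml; exact: l2_lc.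
have Dlb : has_lbound D by exists 0 => _ [v Mv <-]; apply: n2_ge0; exact: lgv.
have D0 : D !=set0 by eexists; exists (fun=> 0); [exact: M0|reflexivity].
pose d := inf D.
have dle v : M v -> d <= n2 (lc 1 g (-1) v) by move=> Mv; apply: ge_inf => //; exists v.
have minseq n : exists v, M v /\ n2 (lc 1 g (-1) v) <= d + n.+1%:R^-1.
  have e0 : 0 < n.+1%:R^-1 :> R by rewrite invr_gt0.
  have [_ [v Mv <-] /ltW H] := inf_adherent e0 (conj D0 Dlb).
  by exists v.
have [U HU] := choice minseq.
have MU n : M (U n) := (HU n).1.
have LU n : l2 (U n) := Ml _ (MU n).
have [m lm Hm] : exists2 u, l2 u & forall e : R, 0 < e -> exists N, forall m, (N <= m)%N ->
     n2 (lc 1 u (-1) (U m)) <= e.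
  apply: l2_complete => // e e0.
  have e4 : 0 < 4 / e by rewrite divr_gt0.
  (* Beyond this index the two distances exceed [d] by at most e/4, and 2 (d + e/4) + 2 (d + e/4) -
     4 d = e. *)
  exists (Num.trunc (4 / e)) => p q Np Nq.
  have inve r : (Num.trunc (4 / e) <= r)%N -> r.+1%:R^-1 <= e / 4.
    move=> Nr; rewrite -[e / 4]invrK lef_pV2 ?posrE ?invr_gt0 ?divr_gt0// invf_div.
    by rewrite ltW// (lt_le_trans (truncnS_gt _))// ler_nat.
  have := parallelogram (lgv _ (MU q)) (lgv _ (MU p)).
  have -> : lc 1 (lc 1 g (-1) (U q)) (-1) (lc 1 g (-1) (U p)) = lc 1 (U p) (-1) (U q).
    by apply/funext => k; rewrite /lc; ring.
  have -> : lc 1 (lc 1 g (-1) (U q)) 1 (lc 1 g (-1) (U p)) =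
     (fun k => 2 * lc 1 g (-1) (lc 2^-1 (U p) 2^-1 (U q)) k).
    by apply/funext => k; rewrite /lc; field.
  have Mpq : M (lc 2^-1 (U p) 2^-1 (U q)) by exact: Mlc.
  rewrite n2Z; last exact: lgv.
  have -> : nq (2 : C) = 4.
    rewrite (_ : 2 = (2%:R)%:C); last by rewrite rmorph_nat.
    by rewrite nq_real; ring.
  have := dle _ Mpq; have := inve _ Np; have := inve _ Nq.
  have := (HU p).2; have := (HU q).2.
  move: (q.+1%:R^-1 : R) (p.+1%:R^-1 : R) (n2 (lc 1 g _ (U q))) (n2 (lc 1 g _ (U p)))
    (n2 (lc 1 (U p) _ _)) (n2 (lc 1 g _ (lc _ _ _ _))) => x1 x2 x3 x4 x5 x6.
  by clearbody d; lra.
have Mm : M m.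
  by apply: Mc => // e /Hm[N HN]; exists (U N) => //; exact: HN.
exists m => // v Mv.
have lv := Ml _ Mv; have lw := lgv _ Mm; set w := lc 1 g (-1) m in lw *.
have Lm n : l2 (lc 1 m (-1) (U n)) by apply: l2_lc => //; exact: Ml.
have c0 : n2 (lc 1 m (-1) (U n)) @[n --> \oo] --> (0 : R).
  apply/cvgrPdist_le => e /Hm[N HN]; exists N => // n /= Nn.
  by rewrite sub0r normrN ger0_norm ?n2_ge0// HN.
have c1 : Re (dot w (lc 1 m (-1) (U n))) @[n --> \oo] --> (0 : R).
  apply: sqr_cvg0; apply: (@squeeze_cvgr _ _ _ _ (cst 0)
    (fun n => n2 w * n2 (lc 1 m (-1) (U n)))).
  - apply: nearW => n; rewrite sqr_ge0 (le_trans (sqr_Re_le_nq _))//.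
    exact: cauchy_schwarz_dot.
  - exact: cvg_cst.
  - have H : n2 w * n2 (lc 1 m (-1) (U n)) @[n --> \oo] --> n2 w * 0.
      by apply: cvgM => //; exact: cvg_cst.
    by rewrite mulr0 in H; exact: H.
have wd : n2 w <= d.
  have E n : n2 (lc 1 g (-1) (U n)) =
      n2 w + n2 (lc 1 m (-1) (U n)) + 2 * Re (dot w (lc 1 m (-1) (U n))).
    have -> : lc 1 g (-1) (U n) = lc 1 w 1 (lc 1 m (-1) (U n)).
      by apply/funext => k; rewrite /w /lc; ring.
    by rewrite n2_lc// nq1 !mul1r conjc1 mul1r.
  have H1 : n2 (lc 1 g (-1) (U n)) @[n --> \oo] --> n2 w + 0 + 2 * 0.
    rewrite (eq_cvg _ _ E); apply: cvgD; first by apply: cvgD => //; exact: cvg_cst.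
    by apply: cvgM => //; exact: cvg_cst.
  have H2 : d + n.+1%:R^-1 @[n --> \oo] --> d + 0.
    by apply: cvgD; [exact: cvg_cst|exact: cvg_harmonic].
  rewrite mulr0 !addr0 in H1; rewrite addr0 in H2.
  by apply: (ler_cvg_to H1 H2); apply: nearW => n; exact: (HU n).2.
apply: nq_eq0; set c := dot w v.
(* Moving by [t c v] changes the squared distance by [t * nq c * (t * n2 v - 2)]; this [t] keeps
   [t * n2 v] below 1, so the change would be negative if [c] were not 0. *)
pose t := (n2 v + 1)^-1.
have v0 := n2_ge0 lv.
have t0 : 0 < t by rewrite invr_gt0 ltr_wpDl.
have tv : t * n2 v + t = 1 by rewrite -[X in _ + X]mulr1 -mulrDr mulVf// gt_eqF// ltr_wpDl.
have : d <= n2 (lc 1 g (-1) (lc 1 m (t%:C * c) v)) by apply: dle; exact: Mlc.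
have -> : lc 1 g (-1) (lc 1 m (t%:C * c) v) = lc 1 w (- (t%:C * c)) v.
  by apply/funext => k; rewrite /w /lc; ring.
rewrite n2_lc// nq1 !mul1r nqN nqM nq_real -/c.
have -> : Re (conjc (- (t%:C * c)) * c) = - t * nq c.
  by case: (c) => x y; rewrite /nq /=; ring.
have := nq_ge0 c; set q := nq c => q0 H.
have {}H : 0 <= (t * q) * (t * n2 v - 2) by move: H wd; nra.
apply/eqP; rewrite eq_le q0 andbT leNgt; apply/negP => qp.
by move: H; rewrite pmulr_rge0 ?mulr_gt0//; lra.
Qed.

End Projection.

(** * Wandering vectors of the backward shift *)

Section Beurling.
Variable R : realType.
Local Notation C := (R[i]).
Implicit Types (z a b : C) (u v w f g : nat -> C) (M : set (nat -> C)).

Definition trunc n u : nat -> C := fun k => if (k < n)%N then u k else 0.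

Lemma l2_finite n u : (forall k, (n <= k)%N -> u k = 0) -> l2 u.
Proof.
move=> u0; exists (\sum_(k < n) nq (u k)) => m.
have [mn|nm] := leqP m n.
  rewrite -!(big_mkord xpredT (fun k => nq (u k))) [leRHS](big_cat_nat (leq0n m) mn)//= lerDl.
  by apply: sumr_ge0 => k _; exact: nq_ge0.
rewrite -!(big_mkord xpredT (fun k => nq (u k))) (big_cat_nat (leq0n n) (ltnW nm))//=.
by rewrite [X in _ + X]big1_seq ?addr0// => k /=; rewrite mem_index_iota => /andP[nk _]; rewrite u0 ?nq0.
Qed.

Lemma dot_finite n u v : (forall k, (n <= k)%N -> u k = 0) -> l2 v -> dot u v = pdot u v n.
Proof.
move=> u0 lv; apply: dot_eq => //; first exact: l2_finite u0.
have E m : (n <= m)%N -> pdot u v m = pdot u v n.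
  move=> nm; rewrite /pdot -!(big_mkord xpredT (fun k => u k * conjc (v k))).
  rewrite (big_cat_nat (leq0n n) nm)//= [X in _ + X]big1_seq ?addr0// => k /=.
  by rewrite mem_index_iota => /andP[nk _]; rewrite u0// mul0r.
by split; apply: cvg_near_cst; exists n => // m /= nm; rewrite E.
Qed.

Lemma l2_trunc n u : l2 (trunc n u).
Proof. by apply: (@l2_finite n) => k nk; rewrite /trunc ltnNge nk. Qed.

Lemma n2_trunc n u : n2 (trunc n u) = \sum_(k < n) nq (u k).
Proof.
rewrite /n2 (@dot_finite n); last exact: l2_trunc.
  rewrite (Re_sum n (fun k => trunc n u k * conjc (trunc n u k))).
  by apply: eq_bigr => k _; rewrite mulJ_nq /trunc ltn_ord.
by move=> k nk; rewrite /trunc ltnNge nk.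
Qed.

Lemma n2_sub_trunc n u : l2 u -> n2 (lc 1 u (-1) (trunc n u)) = n2 u - \sum_(k < n) nq (u k).
Proof.
move=> lu; rewrite n2_lc//; last exact: l2_trunc.
have -> : dot u (trunc n u) = (n2 (trunc n u))%:C.
  rewrite dotC//; last exact: l2_trunc.
  rewrite -[RHS]conjc_real; congr conjc.
  rewrite -dot_n2; last exact: l2_trunc.
  have H k : (n <= k)%N -> trunc n u k = 0 by move=> nk; rewrite /trunc ltnNge nk.
  rewrite !(dot_finite H)//; last exact: l2_trunc.
  by apply: eq_bigr => k _; rewrite /trunc ltn_ord.
rewrite n2_trunc nqN nq1 conjcN conjc1 !mul1r mulN1r cReN /=; ring.
Qed.

Lemma n2_sub_trunc_cvg u : l2 u -> n2 (lc 1 u (-1) (trunc n u)) @[n --> \oo] --> (0 : R).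
Proof.
move=> lu; rewrite (eq_cvg _ _ (fun n => n2_sub_trunc n lu)).
have H : n2 u - \sum_(k < n) nq (u k) @[n --> \oo] --> n2 u - n2 u.
  by apply: cvgB; [exact: cvg_cst|exact: n2_cvg].
by rewrite subrr in H; exact: H.
Qed.

Lemma n2_eq0 u k : l2 u -> n2 u = 0 -> u k = 0.
Proof.
move=> lu u0; apply: nq_eq0; apply/eqP; rewrite eq_le nq_ge0 andbT -u0.
by apply: n2le_coord; exact: n2le_n2.
Qed.

Lemma dot_fsr u v : l2 u -> l2 v -> dot v (fs u) = dot (bs 1 v) u.
Proof.
move=> lu lv; rewrite dotC//; last exact: l2_fs.
by rewrite dot_fs// -dotC//; exact: l2_bs.
Qed.

Lemma dot_fs_fs u v : l2 u -> l2 v -> dot (fs u) (fs v) = dot u v.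
Proof.
by move=> lu lv; rewrite dot_fs//; exact: l2_fs.
Qed.

Lemma l2_iter_fs k u : l2 u -> l2 (iter k (@fs R) u).
Proof. by move=> lu; elim: k => //= k; exact: l2_fs. Qed.

Lemma dot_iter_fsr k u v : l2 u -> l2 v -> dot v (iter k (@fs R) u) = dot (bs k v) u.
Proof.
move=> lu; elim: k v => [|k IH] v lv //=.
rewrite dot_fsr//; last exact: l2_iter_fs.
by rewrite IH; last exact: l2_bs.
Qed.

Lemma iter_fsE k u i : iter k (@fs R) u i = if (k <= i)%N then u (i - k)%N else 0.
Proof. by elim: k i => [|k IH] [|i] //=; rewrite IH ltnS subSS. Qed.

Lemma dot_cst0 u : l2 u -> dot u (fun=> 0) = 0.
Proof.
move=> lu; have -> : (fun=> 0) = lc 0 u 0 u.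
  by apply/funext => k; rewrite /lc !mul0r addr0.
by rewrite dot_lcr// conjc0 !mul0r addr0.
Qed.

Lemma trunc_in M g n : subspace_l2 M -> (forall j, M (@delta R j)) -> M (trunc n g).
Proof.
move=> [_ M0 Mlc] Md; elim: n => [|n IH].
  by rewrite (_ : trunc 0 g = fun=> 0)//; apply/funext.
rewrite (_ : trunc n.+1 g = lc 1 (trunc n g) (g n) (delta R n)); first exact: Mlc.
apply/funext => k; rewrite /lc /trunc /delta ltnS mul1r.
by case: ltngtP => [kn|kn|->]; rewrite ?mulr0 ?addr0 ?mulr1 ?add0r.
Qed.

(** The operator sending g to the sequence of [dot (bs k g) theta] has norm at most 1, expressed on
    sequences supported below [N]: for them the inner sum stops at [N - k]. *)
Definition toeplitz_contraction (theta : nat -> C) := forall N g,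
  \sum_(k < N) nq (\sum_(j < N - k) conjc (theta j) * g (k + j)%N) <= \sum_(i < N) nq (g i).

Section Wandering.
Variable theta : nat -> C.
Hypothesis ltheta : l2 theta.
Hypothesis ntheta : n2 theta = 1.
Hypothesis wandering : forall d, dot (iter d.+1 (@fs R) theta) theta = 0.

Let V k := iter k (@fs R) theta.

Let lV k : l2 (V k). Proof. exact: l2_iter_fs. Qed.

Let dotVV k d : dot (V (k + d)) (V k) = (d == 0)%N%:R.
Proof.
elim: k => [|k IH]; last first.
  rewrite addSn /V /= dot_fs_fs; [exact: IH|exact: lV..].
case: d => [|d]; last exact: wandering.
by rewrite /V /= dot_n2// ntheta.
Qed.

Let dotV k l : dot (V k) (V l) = (k == l)%:R.
Proof.
case: (ltngtP k l) => [kl|lk|->].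
- rewrite dotC// -(subnKC (ltnW kl)) dotVV.
  by rewrite subn_eq0 leqNgt kl conjc_nat.
- by rewrite -(subnKC (ltnW lk)) dotVV subn_eq0 leqNgt lk.
- by have := dotVV l 0; rewrite addn0.
Qed.

(** What is left of [g] after subtracting its projection onto the orthonormal vectors
    [V 0, ..., V (n - 1)]. *)
Fixpoint residual g n : nat -> C :=
  if n is n'.+1 then lc 1 (residual g n') (- dot g (V n')) (V n') else g.

Lemma l2_residual g n : l2 g -> l2 (residual g n).
Proof. by move=> lg; elim: n => //= n IH; exact: l2_lc. Qed.

Lemma dot_residualV g n l : l2 g -> (n <= l)%N -> dot (residual g n) (V l) = dot g (V l).
Proof.
move=> lg; elim: n => //= n IH nl.
rewrite dot_lc//; last exact: l2_residual.
by rewrite IH 1?ltnW// dotV ltn_eqF// mulr0 addr0 mul1r.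
Qed.

Lemma n2_residual g n : l2 g ->
  n2 (residual g n) = n2 g - \sum_(k < n) nq (dot g (V k)).
Proof.
move=> lg; elim: n => [|n IH]; first by rewrite big_ord0 subr0.
rewrite big_ord_recr /= n2_lc//; last exact: l2_residual.
rewrite dot_residualV// IH nq1 nqN conjcN.
have -> : n2 (V n) = 1.
  by have := dotV n n; rewrite dot_n2// eqxx => -[].
rewrite !mul1r mulNr cReN mulrC [conjc _ * _]mulrC mulJ_nq /=; ring.
Qed.

Lemma dot_residual f g n : l2 f -> l2 g -> (forall k, dot f (V k) = 0) ->
  dot f (residual g n) = dot f g.
Proof.
move=> lf lg fV; elim: n => //= n IH.
rewrite dot_lcr//; last exact: l2_residual.
by rewrite fV mulr0 addr0 conjc1 mul1r.
Qed.

Lemma bessel g n : l2 g -> \sum_(k < n) nq (dot g (V k)) <= n2 g.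
Proof. by move=> lg; rewrite -subr_ge0 -n2_residual// n2_ge0//; exact: l2_residual. Qed.

(** Bessel's inequality for the orthonormal shifts of [theta], applied to the truncation of [g] at
    [N]; only the first [N] shifts meet its support. *)
Lemma wandering_contraction : toeplitz_contraction theta.
Proof.
move=> N g; rewrite -n2_trunc; apply: le_trans (bessel N (l2_trunc N g)).
apply: ler_sum => k _; rewrite le_eqVlt; apply/orP; left; apply/eqP; congr nq.
rewrite /V dot_iter_fsr//; last exact: l2_trunc.
rewrite (@dot_finite (N - k)%N)//.
  by apply: eq_bigr => j _; rewrite /bs /trunc -ltn_subRL ltn_ord mulrC.
by move=> j Nj; rewrite /bs /trunc ltnNge -leq_subLR Nj.
Qed.

(* The basis vector [delta n] is almost in the span of the shifts of [theta]
   for large [n], since its residual has square norm [1 - \sum_(k <= n) nq (theta k)]. *)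
Lemma wandering_complete f i : l2 f ->
  (forall m k, dot (iter m (@fs R) f) (V k) = 0) -> f i = 0.
Proof.
move=> lf fV; apply: nq_eq0; apply/eqP; rewrite eq_le nq_ge0 andbT.
have H1 n : (i <= n)%N -> nq (f i) <= n2 f * (1 - \sum_(k < n.+1) nq (theta k)).
  move=> ni; set F := iter (n - i) (@fs R) f.
  have lF : l2 F by exact: l2_iter_fs.
  have nF : n2 F = n2 f.
    by rewrite /F; elim: (n - i)%N => //= m IH; rewrite /n2 dot_fs_fs//; exact: l2_iter_fs.
  have -> : f i = dot F (residual (delta R n) n.+1).
    (* Shifting has moved the entry [f i] to index [n], and orthogonality to every [V k] allows
       [delta n] to be replaced by its residual. *)
    rewrite dot_residual//; [|exact: l2_delta|by move=> k; exact: fV].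
    by rewrite dot_delta// /F iter_fsE leq_subr subKn.
  apply: le_trans (cauchy_schwarz_dot _ _) _ => //.
    by apply: l2_residual; exact: l2_delta.
  rewrite nF n2_residual; last exact: l2_delta.
  rewrite ler_wpM2l ?n2_ge0// lerB//.
    by apply/n2leP; [exact: l2_delta|exact: n2le_delta].
  rewrite (reindex_inj rev_ord_inj) /= le_eqVlt; apply/orP; left; apply/eqP.
  apply: eq_bigr => k _; rewrite dotC//; last exact: l2_delta.
  by rewrite nqJ dot_delta// /V iter_fsE subSS -ltnS ltn_ord.
have H2 : n2 f * (1 - \sum_(k < n.+1) nq (theta k)) @[n --> \oo] --> n2 f * (1 - n2 theta).
  apply: cvgM; first exact: cvg_cst.
  apply: cvgB; first exact: cvg_cst.
  by have := n2_cvg ltheta; rewrite -(cvg_shiftS (fun n => \sum_(k < n) nq (theta k))).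
rewrite ntheta subrr mulr0 in H2.
rewrite -(cvg_lim (@Rhausdorff R) H2); apply: limr_ge.
  by apply/cvg_ex; eexists; exact: H2.
by exists i => // n /= ni; exact: H1.
Qed.

End Wandering.

End Beurling.

(** * Beurling's theorem for the backward shift *)

Section BeurlingKernel.
Variable R : realType.
Local Notation C := (R[i]).
Implicit Types (z a b : C) (u v w f g : nat -> C) (M : set (nat -> C)).

(** If [M] contains every [delta j], it is all of l^2 and [theta = 0] will do. Otherwise [theta] is
    the normalized projection of the first missing [delta j] onto the orthogonal complement. If [g]
    satisfies the conditions, its component orthogonal to [M] has all its forward shifts orthogonal
    to all shifts of [theta], hence is 0. *)
Lemma beurling M : subspace_l2 M -> closed_l2 M -> (forall u, M u -> M (bs 1 u)) ->
  exists theta, [/\ l2 theta, toeplitz_contraction theta &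
    forall g, l2 g -> (M g <-> forall k, dot (bs k g) theta = 0)].
Proof.
move=> sM cM bM; have [Ml M0 Mlc] := sM.
have bkM k u : M u -> M (bs k u).
  elim: k u => [|k IH] u Mu; first exact: Mu.
  by have := IH _ (bM _ Mu).
have [Md|/existsNP] := pselect (forall j, M (@delta R j)).
  exists (fun=> 0); split.
  - by apply: (@l2_finite _ 0).
  - move=> N g; rewrite big1 ?sumr_ge0// => [i _|k _]; first exact: nq_ge0.
    by rewrite big1 ?nq0// => j _; rewrite conjc0 mul0r.
  - move=> g lg; split=> [_ k|_]; first by apply: dot_cst0; exact: l2_bs.
    apply: cM => // e e0.
    have /cvgrPdist_le /(_ e e0)[N _ /(_ N (leqnn N))] := n2_sub_trunc_cvg lg.
    rewrite sub0r normrN ger0_norm; last by apply: n2_ge0; apply: l2_lc => //; exact: l2_trunc.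
    by move=> H; exists (trunc N g) => //; exact: trunc_in.
move=> exj.
have [j nMj jmin] : exists2 j, ~ M (@delta R j) & forall i, (i < j)%N -> M (@delta R i).
  have ex : exists j, `[< ~ M (@delta R j) >] by have [j Hj] := exj; exists j; apply/asboolP.
  case: (ex_minnP ex) => j /asboolP nMj jm; exists j => // i ij.
  apply: contrapT => nMi; have /jm := asboolT nMi.
  by rewrite leqNgt ij.
(* The sequences of [N], the orthogonal complement of [M], vanish before index [j],
   and the projection [u] of [delta j] onto [N] represents their [j]-th entry; so
   [u] is orthogonal to the forward shifts of [N]. *)
have lj := @l2_delta R j.
have [m Mm Hm] := projection_exists sM cM lj.
have lm := Ml _ Mm.
set u := lc 1 (delta R j) (-1) m in Hm.
have lu : l2 u by exact: l2_lc.
pose N f := l2 f /\ forall v, M v -> dot f v = 0.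
have Nlc f g a b : N f -> N g -> N (lc a f b g).
  move=> [lf Hf] [lg Hg]; split; first exact: l2_lc.
  by move=> v Mv; rewrite dot_lc ?Hf ?Hg ?mulr0 ?addr0//; exact: Ml.
have Nfs f : N f -> N (fs f).
  move=> [lf Hf]; split; first exact: l2_fs.
  by move=> v Mv; rewrite dot_fs ?Hf//; [exact: bM|exact: Ml].
have Nifs k f : N f -> N (iter k (@fs R) f) by move=> Nf; elim: k => //= k; exact: Nfs.
have Nlow f i : N f -> (i < j)%N -> f i = 0.
  by move=> [lf Hf] /jmin Mi; rewrite -(dot_delta i lf); exact: Hf.
have Nu f : N f -> dot f u = f j.
  by move=> [lf Hf]; rewrite dot_lcr// dot_delta// Hf// mulr0 addr0 conjc1 mul1r.
have u0 : n2 u != 0.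
  apply/eqP => u0; apply: nMj.
  have -> : delta R j = m; last exact: Mm.
  apply/funext => k; have := n2_eq0 k lu u0; rewrite /u /lc mul1r mulN1r.
  by move/eqP; rewrite subr_eq0 => /eqP.
have up : 0 < n2 u by rewrite lt_neqAle eq_sym u0 n2_ge0.
pose r := ((Num.sqrt (n2 u))^-1)%:C : C.
pose theta := lc r u 0 u.
have lt : l2 theta by exact: l2_lc.
have Nt : N theta by apply: Nlc.
have dott f : N f -> dot f theta = r * f j.
  move=> Nf; have [lf _] := Nf; rewrite /theta dot_lcr// Nu//.
  by rewrite conjc0 mul0r addr0 conjc_real.
have nt : n2 theta = 1.
  rewrite /theta n2_lc// nq0 mul0r conjc0 mulr0 mul0r /= mulr0 !addr0.
  by rewrite nq_real exprVn sqr_sqrtr ?ltW// mulVf.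
have wt d : dot (iter d.+1 (@fs R) theta) theta = 0.
  rewrite dott; last exact: Nifs.
  rewrite iter_fsE; case: ltnP => [dj|_]; last by rewrite mulr0.
  by rewrite Nlow ?mulr0// ltn_subrL /= (leq_trans _ dj).
exists theta; split => //; first exact: wandering_contraction.
move=> g lg; split.
  move=> Mg k; rewrite dotC//; last by apply: l2_bs.
  by rewrite Nt.2 ?conjc0//; exact: bkM.
move=> Hg; have [p Mp Hp] := projection_exists sM cM lg.
set f := lc 1 g (-1) p in Hp.
have lp := Ml _ Mp.
have lf : l2 f by exact: l2_lc.
have Hf k : dot f (iter k (@fs R) theta) = 0.
  have lk : l2 (iter k (@fs R) theta) by exact: l2_iter_fs.
  rewrite /f dot_lc// dot_iter_fsr// Hg mulr0 add0r dotC//.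
  by rewrite (Nifs k _ Nt).2// conjc0 mulr0.
(* A common shift cancels, so only [k = 0] is new: the product with [theta] is a multiple of the
   [j]-th entry, which after one more shift is an entry of index below [j], or the 0 that [fs]
   inserts. *)
have Hm' q : N (iter q (@fs R) f) /\ forall k, dot (iter q (@fs R) f) (iter k (@fs R) theta) = 0.
  elim: q => [|q [IHN IH]] //=.
  have NS := Nfs _ IHN; split=> // -[|k] /=.
    rewrite dott//; case: (j) jmin => [|j'] jm' /=; first by rewrite mulr0.
    have lq := IHN.1.
    by rewrite -(dot_delta j' lq) IHN.2 ?mulr0//; apply: jm'.
  by rewrite dot_fs_fs//; [exact: IHN.1|exact: l2_iter_fs].
have f0 i : f i = 0 by apply: (wandering_complete lt nt wt) => // q k; exact: (Hm' q).2.
have -> : g = p; last exact: Mp.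
apply/funext => k; have := f0 k; rewrite /f /lc mul1r mulN1r.
by move/eqP; rewrite subr_eq0 => /eqP.
Qed.

End BeurlingKernel.

(** * Approximating recurrences *)

Section Approximants.
Variable R : realType.
Local Notation C := (R[i]).
Implicit Types (z a b : C) (u v w f g q : nat -> C).

(** The [k]-th entry of the Toeplitz image of [g] cut off at [N]: no entry of [g] with index [N] or
    more enters. *)
Definition hankel q N g k : C := \sum_(j < N - k) q j * g (k + j)%N.

(* Every finite section of the Toeplitz operator [g |-> \sum_j q j * g (k + j)]
   has square norm at most [r]. *)
Definition opc q (r : R) := forall N g,
  \sum_(k < N) nq (hankel q N g k) <= r * \sum_(i < N) nq (g i).

Lemma sum_widen (V : zmodType) n m (F : nat -> V) : (n <= m)%N ->
  (forall j, (n <= j < m)%N -> F j = 0) -> \sum_(j < m) F j = \sum_(j < n) F j.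
Proof.
move=> nm F0; rewrite -!(big_mkord xpredT F) (big_cat_nat (leq0n n) nm)//=.
by rewrite [X in _ + X]big1_seq ?addr0// => j /=; rewrite mem_index_iota => /F0.
Qed.

Lemma sum_interval (V : pzSemiRingType) (T a b : nat) : (b < T)%N ->
  \sum_(t < T) ((a < t <= b)%N)%:R = (b - a)%:R :> V.
Proof.
move=> bT; rewrite -natr_sum; congr _%:R.
have H m : (\sum_(t < m) (a < t <= b) = minn m b.+1 - a.+1)%N.
  elim: m => [|m IH]; first by rewrite big_ord0.
  by rewrite big_ord_recr /= IH; lia.
by rewrite H; lia.
Qed.

Lemma hankel_lin q1 q2 a b N g k :
  hankel (fun j => a * q1 j + b * q2 j) N g k = a * hankel q1 N g k + b * hankel q2 N g k.
Proof.
rewrite /hankel !mulr_sumr -big_split /=; apply: eq_bigr => j _.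
by rewrite mulrDl !mulrA.
Qed.

Lemma hankel_linr q a b u v N k :
  hankel q N (lc a u b v) k = a * hankel q N u k + b * hankel q N v k.
Proof.
rewrite /hankel !mulr_sumr -big_split /=; apply: eq_bigr => j _.
by rewrite /lc; ring.
Qed.

Lemma opcD q1 q2 r1 r2 : opc q1 r1 -> opc q2 r2 ->
  opc (fun j => 1 * q1 j + 1 * q2 j) (2 * r1 + 2 * r2).
Proof.
move=> H1 H2 N g; rewrite mulrDl -!mulrA.
apply: (@le_trans _ _ (2 * (\sum_(k < N) nq (hankel q1 N g k)) + 2 * (\sum_(k < N) nq (hankel q2 N g k)))).
  rewrite !mulr_sumr -big_split /=; apply: ler_sum => k _.
  by rewrite hankel_lin !mul1r nqD_le.
by apply: lerD; rewrite ler_pM2l.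
Qed.

Lemma opc_cst c : opc (fun j => if j == 0%N then c else 0) (nq c).
Proof.
move=> N g; rewrite mulr_sumr; apply: ler_sum => k _.
rewrite /hankel (@sum_widen _ 1 _ (fun j => (if j == 0%N then c else 0) * g (k + j)%N)).
- by rewrite big_ord1 /= addn0 nqM.
- by rewrite subn_gt0.
- by move=> [|j]//= _; rewrite mul0r.
Qed.

(* Averaging over the windows [k < t <= k + n] of length [n] yields the Cesaro
   factors [n - j], as [k] and [k + j] share exactly [n - j] windows. *)
Lemma opc_cesaro q n : (0 < n)%N -> opc q 1 ->
  opc (fun j => ((n - j)%:R / (4 * n%:R))%:C * q j) (16^-1).
Proof.
move=> n0 H N g.
have n0' : n%:R != 0 :> R by rewrite pnatr_eq0 -lt0n.
pose W t i : C := if (i < t <= i + n)%N then g i else 0.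
pose T := (N + n).+1.
have E k : (k < N)%N -> hankel (fun j => (n - j)%:R * q j) N g k =
    \sum_(t < T) ((k < t <= k + n)%N)%:R * hankel q N (W t) k.
  move=> kN; under [RHS]eq_bigr do rewrite /hankel mulr_sumr.
  rewrite exchange_big /=; apply: eq_bigr => j _.
  have jk : (k + n < T)%N by rewrite /T; lia.
  have -> : (n - j)%:R = \sum_(t < T) ((k + j < t <= k + n)%N)%:R :> C.
    by rewrite sum_interval// subnDl.
  rewrite !mulr_suml.
  apply: eq_bigr => t _; rewrite /W.
  have -> : (k + j < t <= k + n)%N = (k < t <= k + n)%N && (k + j < t <= k + j + n)%N by lia.
  by case: (k < t <= k + n)%N; case: (k + j < t <= k + j + n)%N; rewrite /= ?mul1r ?mul0r ?mulr0 ?mul0r.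
(* Cauchy-Schwarz over the [n] windows attached to [k] costs a factor [n]. Each entry of [g] lies in
   [n] windows, which costs another; the scaling by 1 / (4 n) turns [n ^+ 2] into 1/16. *)
have E2 k : (k < N)%N -> nq (hankel (fun j => (n - j)%:R * q j) N g k) <=
    n%:R * \sum_(t < T) nq (hankel q N (W t) k).
  move=> kN; rewrite E//; apply: (le_trans (nq_sum_mul_le _ _ _)).
  rewrite ler_wpM2r//; first by apply: sumr_ge0 => t _; exact: nq_ge0.
  have kT : (k + n < T)%N by rewrite /T; lia.
  have := sum_interval R k kT; rewrite addKn => <-.
  by apply: ler_sum => t _; case: (_ && _); rewrite ?nq1 ?nq0.
have E3 : \sum_(k < N) nq (hankel (fun j => (n - j)%:R * q j) N g k) <=
    n%:R ^+ 2 * \sum_(i < N) nq (g i).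
  apply: (@le_trans _ _ (\sum_(k < N) n%:R * \sum_(t < T) nq (hankel q N (W t) k))).
    by apply: ler_sum => k _; exact: E2.
  rewrite -mulr_sumr exchange_big /= expr2 -mulrA ler_wpM2l//.
  apply: (@le_trans _ _ (\sum_(t < T) \sum_(i < N) nq (W t i))).
    by apply: ler_sum => t _; have := H N (W t); rewrite mul1r.
  rewrite exchange_big /= mulr_sumr; apply: ler_sum => i _.
  have iT : (i + n < T)%N by have := ltn_ord i; rewrite /T; lia.
  have := sum_interval R i iT; rewrite addKn => <-.
  rewrite mulr_suml; apply: ler_sum => t _; rewrite /W.
  by case: (_ && _); rewrite ?mul1r ?mul0r ?nq0.
have E4 k : hankel (fun j => ((n - j)%:R / (4 * n%:R))%:C * q j) N g k =
    ((4 * n%:R)^-1)%:C * hankel (fun j => (n - j)%:R * q j) N g k.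
  rewrite /hankel mulr_sumr; apply: eq_bigr => j _.
  by rewrite rmorphM /= rmorph_nat; ring.
under eq_bigr do rewrite E4 nqM nq_real.
rewrite -mulr_sumr; apply: (le_trans (ler_wpM2l (sqr_ge0 _) E3)).
by rewrite le_eqVlt; apply/orP; left; apply/eqP; field.
Qed.

Definition recurrent q n g := forall k, g (k + n)%N = - \sum_(j < n) q j * g (k + j)%N.

Lemma recurrent_energy q n g L : opc q 4^-1 -> (forall j, (n <= j)%N -> q j = 0) ->
  recurrent q n g ->
  \sum_(k < L) nq (g (k + n)%N) <= 4 * \sum_(k < n) nq (hankel q n g k).
Proof.
move=> H q0 gE.
(* Applying the bound to [b] alone gives [X <= 2 * E + 2 * (X / 4)]. *)
pose a := trunc n g; pose b k : C := if (k < n)%N then 0 else g k.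
have gab : g = lc 1 a 1 b.
  by apply/funext => k; rewrite /lc /a /b /trunc; case: ltnP => _; rewrite !mul1r ?addr0 ?add0r.
set X := \sum_(k < L) _; set E := \sum_(k < n) _.
have gk k : (k < L)%N -> nq (g (k + n)%N) <=
    2 * nq (hankel q (L + n) a k) + 2 * nq (hankel q (L + n) b k).
  move=> kL; rewrite gE nqN.
  have -> : \sum_(j < n) q j * g (k + j)%N = hankel q (L + n) g k.
    rewrite /hankel (@sum_widen _ n (L + n - k) (fun j => q j * g (k + j)%N))//; first by lia.
    by move=> j /andP[nj _]; rewrite q0// mul0r.
  by rewrite gab hankel_linr !mul1r nqD_le.
have wid (F : nat -> R) : (forall k, 0 <= F k) -> \sum_(k < L) F k <= \sum_(k < L + n) F k.
  by move=> F0; rewrite big_split_ord /= lerDl; apply: sumr_ge0.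
(* As [a] vanishes from [n] on, rows [k >= n] are zero and the rows below reduce to the section of
   size [n]. *)
have Ea : \sum_(k < L + n) nq (hankel q (L + n) a k) = E.
  rewrite (@sum_widen _ n _ (fun k => nq (hankel q (L + n) a k))); last first.
  - move=> k /andP[nk _]; rewrite /hankel big1 ?nq0// => j _.
    by rewrite /a /trunc ltnNge (leq_trans nk (leq_addr _ _)) mulr0.
  - by lia.
  apply: eq_bigr => k _; congr nq; have kn := ltn_ord k.
  rewrite /hankel (@sum_widen _ (n - k) _ (fun j => q j * a (k + j)%N)); first last.
  - by move=> j /andP[nj _]; rewrite /a /trunc ifN ?mulr0// -leqNgt; lia.
  - by lia.
  by apply: eq_bigr => j _; have := ltn_ord j; rewrite /a /trunc => jn; rewrite ifT//; lia.
have Eb : \sum_(i < L + n) nq (b i) = X.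
  rewrite addnC big_split_ord /= big1 ?add0r => [|i _]; last by rewrite /b ltn_ord nq0.
  by apply: eq_bigr => i _; rewrite /b ltnNge leq_addr addnC.
have : X <= 2 * E + 2 * (4^-1 * X).
  apply: (@le_trans _ _ (\sum_(k < L) (2 * nq (hankel q (L + n) a k) + 2 * nq (hankel q (L + n) b k)))).
    by apply: ler_sum => k _; exact: gk.
  rewrite big_split /= -!mulr_sumr; apply: lerD; rewrite ler_pM2l//.
    by rewrite -Ea; apply: (wid (fun k => nq (hankel q (L + n) a k))) => k; exact: nq_ge0.
  rewrite -Eb; apply: le_trans (H (L + n)%N b).
  by apply: (wid (fun k => nq (hankel q (L + n) b k))) => k; exact: nq_ge0.
lra.
Qed.

(** If [nq x >= 1], the energy of the first [L] tail terms of the powers of [x] would be at least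
    [L], against a bound independent of [L]. *)
Lemma nq_lt1 q n (x : C) : opc q 4^-1 -> (forall j, (n <= j)%N -> q j = 0) ->
  recurrent q n (fun k => x ^+ k) -> nq x < 1.
Proof.
move=> H q0 /(recurrent_energy _ H q0); set B := 4 * _ => HB.
rewrite ltNge; apply/negP => x1.
have h L : L%:R <= B.
  apply: le_trans (HB L); rewrite -[X in X%:R]card_ord -sumr_const.
  by apply: ler_sum => k _; rewrite nqX exprn_ege1.
have := h (Num.trunc B).+1; apply/negP; rewrite -ltNge; exact: truncnS_gt.
Qed.

End Approximants.

(** * Interpolation by powers and distinct characteristic roots *)

Section Spectrum.
Variable R : realType.
Local Notation C := (R[i]).
Implicit Types (f g q : nat -> C).

Lemma power_interpolation (ws : seq C) f : uniq ws ->
  exists a : C -> C, forall k, (k < size ws)%N -> \sum_(w <- ws) a w * w ^+ k = f k.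
Proof.
move=> uws; set n := size ws.
pose r : 'rV[C]_n := \row_j nth 0 ws j.
have Vu : Vandermonde n r \in unitmx.
  rewrite unitmxE det_Vandermonde unitfE; apply/prodf_neq0 => i _.
  apply/prodf_neq0 => j ij; rewrite !mxE subr_eq0 nth_uniq//.
  by rewrite gtn_eqF.
pose x : 'cV[C]_n := invmx (Vandermonde n r) *m \col_i f i.
have Vx : Vandermonde n r *m x = \col_i f i by rewrite mulKVmx.
(* This turns one coefficient per index into one per root; as [ws] has no repetition, the sum has a
   single term for each root. *)
exists (fun w => \sum_(i < n | nth 0 ws i == w) x i 0) => k kn.
have := congr1 (fun A : 'cV[C]_n => A (Ordinal kn) 0) Vx; rewrite !mxE /= => <-.
rewrite (big_nth 0) big_mkord; apply: eq_bigr => i _.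
rewrite (big_pred1 i) => [|j]; first by rewrite !mxE mulrC.
by rewrite nth_uniq//; apply/eqP/eqP => [/val_inj|->].
Qed.

Lemma small_simple_shift (p : {poly C}) (e : R) : (1 < size p)%N -> p \is monic -> 0 < e ->
  exists c, nq c <= e /\ exists2 ws : seq C, uniq ws & p + c%:P = \prod_(w <- ws) ('X - w%:P).
Proof.
move=> sp mp e0; pose d := Num.min 1 e.
have d0 : 0 < d by rewrite lt_min ltr01.
have de : d ^+ 2 <= e.
  have : d <= 1 by rewrite ge_min lexx.
  have : d <= e by rewrite ge_min lexx orbT.
  nra.
have p'0 : p^`() != 0.
  have sp' : ((size p).-2.+1 = (size p).-1)%N by case: (size p) sp => [|[]].
  apply/eqP => /(congr1 (fun q : {poly C} => q`_(size p).-2)).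
  rewrite coef_deriv coef0 sp' -lead_coefE (monicP mp) => /eqP.
  by rewrite pnatr_eq0 -sp'.
have [rs rsE] := closed_field_poly_normal p^`().
(* One more candidate than the derivative has roots, so one of them avoids all the values [- p.[r]];
   each has squared modulus at most [d ^+ 2 <= e]. *)
pose cs := [seq (d / i.+1%:R)%:C | i <- iota 0 (size rs).+1] : seq C.
have ucs : uniq cs.
  have d0' : d != 0 by rewrite gt_eqF.
  rewrite map_inj_uniq ?iota_uniq// => i j /complexI /(mulfI d0') /invr_inj /eqP.
  by rewrite eqr_nat eqSS => /eqP.
(* A multiple root [r] of [p + c] is a critical point with [p.[r] = - c]. *)
have [c cin cnot] : exists2 c, c \in cs & c \notin [seq - p.[r] | r <- rs].
  apply: contrapT => H.
  have sub : {subset cs <= [seq - p.[r] | r <- rs]}.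
    by move=> c cin; apply: contrapT => /negP cn; apply: H; exists c.
  by have := uniq_leq_size ucs sub; rewrite !size_map size_iota ltnn.
exists c; split.
  have /mapP[i _ ->] := cin; rewrite nq_real (le_trans _ de)//.
  by rewrite lerXn2r// ?nnegrE ?divr_ge0 ?(ltW d0)// ler_pdivrMr// ler_peMr ?(ltW d0)// ler1n.
have [ws wsE] := closed_field_poly_normal (p + c%:P).
have lc1 : lead_coef (p + c%:P) = 1.
  by rewrite lead_coefDl ?(monicP mp)// (leq_ltn_trans (size_polyC_leq1 _)).
rewrite lc1 scale1r in wsE; exists ws => //.
rewrite -separable_prod_XsubC -wsE separable_poly.unlock.
rewrite derivD derivC addr0 coprimep_sym; apply: Pdiv.ClosedField.root_coprimep => z.
rewrite rsE rootZ ?lead_coef_eq0// root_prod_XsubC => zrs.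
rewrite hornerD hornerC addrC -[p.[z]]opprK subr_eq0; apply: contraNneq cnot => ->.
exact: map_f.
Qed.

End Spectrum.

(** * Cesaro symbols and their recurrences *)

Section SpectralApproximation.
Variable R : realType.
Local Notation C := (R[i]).
Local Notation Re := (@complex.Re R).
Local Notation Im := (@complex.Im R).
Implicit Types (f g q theta : nat -> C).

(** The perturbation [c] sits at index 0, where it adds a constant to the characteristic polynomial.
    The factors [1 *] match the form of [opcD]. *)
Definition cesaro_symbol theta n (c : C) j : C :=
  1 * (((n - j)%:R / (4 * n%:R))%:C * conjc (theta j)) + 1 * (if j == 0%N then c else 0).

(** The weighted part and the perturbation have squared norm at most 1/16 each, and 2/16 + 2/16 =
    1/4, the value that [recurrent_energy] requires. *)
Lemma cesaro_symbol_opc theta n c : (0 < n)%N -> toeplitz_contraction theta ->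
  nq c <= 16^-1 -> opc (cesaro_symbol theta n c) 4^-1.
Proof.
move=> n0 H c16 N g.
have H1 : opc (fun j => conjc (theta j)) 1 by move=> N' g'; rewrite mul1r; exact: H.
apply: le_trans (opcD (opc_cesaro n0 H1) (opc_cst c) N g) _.
apply: ler_wpM2r; first by apply: sumr_ge0 => i _; exact: nq_ge0.
by have := c16; lra.
Qed.

Lemma cesaro_symbol0 theta n c j : (0 < n)%N -> (n <= j)%N -> cesaro_symbol theta n c j = 0.
Proof.
move=> n0 nj; rewrite /cesaro_symbol (eqP (_ : n - j == 0)%N); last by rewrite subn_eq0.
have -> : (j == 0)%N = false by rewrite gtn_eqF// (leq_trans n0).
by rewrite mul0r mul0r !mulr0 addr0.
Qed.

(** The characteristic polynomial for [c = 0], plus the constant [c], is the one for [c]. The bound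
    on [nq c] stays below the 1/16 of [cesaro_symbol_opc] and tends to 0, so the perturbation
    disappears in the limit. *)
Lemma spectral_data theta n : toeplitz_contraction theta ->
  exists c (ws : seq C), [/\ nq c <= (16 * n.+1%:R)^-1, uniq ws, size ws = n.+1 &
    forall w, w \in ws -> recurrent (cesaro_symbol theta n.+1 c) n.+1 (fun k => w ^+ k)].
Proof.
move=> H; set N := n.+1.
pose p0 : {poly C} := \poly_(j < N) cesaro_symbol theta N 0 j.
pose p := 'X^N + p0.
have sp0 : (size p0 < size ('X^N : {poly C}))%N by rewrite size_polyXn ltnS size_poly.
have sp : size p = N.+1 by rewrite size_polyDl// size_polyXn.
have mp : p \is monic by rewrite monicE lead_coefDl// lead_coefXn.
have e0 : 0 < (16 * N%:R)^-1 :> R by rewrite invr_gt0 mulr_gt0// ltr0n.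
have [|c [ce [ws uws wsE]]] := small_simple_shift _ mp e0; first by rewrite sp.
exists c, ws; split => //.
  have := size_prod_XsubC ws id; rewrite -wsE size_polyDl ?sp; last first.
    by rewrite ?sp (leq_ltn_trans (size_polyC_leq1 _)).
  by move=> -[].
move=> w wws k.
have : (p + c%:P).[w] = 0.
  by apply/eqP; rewrite -/(root _ _) wsE root_prod_XsubC.
rewrite !hornerD hornerXn hornerC horner_poly => pw.
have E : \sum_(j < N) cesaro_symbol theta N c j * w ^+ j =
    \sum_(j < N) cesaro_symbol theta N 0 j * w ^+ j + c.
  rewrite !big_ord_recl /= addrAC; congr (_ + _).
  by rewrite /cesaro_symbol /= expr0; ring.
rewrite exprD; under eq_bigr do rewrite exprD mulrCA.
rewrite -mulr_sumr E -mulrN; congr (_ * _).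
by apply/eqP; rewrite -addr_eq0 addrA pw.
Qed.

Lemma opc_coord q r N g k : opc q r -> (k < N)%N ->
  nq (hankel q N g k) <= r * \sum_(i < N) nq (g i).
Proof.
move=> H kN; apply: le_trans (H N g).
rewrite (bigD1 (Ordinal kN))//= lerDl.
by apply: sumr_ge0 => i _; exact: nq_ge0.
Qed.

(** The term [x j] occurs in [n - j] of the first [n] nonempty partial sums; so the weighted sums
    are Cesaro means of partial sums. *)
Lemma weighted_sum_partial (x : nat -> C) n :
  \sum_(j < n) (n - j)%:R * x j = \sum_(m < n) \sum_(j < m.+1) x j.
Proof.
elim: n => [|n IH]; first by rewrite !big_ord0.
rewrite [RHS]big_ord_recr /= -IH.
have -> : \sum_(j < n) (n - j)%:R * x j = \sum_(j < n.+1) (n - j)%:R * x j.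
  by rewrite big_ord_recr /= subnn mul0r addr0.
rewrite -big_split /=; apply: eq_bigr => j _.
by rewrite subSn -1?ltnS// -natr1 mulrDl mul1r.
Qed.

Lemma ccvg_cesaro (x : nat -> C) l : ccvg (fun n => \sum_(j < n) x j) l ->
  ccvg (fun n => n.+1%:R^-1%:C * \sum_(j < n.+1) (n.+1 - j)%:R * x j) l.
Proof.
move=> /(ccvg_shift 1)[H1 H2].
have E n : n.+1%:R^-1%:C * \sum_(j < n.+1) (n.+1 - j)%:R * x j =
    (n.+1%:R^-1%:C * \sum_(m < n.+1) \sum_(j < m.+1) x j).
  by rewrite weighted_sum_partial.
split.
- have := cesaro H1; rewrite /arithmetic_mean => H.
  rewrite (eq_cvg _ _ (fun n => congr1 Re (E n))).
  apply: cvg_trans H; apply: near_eq_cvg; apply: nearW => n.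
  rewrite /= /series /= big_mkord cReM /= mul0r subr0.
  rewrite (Re_sum n.+1 (fun m => \sum_(j < m.+1) x j)).
  by congr (_ * _); apply: eq_bigr => m _; rewrite addn1.
- have := cesaro H2; rewrite /arithmetic_mean => H.
  rewrite (eq_cvg _ _ (fun n => congr1 Im (E n))).
  apply: cvg_trans H; apply: near_eq_cvg; apply: nearW => n.
  rewrite /= /series /= big_mkord cImM /= mul0r addr0.
  rewrite (Im_sum n.+1 (fun m => \sum_(j < m.+1) x j)).
  by congr (_ * _); apply: eq_bigr => m _; rewrite addn1.
Qed.

End SpectralApproximation.

(** * Convergence of the approximating spaces *)

Section SpectralLimit.
Variable R : realType.
Local Notation C := (R[i]).
Implicit Types (f g q theta : nat -> C).

Lemma ccvgM (s t : nat -> C) z w : ccvg s z -> ccvg t w -> ccvg (fun n => s n * t n) (z * w).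
Proof.
move=> [s1 s2] [t1 t2]; split.
  by under eq_cvg do rewrite cReM; rewrite cReM; apply: cvgB; apply: cvgM.
by under eq_cvg do rewrite cImM; rewrite cImM; apply: cvgD; apply: cvgM.
Qed.

Lemma ccvg_cst (z : C) : ccvg (fun=> z) z.
Proof. by split; exact: cvg_cst. Qed.

Lemma ccvgD (s t : nat -> C) z w : ccvg s z -> ccvg t w -> ccvg (fun n => s n + t n) (z + w).
Proof.
move=> H1 H2; have := ccvg_lin 1 1 H1 H2; rewrite !mul1r.
by rewrite (_ : (fun n => _) = (fun n => s n + t n))//; apply/funext => n; rewrite !mul1r.
Qed.

Lemma ccvg_sum m (s : nat -> nat -> C) (z : nat -> C) :
  (forall j, ccvg (fun n => s n j) (z j)) ->
  ccvg (fun n => \sum_(j < m) s n j) (\sum_(j < m) z j).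
Proof.
move=> H; elim: m => [|m IH].
  rewrite big_ord0 (_ : (fun n => _) = fun=> 0); first exact: ccvg_cst.
  by apply/funext => n; rewrite big_ord0.
rewrite big_ord_recr (_ : (fun n => _) = fun n => \sum_(j < m) s n j + s n m).
  exact: ccvgD.
by apply/funext => n; rewrite big_ord_recr.
Qed.

Lemma cvg_sum_ord m (s : nat -> nat -> R) (z : nat -> R) :
  (forall j, (j < m)%N -> s n j @[n --> \oo] --> z j) ->
  \sum_(j < m) s n j @[n --> \oo] --> \sum_(j < m) z j.
Proof.
elim: m => [|m IH] H.
  by under eq_cvg do rewrite big_ord0; rewrite big_ord0; exact: cvg_cst.
under eq_cvg do rewrite big_ord_recr /=; rewrite big_ord_recr /=.
by apply: cvgD; [apply: IH => j jm; apply: H; exact: ltnW|exact: H].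
Qed.

Lemma cesaro_weight_cvg j :
  (n.+1 - j)%:R / (4 * n.+1%:R) @[n --> \oo] --> (4^-1 : R).
Proof.
have E : (fun n => 4^-1 * (1 - j%:R * n.+1%:R^-1)) @ \oo --> (4^-1 * (1 - j%:R * 0) : R).
  apply: cvgM; first exact: cvg_cst.
  apply: cvgB; first exact: cvg_cst.
  by apply: cvgM; [exact: cvg_cst|exact: cvg_harmonic].
rewrite mulr0 subr0 mulr1 in E.
apply: cvg_trans E; apply: near_eq_cvg; exists j => // n /= jn.
rewrite natrB; last exact: leqW.
have n0 : n.+1%:R != 0 :> R by rewrite pnatr_eq0.
by field.
Qed.

Lemma cesaro_symbol_cvg theta (c : nat -> C) j :
  (forall n, nq (c n) <= (16 * n.+1%:R)^-1) ->
  ccvg (fun n => cesaro_symbol theta n.+1 (c n) j) (4^-1%:C * conjc (theta j)).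
Proof.
move=> cn; rewrite -[X in ccvg _ X](addr0) -[_ * conjc _]mul1r.
apply: ccvgD.
  apply: ccvgM; first exact: ccvg_cst.
  apply: ccvgM; last exact: ccvg_cst.
  by split => /=; [exact: cesaro_weight_cvg|exact: cvg_cst].
rewrite -[X in ccvg _ X]mul1r; apply: ccvgM; first exact: ccvg_cst.
case: (j == 0%N); last exact: ccvg_cst.
apply: ccvg_nq0; apply: (@squeeze_cvgr _ _ _ _ (cst 0) (fun n => 16^-1 / n.+1%:R)).
- by apply: nearW => n; rewrite nq_ge0 /= subr0 -invfM; exact: cn.
- exact: cvg_cst.
- exact: harmonic_cvg0.
Qed.

Lemma hankel_trunc q K L f k : (k < K <= L)%N -> hankel q L (trunc K f) k = hankel q K f k.
Proof.
move=> /andP[kK KL].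
rewrite /hankel (@sum_widen _ (K - k) (L - k) (fun j => q j * trunc K f (k + j)%N)); last 2 first.
- by rewrite leq_sub2r.
- by move=> j /andP[nj _]; rewrite /trunc ifN ?mulr0// -leqNgt; lia.
by apply: eq_bigr => j _; have := ltn_ord j; rewrite /trunc => jn; rewrite ifT//; lia.
Qed.

Lemma hankel_trunc0 q K L f k : (K <= k)%N -> hankel q L (trunc K f) k = 0.
Proof.
move=> Kk; rewrite /hankel big1// => j _.
by rewrite /trunc ltnNge (leq_trans Kk (leq_addr _ _)) mulr0.
Qed.

Lemma lc_truncK K f : lc 1 (trunc K f) 1 (lc 1 f (-1) (trunc K f)) = f.
Proof. by apply/funext => k; rewrite /lc; ring. Qed.

(** The Toeplitz image of [f] vanishes, so the image of its first [K] terms is minus the image of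
    the tail, which the contraction bounds by the tail itself. *)
Lemma toeplitz_tail theta f K : l2 theta -> toeplitz_contraction theta -> l2 f ->
  (forall k, dot (bs k f) theta = 0) ->
  \sum_(k < K) nq (hankel (fun j => conjc (theta j)) K f k) <= n2 (lc 1 f (-1) (trunc K f)).
Proof.
move=> lt Ht lf H; set qt := fun j => conjc (theta j); set f' := lc 1 f _ _.
have lf' : l2 f' by apply: l2_lc => //; exact: l2_trunc.
have H1 k : (k < K)%N -> ccvg (fun L => hankel qt (L + K) f' k) (- hankel qt K f k).
  move=> kK; have lb := l2_bs k lf.
  have E L : hankel qt (L + K) f' k = pdot (bs k f) theta (L + (K - k)) + - hankel qt K f k.
    have <- : hankel qt (L + K) f k = pdot (bs k f) theta (L + (K - k)).
      rewrite /hankel /pdot addnBA; last exact: ltnW.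
      by apply: eq_bigr => j _; rewrite mulrC.
    rewrite -{1}(lc_truncK K f) hankel_linr hankel_trunc ?kK ?leq_addl//.
    by rewrite !mul1r addrAC subrr add0r.
  rewrite (_ : (fun L => _) = (fun L => pdot (bs k f) theta (L + (K - k)) + - hankel qt K f k)).
    rewrite -[X in ccvg _ X]add0r; apply: ccvgD; last exact: ccvg_cst.
    by rewrite -(H k); apply: ccvg_shift; exact: dotP.
  by apply/funext.
have H2 : \sum_(k < K) nq (hankel qt (L + K) f' k) @[L --> \oo] --> \sum_(k < K) nq (hankel qt K f k).
  apply: (@cvg_sum_ord K (fun L k => nq (hankel qt (L + K) f' k)) (fun k => nq (hankel qt K f k))).
  by move=> k /H1 /ccvg_nq; rewrite nqN.
rewrite -(cvg_lim (@Rhausdorff R) H2); apply: limr_le.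
  by apply/cvg_ex; eexists; exact: H2.
apply: nearW => L; apply: le_trans (n2le_n2 lf' (L + K)%N).
apply: le_trans (Ht (L + K)%N f').
rewrite addnC [leRHS]big_split_ord /= lerDl.
by apply: sumr_ge0 => i _; exact: nq_ge0.
Qed.

(** The symbols converge only coefficient by coefficient, so [f] is cut at a fixed [K]. On the head
    the limit symbol leaves at most e/16 by [toeplitz_tail]; on the tail the uniform operator bound
    leaves e/4. In total 2 (e/16 + e/8) + 2 (e/4) < e. *)
Lemma energy_cvg0 theta (c : nat -> C) f : l2 theta -> toeplitz_contraction theta ->
  (forall n, nq (c n) <= (16 * n.+1%:R)^-1) -> l2 f ->
  (forall k, dot (bs k f) theta = 0) -> forall e : R, 0 < e ->
  exists N, forall n, (N <= n)%N ->
    \sum_(k < n.+1) nq (hankel (cesaro_symbol theta n.+1 (c n)) n.+1 f k) <= e.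
Proof.
move=> lt Ht cn lf H e e0; pose q n := cesaro_symbol theta n.+1 (c n).
have Hq n : opc (q n) 4^-1.
  apply: cesaro_symbol_opc => //; apply: le_trans (cn n) _.
  by rewrite lef_pV2 ?posrE// ler_pMr// ler1n.
have [K KE] : exists K, n2 (lc 1 f (-1) (trunc K f)) <= e.
  have /cvgrPdist_le /(_ e e0)[N _ /(_ N (leqnn N))] := n2_sub_trunc_cvg lf.
  rewrite sub0r normrN ger0_norm; last by apply: n2_ge0; apply: l2_lc => //; exact: l2_trunc.
  by exists N.
set f' := lc 1 f _ _ in KE.
have lf' : l2 f' by apply: l2_lc => //; exact: l2_trunc.
have A := toeplitz_tail K lt Ht lf H; rewrite -/f' in A.
set S := \sum_(k < K) _ in A.
have B : \sum_(k < K) nq (hankel (q n) K f k) @[n --> \oo] --> 16^-1 * S.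
  have SE : \sum_(k < K) nq (4^-1%:C * hankel (fun j => conjc (theta j)) K f k) = 16^-1 * S.
    by rewrite /S mulr_sumr; apply: eq_bigr => k _; rewrite nqM nq_real; congr (_ * _); field.
  have := @cvg_sum_ord K (fun n k => nq (hankel (q n) K f k))
     (fun k => nq (4^-1%:C * hankel (fun j => conjc (theta j)) K f k)).
  rewrite SE; apply => k _.
  apply: ccvg_nq; rewrite /hankel mulr_sumr.
  under eq_bigr do rewrite mulrA.
  apply: (@ccvg_sum (K - k) (fun n j => q n j * f (k + j)%N)
    (fun j => 4^-1%:C * conjc (theta j) * f (k + j)%N)) => j.
  by apply: ccvgM; [exact: cesaro_symbol_cvg|exact: ccvg_cst].
have e8 : 0 < e / 8 by rewrite divr_gt0.
move/cvgrPdist_le: B => /(_ _ e8)[N _ HN].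
exists (maxn N K) => n; rewrite geq_max => /andP[Nn Kn].
have := HN n Nn; rewrite ler_norml => /andP[B1 _].
have C1 : \sum_(k < n.+1) nq (hankel (q n) n.+1 (trunc K f) k) = \sum_(k < K) nq (hankel (q n) K f k).
  rewrite (@sum_widen _ K n.+1 (fun k => nq (hankel (q n) n.+1 (trunc K f) k))); last 2 first.
  - exact: leqW.
  - by move=> k /andP[Kk _]; rewrite hankel_trunc0// nq0.
  by apply: eq_bigr => k _; rewrite hankel_trunc// ltn_ord leqW.
have C2 : \sum_(k < n.+1) nq (hankel (q n) n.+1 f' k) <= 4^-1 * e.
  apply: le_trans (Hq n n.+1 f') _; rewrite ler_pM2l//.
  by apply: le_trans KE; exact: n2le_n2.
apply: (@le_trans _ _ (2 * \sum_(k < n.+1) nq (hankel (q n) n.+1 (trunc K f) k) +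
   2 * \sum_(k < n.+1) nq (hankel (q n) n.+1 f' k))).
  rewrite !mulr_sumr -big_split /=; apply: ler_sum => k _.
  by rewrite -/(q n) -{1}(lc_truncK K f) hankel_linr !mul1r nqD_le.
rewrite C1; move: B1 A KE C2; lra.
Qed.

End SpectralLimit.

(** * Solution spaces tend to the invariant subspace *)

Section SpectralSynthesis.
Variable R : realType.
Local Notation C := (R[i]).
Implicit Types (f g q theta : nat -> C) (M : set (nat -> C)).

Definition geometric_combo (ws : seq C) (a : C -> C) : nat -> C :=
  fun k => \sum_(w <- ws) a w * w ^+ k.

Lemma recurrent_combo q n (ws : seq C) a :
  (forall w, w \in ws -> recurrent q n (fun k => w ^+ k)) ->
  recurrent q n (geometric_combo ws a).
Proof.
move=> H k; rewrite /geometric_combo.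
under [X in _ = - X]eq_bigr do rewrite mulr_sumr.
rewrite exchange_big /= -sumrN; apply: eq_big_seq => w wws.
rewrite (H w wws k) mulrN mulr_sumr; congr (- _); apply: eq_bigr => j _.
by rewrite mulrCA.
Qed.

Lemma hankel_eq q n f g k : (forall i, (i < n)%N -> f i = g i) -> (k < n)%N ->
  hankel q n f k = hankel q n g k.
Proof.
move=> fg kn; apply: eq_bigr => j _; rewrite fg//.
by have := ltn_ord j; lia.
Qed.

(** The two sequences differ only from index [n] on, where the error is split into the tail of [f]
    and the tail of the solution; the latter is controlled by [recurrent_energy], and 8 = 2 * 4. *)
Lemma recurrent_approx q n f g : opc q 4^-1 -> (forall j, (n <= j)%N -> q j = 0) ->
  recurrent q n g -> (forall k, (k < n)%N -> g k = f k) -> l2 f ->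
  n2le (lc 1 f (-1) g) (2 * n2 (lc 1 f (-1) (trunc n f)) +
     8 * \sum_(k < n) nq (hankel q n f k)).
Proof.
move=> Hq q0 Hg gf lf L.
have lt : l2 (lc 1 f (-1) (trunc n f)) by apply: l2_lc => //; exact: l2_trunc.
apply: (@le_trans _ _ (\sum_(k < n + L) nq (lc 1 f (-1) g k))).
  rewrite addnC big_split_ord /= lerDl.
  by apply: sumr_ge0 => i _; exact: nq_ge0.
rewrite big_split_ord /= big1 ?add0r => [|k _]; last first.
  by rewrite /lc gf// mul1r mulN1r subrr nq0.
apply: (@le_trans _ _ (\sum_(k < L) (2 * nq (f (n + k)%N) + 2 * nq (g (k + n)%N)))).
  apply: ler_sum => k _; rewrite /lc mul1r mulN1r addnC.
  by rewrite (le_trans (nqD_le _ _))// nqN.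
rewrite big_split /= -!mulr_sumr; apply: lerD.
  rewrite ler_pM2l//; apply: le_trans (n2le_n2 lt (n + L)%N).
  rewrite big_split_ord /= ler_wpDl//; first by apply: sumr_ge0 => i _; exact: nq_ge0.
  rewrite le_eqVlt; apply/orP; left; apply/eqP; apply: eq_bigr => k _.
  by rewrite /lc /trunc ltnNge leq_addr /= mul1r mulr0 addr0.
have := recurrent_energy L Hq q0 Hg.
under [X in _ <= 4 * X -> _]eq_bigr => k _ do rewrite (hankel_eq q gf (ltn_ord k)).
lra.
Qed.

Lemma l2_spectral M : subspace_l2 M -> closed_l2 M -> (forall u, M u -> M (bs 1 u)) ->
  exists Lam : nat -> seq C,
    [/\ forall n, uniq (Lam n), forall n w, w \in Lam n -> nq w < 1 &
    forall f, l2 f -> (M f <-> forall e : R, 0 < e -> exists N, forall n, (N <= n)%N ->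
      exists a, n2le (lc 1 f (-1) (geometric_combo (Lam n) a)) e)].
Proof.
move=> sM cM bM; have [theta [lt Ht HM]] := beurling sM cM bM.
have [c Hc] := choice (fun n => spectral_data n Ht).
have [Lam HL] := choice Hc.
pose q n := cesaro_symbol theta n.+1 (c n).
have cn n : nq (c n) <= (16 * n.+1%:R)^-1 by have [] := HL n.
have Hq n : opc (q n) 4^-1.
  apply: cesaro_symbol_opc => //; apply: le_trans (cn n) _.
  by rewrite lef_pV2 ?posrE// ler_pMr// ler1n.
have q0 n j : (n.+1 <= j)%N -> q n j = 0 by exact: cesaro_symbol0.
have HLrec n w : w \in Lam n -> recurrent (q n) n.+1 (fun k => w ^+ k).
  by have [_ _ _ H] := HL n; exact: H.
exists Lam; split.
- by move=> n; have [] := HL n.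
- move=> n w wL; exact: (nq_lt1 (Hq n) (q0 n) (HLrec n w wL)).
move=> f lf; split.
  move=> /(HM f lf) fp e e0.
  (* [recurrent_approx] weighs the tail by 2 and the energy by 8: 2 (e/4) + 8 (e/16) = e. *)
  have e4 : 0 < e / 4 by rewrite divr_gt0.
  have e16 : 0 < e / 16 by rewrite divr_gt0.
  have [N1 H1] := energy_cvg0 lt Ht cn lf fp e16.
  have /cvgrPdist_le /(_ _ e4)[N2 _ H2] := n2_sub_trunc_cvg lf.
  exists (maxn N1 N2) => n; rewrite geq_max => /andP[/H1 E1 N2n].
  have [_ un sn _] := HL n.
  have [a aP] := power_interpolation f un.
  exists a; apply: n2le_trans; last first.
    apply: (recurrent_approx (Hq n) (q0 n)) => //; first by apply: recurrent_combo => w; exact: HLrec.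
    by move=> k kn; apply: aP; rewrite sn.
  have := H2 n.+1 (leqW N2n); rewrite /= sub0r normrN ger0_norm => [E2|].
    by move: E1 E2; rewrite -/(q n); lra.
  by apply: n2_ge0; apply: l2_lc => //; exact: l2_trunc.
move=> Hf; apply/HM => // k; set tau := dot _ _.
have lb := l2_bs k lf.
(* Apart from [c n], the lower-order part of the recurrence applied to [f] at [k] is a quarter of
   the Cesaro mean of the partial sums of [dot (bs k f) theta]. *)
have ct : ccvg (fun n => 4^-1%:C * (n.+1%:R^-1%:C * \sum_(j < n.+1) (n.+1 - j)%:R * (f (k + j)%N * conjc (theta j))))
    (4^-1%:C * tau).
  apply: ccvgM; first exact: ccvg_cst.
  apply: (@ccvg_cesaro _ (fun j => f (k + j)%N * conjc (theta j))).
  exact: (dotP lb lt).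
have fn0 : nq (f (k + n.+1)%N) @[n --> \oo] --> (0 : R).
  have H0 : \sum_(i < m + 1) nq (f i) - \sum_(i < m) nq (f i) @[m --> \oo] --> n2 f - n2 f.
    apply: cvgB; last exact: n2_cvg.
    by have := n2_cvg lf; rewrite -(cvg_shiftn 1 (fun m => \sum_(i < m) nq (f i))).
  rewrite subrr -(cvg_shiftn k.+1) in H0.
  apply: cvg_trans H0; apply: near_eq_cvg; apply: nearW => n /=.
  by rewrite addn1 big_ord_recr /= addrAC subrr add0r addnC addSnnS.
have key n : nq (4^-1%:C * (n.+1%:R^-1%:C * \sum_(j < n.+1) (n.+1 - j)%:R * (f (k + j)%N * conjc (theta j))))
   <= 2 * nq (\sum_(j < n.+1) q n j * f (k + j)%N) + 2 * (nq (c n) * nq (f k)).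
  have -> : 4^-1%:C * (n.+1%:R^-1%:C * \sum_(j < n.+1) (n.+1 - j)%:R * (f (k + j)%N * conjc (theta j)))
     = \sum_(j < n.+1) q n j * f (k + j)%N + - (c n * f k).
    have -> : c n * f k = \sum_(j < n.+1) (if j == 0%N :> nat then c n else 0) * f (k + j)%N.
      by rewrite big_ord_recl /= addn0 big1 ?addr0// => j _; rewrite mul0r.
    rewrite mulrA mulr_sumr -sumrB; apply: eq_bigr => j _.
    by rewrite /q /cesaro_symbol rmorphM /= rmorph_nat !fmorphV /= rmorphM /= !rmorph_nat invfM; ring.
  by rewrite (le_trans (nqD_le _ _))// nqN nqM.
(* With [f = g + d] and [g] a solution, the lower-order part is the Toeplitz image of the error [d]
   minus [g (k + n.+1)], which is an entry of [f], tending to 0, minus an entry of [d]. *)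
have key2 n a e : n2le (lc 1 f (-1) (geometric_combo (Lam n) a)) e ->
   nq (\sum_(j < n.+1) q n j * f (k + j)%N) <= 2 * (4^-1 * e) + 2 * (2 * nq (f (k + n.+1)%N) + 2 * e).
  set g := geometric_combo _ _; set d := lc _ _ _ _ => de.
  have gr : recurrent (q n) n.+1 g by apply: recurrent_combo => w; exact: HLrec.
  have -> : \sum_(j < n.+1) q n j * f (k + j)%N = hankel (q n) (k + n.+1) d k + - g (k + n.+1)%N.
    rewrite gr opprK /hankel addKn -big_split /=; apply: eq_bigr => j _.
    by rewrite /d /lc; ring.
  rewrite (le_trans (nqD_le _ _))// nqN; apply: lerD; rewrite ler_pM2l//.
    apply: le_trans (opc_coord _ (Hq n) _) _; first by rewrite -addn1 leq_add2l.
    by rewrite ler_pM2l//; exact: de.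
  have -> : g (k + n.+1)%N = f (k + n.+1)%N + - d (k + n.+1)%N by rewrite /d /lc; ring.
  rewrite (le_trans (nqD_le _ _))// nqN lerD2l ler_pM2l//.
  exact: n2le_coord.
(* The terms of [key] and [key2] that survive the limit add up to 2 (2 (e/4) + 2 (2 e)) = 9 e. *)
have bound e : 0 < e -> nq (4^-1%:C * tau) <= 9 * e.
  move=> e0; have [N HN] := Hf e e0.
  have H1 : 2 * (2 * (4^-1 * e) + 2 * (2 * nq (f (k + n.+1)%N) + 2 * e)) +
      2 * (16^-1 / n.+1%:R * nq (f k)) @[n --> \oo] -->
      2 * (2 * (4^-1 * e) + 2 * (2 * 0 + 2 * e)) + 2 * (0 * nq (f k)).
    apply: cvgD; apply: cvgM; try exact: cvg_cst.
      apply: cvgD; first exact: cvg_cst.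
      apply: cvgM; first exact: cvg_cst.
      apply: cvgD; last exact: cvg_cst.
      by apply: cvgM => //; exact: cvg_cst.
    by apply: cvgM; [exact: harmonic_cvg0|exact: cvg_cst].
  have -> : 9 * e = 2 * (2 * (4^-1 * e) + 2 * (2 * 0 + 2 * e)) + 2 * (0 * nq (f k)) by field.
  apply: (ler_cvg_to (ccvg_nq ct) H1); exists N => // n /= Nn.
  have [a /key2 Ha] := HN n Nn.
  apply: (le_trans (key n)); apply: lerD; first by rewrite ler_pM2l.
  by rewrite ler_pM2l// ler_wpM2r ?nq_ge0// -invfM; exact: cn.
have t0 : nq (4^-1%:C * tau) = 0.
  apply/eqP; rewrite eq_le nq_ge0 andbT leNgt; apply/negP => tp.
  have := bound (nq (4^-1%:C * tau) / 18) (divr_gt0 tp (ltr0Sn _ 17)); lra.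
apply: nq_eq0; move: t0; rewrite nqM nq_real => /eqP.
by rewrite mulf_eq0 sqrf_eq0 invr_eq0 pnatr_eq0 /= => /eqP.
Qed.

End SpectralSynthesis.

(** * Hardy operator and monomials *)

Section HardyMonomial.
Variable R : realType.
Local Notation mu := (@lebesgue_measure R).
Local Notation I := (@unit_itv R).
Local Notation C := (R[i]).
Implicit Types (a b c p q t x : R).

Lemma measurable_osc (A : set R) a b p q : measurable_fun A (osc a b p q).
Proof.
apply: measurable_funTS; apply: measurable_funM; first exact: measurable_powR.
have ml : measurable_fun setT (fun x : R => b * ln x).
  by apply: measurable_funM => //; exact: measurable_ln.
apply: measurable_funD; apply: measurable_funM => //.
- apply: (measurableT_comp _ ml); apply: continuous_measurable_fun; exact: continuous_cos.
- apply: (measurableT_comp _ ml); apply: continuous_measurable_fun; exact: continuous_sin.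
Qed.

Lemma abs_osc_le a b p q t : `|osc a b p q t| <= (`|p| + `|q|) * t `^ a.
Proof.
rewrite /osc normrM (ger0_norm (powR_ge0 _ _)) mulrC ler_wpM2r ?powR_ge0//.
apply: (le_trans (ler_normD _ _)); rewrite !normrM.
apply: lerD; rewrite -[leRHS]mulr1 ler_wpM2l//.
- by rewrite ler_norml cos_geN1 cos_le1.
- by rewrite ler_norml sin_geN1 sin_le1.
Qed.

Lemma osc_rL2 a b p q : - 2^-1 < a -> rL2 (osc a b p q).
Proof.
move=> a2.
have H := rL2_lin (`|p| + `|q|) 0 (powR_rL2 a2) (powR_rL2 a2).
apply: (le_rL2 _ H); first exact: measurable_osc.
by move=> t _; rewrite mul0r addr0 abs_osc_le.
Qed.

(** The integrand is the derivative of the right side on positive reals. Integrating from [e n] and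
    letting it tend to 0 avoids the singularity; the missing piece is small by the bound on
    integrals over [[0, x]]. *)
Lemma Rintegral_osc a b p q x : - 2^-1 < a -> 0 < x <= 1 ->
  \int[mu]_(t in `[0, x]) osc a b ((a + 1) * p + b * q) ((a + 1) * q - b * p) t =
  osc (a + 1) b p q x.
Proof.
move=> a2 /andP[x0 x1].
set u := osc a b _ _; set F := osc (a + 1) b p q.
have Lu : rL2 u by exact: osc_rL2.
have Ix : I x by rewrite /unit_itv /= in_itv /= ltW.
have dF t : 0 < t -> is_derive t 1 F (u t).
  move=> t0; have := is_derive_osc (a + 1) b p q t0.
  by rewrite addrK.
have du t : 0 < t -> derivable u t 1 by move=> t0; have [] := is_derive_osc a b ((a + 1) * p + b * q) ((a + 1) * q - b * p) t0.
pose e n : R := x / n.+2%:R.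
have e0 n : 0 < e n by rewrite divr_gt0.
have ex n : e n < x by rewrite ltr_pdivrMr// ltr_pMr// ltr1n.
have e1 n : e n <= 1 by rewrite ltW// (lt_le_trans (ex n)).
have ecvg : e n @[n --> \oo] --> (0 : R).
  have := harmonic_cvg0 x; rewrite -(cvg_shiftS (fun n => x / n.+1%:R)); exact.
have E n : F x - F (e n) = \int[mu]_(t in `[0, x]) u t - \int[mu]_(t in `[0, e n]) u t.
  rewrite -(ftc_pos dF du (e0 n) (ex n)).
  rewrite (@Rintegral_itvB _ u (BLeft 0) (BRight x) (e n)).
  - rewrite Rintegral_itv_obnd_cbnd//.
    apply: integrableS (cont_pos_integrable x du (e0 n)) => //.
    by apply: subset_itvr; rewrite bnd_simp.
  - exact: rL2_integrable_sub.
  - by rewrite bnd_simp ltW.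
  - by rewrite bnd_simp ltW.
have H1 : \int[mu]_(t in `[0, e n]) u t @[n --> \oo] --> (0 : R).
  apply: sqr_cvg0; apply: (@squeeze_cvgr _ _ _ _ (cst 0) (fun n => e n * sq u)).
  - apply: nearW => n; rewrite sqr_ge0 /=; apply: Rintegral_prefix_sqr => //.
    by rewrite /unit_itv /= in_itv /= e1 ltW.
  - exact: cvg_cst.
  - have H : e n * sq u @[n --> \oo] --> 0 * sq u by apply: cvgM => //; exact: cvg_cst.
    by rewrite mul0r in H; exact: H.
have H2 : F (e n) @[n --> \oo] --> (0 : R).
  (* Since [a > -1/2], the exponent 2 (a + 1) exceeds 1, so the square of [F (e n)] is at most a
     multiple of [e n]. *)
  apply: sqr_cvg0; apply: (@squeeze_cvgr _ _ _ _ (cst 0) (fun n => (`|p| + `|q|) ^+ 2 * e n)).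
  - apply: nearW => n; rewrite sqr_ge0 /=.
    have := abs_osc_le (a + 1) b p q (e n); rewrite -/F => FK.
    rewrite -real_normK ?num_real//.
    apply: (@le_trans _ _ (((`|p| + `|q|) * e n `^ (a + 1)) ^+ 2)).
      by rewrite lerXn2r// nnegrE mulr_ge0 ?addr_ge0 ?powR_ge0.
    rewrite exprMn ler_wpM2l ?sqr_ge0// expr2 -powRD ?(gt_eqF (e0 n)) ?implybT//.
    by apply: ge1r_powR; [rewrite e0 e1|lra].
  - exact: cvg_cst.
  - have H : (`|p| + `|q|) ^+ 2 * e n @[n --> \oo] --> (`|p| + `|q|) ^+ 2 * 0.
      by apply: cvgM => //; exact: cvg_cst.
    by rewrite mulr0 in H; exact: H.
have H3 : F x - F (e n) @[n --> \oo] --> F x - 0 by apply: cvgB => //; exact: cvg_cst.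
have H4 : F x - F (e n) @[n --> \oo] --> \int[mu]_(t in `[0, x]) u t - 0.
  by rewrite (eq_cvg _ _ E); apply: cvgB => //; exact: cvg_cst.
rewrite !subr0 in H3 H4.
rewrite -(cvg_lim (@Rhausdorff R) H4); apply: cvg_lim => //; exact: Rhausdorff.
Qed.

Lemma L2P (f : R -> C) :
  L2 f <-> rL2 (fun x => complex.Re (f x)) /\ rL2 (fun x => complex.Im (f x)).
Proof.
have E x : Normc.normc (f x) ^+ 2 = 1 * complex.Re (f x) ^+ 2 + 1 * complex.Im (f x) ^+ 2.
  by rewrite -nq_normc !mul1r.
split=> [[mR mI jf]|[[mR jR] [mI jI]]].
  split; split => //; apply: le_integrable jf => //.
  - by apply/measurable_EFinP; exact: measurable_funX.
  - move=> x _; rewrite /= lee_fin !ger0_norm ?sqr_ge0// -nq_normc.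
    exact: sqr_Re_le_nq.
  - by apply/measurable_EFinP; exact: measurable_funX.
  - move=> x _; rewrite /= lee_fin !ger0_norm ?sqr_ge0// -nq_normc.
    exact: sqr_Im_le_nq.
split => //; have := integrable_lin 1 1 (@measurable_unit_itv R) jR jI.
by apply: eq_integrable => // x _; rewrite /= E.
Qed.

Lemma Re_monomial (s : C) x :
  complex.Re (monomial s x) = osc (complex.Re s) (complex.Im s) 1 0 x.
Proof. by rewrite /monomial /osc /= !mul0r subr0 mul1r addr0. Qed.

Lemma Im_monomial (s : C) x :
  complex.Im (monomial s x) = osc (complex.Re s) (complex.Im s) 0 1 x.
Proof. by rewrite /monomial /osc /= !mul0r addr0 mul1r add0r. Qed.

Lemma L2_monomial (s : C) : half_plane s -> L2 (monomial s).
Proof.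
move=> hs; apply/L2P; split.
  by apply: eq_rL2 (osc_rL2 (complex.Im s) 1 0 hs) => x _; rewrite Re_monomial.
by apply: eq_rL2 (osc_rL2 (complex.Im s) 0 1 hs) => x _; rewrite Im_monomial.
Qed.

Lemma hardyE (f : R -> C) x : hardy f x =
  hop (fun t => complex.Re (f t)) x +i* hop (fun t => complex.Im (f t)) x.
Proof. by rewrite /hardy /hop; simpc. Qed.

Lemma hardy_monomial (s : C) x : half_plane s -> 0 < x <= 1 ->
  hardy (monomial s) x = (s + 1)^-1 * monomial s x.
Proof.
move=> hs x01; have /andP[x0 x1] := x01; rewrite hardyE.
case: s hs => a b hs; have a2 : - 2^-1 < a := hs.
have c0 : a + 1 != 0 by rewrite gt_eqF//; lra.
have d0 : (a + 1) ^+ 2 + b ^+ 2 != 0.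
  by rewrite gt_eqF// ltr_wpDr ?sqr_ge0// exprn_even_gt0.
set D := (a + 1) ^+ 2 + b ^+ 2 in d0.
have pow : x `^ (a + 1) = x * x `^ a.
  rewrite -{2}(powRr1 (ltW x0)) -powRD ?(gt_eqF x0) ?implybT//.
  by congr (_ `^ _); ring.
(* The pair [((a + 1) / D, b / D)] solves the linear system that makes the integrand of
   [Rintegral_osc] the real part of the monomial; [D] is the squared modulus of [s + 1]. *)
have ER : hop (fun t => complex.Re (monomial (a +i* b) t)) x =
    x `^ a * (((a + 1) / D) * cos (b * ln x) + (b / D) * sin (b * ln x)).
  rewrite /hop.
  have -> : \int[mu]_(t in `[0, x]) complex.Re (monomial (a +i* b) t) =
     osc (a + 1) b ((a + 1) / D) (b / D) x.
    rewrite -Rintegral_osc//; apply: eq_Rintegral => t _; rewrite Re_monomial /=.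
    by congr osc; rewrite /D; field.
  by rewrite /osc pow; field; rewrite (gt_eqF x0) d0.
have EI : hop (fun t => complex.Im (monomial (a +i* b) t)) x =
    x `^ a * ((- b / D) * cos (b * ln x) + ((a + 1) / D) * sin (b * ln x)).
  rewrite /hop.
  have -> : \int[mu]_(t in `[0, x]) complex.Im (monomial (a +i* b) t) =
     osc (a + 1) b (- b / D) ((a + 1) / D) x.
    rewrite -Rintegral_osc//; apply: eq_Rintegral => t _; rewrite Im_monomial /=.
    by congr osc; rewrite /D; field.
  by rewrite /osc pow; field; rewrite (gt_eqF x0) d0.
rewrite ER EI /monomial; apply: C_eqP; rewrite /= !addr0 -/D; ring.
Qed.

End HardyMonomial.

(** * Coefficients of complex functions and of monomials *)

Section ComplexCoefficients.
Variable R : realType.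
Local Notation mu := (@lebesgue_measure R).
Local Notation I := (@unit_itv R).
Local Notation C := (R[i]).
Local Notation Re := (@complex.Re R).
Local Notation Im := (@complex.Im R).
Implicit Types (f g : R -> C) (a b s : C).

Definition cc f k : C := rc (fun x => Re (f x)) k +i* rc (fun x => Im (f x)) k.

Definition nsq f : R := sq (fun x => Re (f x)) + sq (fun x => Im (f x)).

Lemma normL2E f : L2 f -> normL2 f = Num.sqrt (nsq f).
Proof.
move=> /L2P[[_ jR] [_ jI]]; rewrite /normL2 /nsq; congr Num.sqrt.
rewrite -[sq _]mul1r -[X in _ + X]mul1r -Rintegral_lin//.
by apply: eq_Rintegral => x _; rewrite -nq_normc !mul1r.
Qed.

Lemma Re_lin f g a b x : Re (a * f x + b * g x) =
  1 * (Re a * Re (f x) + - Im a * Im (f x)) + 1 * (Re b * Re (g x) + - Im b * Im (g x)).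
Proof. by rewrite cReD !cReM; ring. Qed.

Lemma Im_lin f g a b x : Im (a * f x + b * g x) =
  1 * (Im a * Re (f x) + Re a * Im (f x)) + 1 * (Im b * Re (g x) + Re b * Im (g x)).
Proof. by rewrite cImD !cImM; ring. Qed.

Lemma L2_lin f g a b : L2 f -> L2 g -> L2 (fun x => a * f x + b * g x).
Proof.
move=> /L2P[fR fI] /L2P[gR gI]; apply/L2P; split.
  apply: eq_rL2 (rL2_lin 1 1 (rL2_lin (Re a) (- Im a) fR fI) (rL2_lin (Re b) (- Im b) gR gI)) => x _.
  by rewrite Re_lin.
apply: eq_rL2 (rL2_lin 1 1 (rL2_lin (Im a) (Re a) fR fI) (rL2_lin (Im b) (Re b) gR gI)) => x _.
by rewrite Im_lin.
Qed.

Lemma cc_lin f g a b k : L2 f -> L2 g ->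
  cc (fun x => a * f x + b * g x) k = a * cc f k + b * cc g k.
Proof.
move=> /L2P[fR fI] /L2P[gR gI]; rewrite /cc.
under [X in rc X k +i* _]eq_fun do rewrite Re_lin.
under [X in _ +i* rc X k]eq_fun do rewrite Im_lin.
rewrite !(rc_lin _ _ _ (rL2_lin _ _ fR fI) (rL2_lin _ _ gR gI)) !rc_lin//.
by apply: C_eqP; rewrite ?(cReD, cImD, cReM, cImM) /=; ring.
Qed.

Lemma eqL2_parts f g : eqL2 f g ->
  ae_eq mu I (fun x => Re (f x)) (fun x => Re (g x)) /\
  ae_eq mu I (fun x => Im (f x)) (fun x => Im (g x)).
Proof. by move=> fg; split; apply: filterS fg => x H Ix; rewrite H. Qed.

Lemma cc_ae f g k : L2 f -> L2 g -> eqL2 f g -> cc f k = cc g k.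
Proof.
move=> /L2P[fR fI] /L2P[gR gI] /eqL2_parts[eR eI].
by rewrite /cc (ae_eq_rc k fR gR eR) (ae_eq_rc k fI gI eI).
Qed.

Lemma eqL2_unit f g : (forall x, 0 < x <= 1 -> f x = g x) -> eqL2 f g.
Proof.
move=> fg; exists [set 0]; split => //; first exact: lebesgue_measure_set1.
move=> x /= /not_implyP[Ix]; apply: contra_notP => /eqP x0; apply: fg.
by move: Ix; rewrite /unit_itv /= in_itv /= lt_neqAle eq_sym x0.
Qed.

Lemma L2_hardy f : L2 f -> L2 (hardy f).
Proof.
move=> /L2P[fR fI]; apply/L2P; split.
  by apply: eq_rL2 (rL2_hop fR) => x _; rewrite hardyE.
by apply: eq_rL2 (rL2_hop fI) => x _; rewrite hardyE.
Qed.

Lemma cc_hardy f k : L2 f -> cc (hardy f) k = cc f k - cc f k.+1.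
Proof.
move=> /L2P[fR fI]; rewrite /cc.
under [X in rc X k +i* _]eq_fun do rewrite hardyE /=.
under [X in _ +i* rc X k]eq_fun do rewrite hardyE /=.
rewrite -[X in rc X k +i* _]/(hop (fun t => Re (f t))).
rewrite -[X in _ +i* rc X k]/(hop (fun t => Im (f t))).
by rewrite !rc_hop.
Qed.

Lemma nsq_hardy_le f : L2 f -> nsq (hardy f) <= 4 * nsq f.
Proof.
move=> /L2P[fR fI]; rewrite /nsq mulrDr; apply: lerD.
  rewrite (@eq_sq _ _ (hop (fun t => Re (f t)))); first exact: sq_hop_le.
  by move=> x _; rewrite hardyE.
rewrite (@eq_sq _ _ (hop (fun t => Im (f t)))); first exact: sq_hop_le.
by move=> x _; rewrite hardyE.
Qed.

Lemma hardy_lin f g a b x : L2 f -> L2 g -> I x ->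
  hardy (fun x => a * f x + b * g x) x = a * hardy f x + b * hardy g x.
Proof.
move=> /L2P[fR fI] /L2P[gR gI] Ix; rewrite !hardyE.
under [X in hop X x +i* _]eq_fun do rewrite Re_lin.
under [X in _ +i* hop X x]eq_fun do rewrite Im_lin.
rewrite !(hop_lin _ _ (rL2_lin _ _ fR fI) (rL2_lin _ _ gR gI))// !hop_lin//.
by apply: C_eqP; rewrite ?(cReD, cImD, cReM, cImM) /=; ring.
Qed.

Lemma eqL2_hardy f g : L2 f -> L2 g -> eqL2 f g -> eqL2 (hardy f) (hardy g).
Proof.
move=> /L2P[fR fI] /L2P[gR gI] /eqL2_parts[eR eI]; apply: eqL2_unit => x /andP[x0 x1].
have Ix : I x by rewrite /unit_itv /= in_itv /= ltW.
by rewrite !hardyE (ae_eq_hop fR gR eR Ix) (ae_eq_hop fI gI eI Ix).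
Qed.

Lemma cc_cvg f : L2 f -> \sum_(k < n) nq (cc f k) @[n --> \oo] --> nsq f.
Proof.
move=> /L2P[fR fI].
have E n : \sum_(k < n) nq (cc f k) =
    \sum_(k < n) rc (fun x => Re (f x)) k ^+ 2 + \sum_(k < n) rc (fun x => Im (f x)) k ^+ 2.
  by rewrite -big_split.
by rewrite (eq_cvg _ _ E); apply: cvgD; exact: rc_parseval.
Qed.

Lemma l2_cc f : L2 f -> l2 (cc f).
Proof.
move=> Lf; exists (nsq f) => n.
have H := cc_cvg Lf.
rewrite -(cvg_lim (@Rhausdorff R) H); apply: limr_ge.
  by apply/cvg_ex; eexists; exact: H.
exists n => // m /= nm.
rewrite -!(big_mkord xpredT (fun k => nq (cc f k))) (big_cat_nat (leq0n n) nm)//= lerDl.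
by apply: sumr_ge0 => k _; exact: nq_ge0.
Qed.

Lemma n2_cc f : L2 f -> n2 (cc f) = nsq f.
Proof.
move=> Lf; rewrite -(cvg_lim (@Rhausdorff R) (cc_cvg Lf)).
by symmetry; apply: cvg_lim; [exact: Rhausdorff|apply: n2_cvg; exact: l2_cc].
Qed.

Lemma half_plane_neq0 s : half_plane s -> s + 1 != 0.
Proof.
case: s => x y hs; have {}hs : - 2^-1 < x := hs.
by rewrite eq_complex /= negb_and gt_eqF//; lra.
Qed.

Lemma monomial1 s : monomial s 1 = 1.
Proof. by rewrite /monomial powR1 ln1 mulr0 cos0 sin0 mul1r. Qed.

Lemma cc0 f : cc f 0 = hardy f 1.
Proof. by rewrite hardyE /hop invr1 !mul1r. Qed.

(** Since H multiplies the monomial by 1/(s + 1), passing to the next coefficient multiplies by 1 -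
    1/(s + 1) = s/(s + 1). *)
Lemma cc_monomial s k : half_plane s ->
  cc (monomial s) k = (s + 1)^-1 * (s / (s + 1)) ^+ k.
Proof.
move=> hs; have s1 := half_plane_neq0 hs; have Ls := L2_monomial hs.
elim: k => [|k IH].
  by rewrite cc0 hardy_monomial ?ltr01 ?lexx// monomial1 expr0.
have -> : cc (monomial s) k.+1 = cc (monomial s) k - cc (hardy (monomial s)) k.
  by rewrite cc_hardy// opprB addrC subrK.
have -> : cc (hardy (monomial s)) k = (s + 1)^-1 * cc (monomial s) k.
  have := cc_lin (s + 1)^-1 0 k Ls Ls; rewrite mul0r addr0 => <-.
  apply: cc_ae; [exact: L2_hardy|exact: L2_lin|].
  by apply: eqL2_unit => x x01; rewrite hardy_monomial// mul0r addr0.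
rewrite IH exprS; field; exact: s1.
Qed.

End ComplexCoefficients.

(** * Transfer to the function space *)

Section Transfer.
Variable R : realType.
Local Notation I := (@unit_itv R).
Local Notation C := (R[i]).
Implicit Types (f g : R -> C) (a b s : C) (M : set (R -> C)).

Lemma L2_cst0 : L2 (fun=> 0 : C).
Proof. by apply/L2P; split; exact: rL2_cst. Qed.

(** An arbitrary index type allows sums over the finite type of an [{fset}], while proofs go by
    induction on the list. *)
Definition monomial_sum (T : Type) (r : seq T) (sv a : T -> C) : R -> C :=
  fun x => \sum_(i <- r) a i * monomial (sv i) x.

Lemma monomial_sum_cons (T : Type) (i : T) r (sv a : T -> C) :
  monomial_sum (i :: r) sv a = fun x => a i * monomial (sv i) x + 1 * monomial_sum r sv a x.
Proof. by apply/funext => x; rewrite /monomial_sum big_cons mul1r. Qed.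

Lemma L2_monomial_sum (T : Type) r (sv a : T -> C) :
  (forall i, half_plane (sv i)) -> L2 (monomial_sum r sv a).
Proof.
move=> hs; elim: r => [|i r IH].
  by rewrite (_ : monomial_sum _ _ _ = fun=> 0); [exact: L2_cst0|apply/funext => x; exact: big_nil].
by rewrite monomial_sum_cons; apply: L2_lin => //; exact: L2_monomial.
Qed.

Lemma cc_monomial_sum (T : Type) r (sv a : T -> C) k : (forall i, half_plane (sv i)) ->
  cc (monomial_sum r sv a) k =
  \sum_(i <- r) a i * ((sv i + 1)^-1 * (sv i / (sv i + 1)) ^+ k).
Proof.
move=> hs; elim: r => [|i r IH].
  rewrite big_nil (_ : monomial_sum _ _ _ = fun x => 0 * 0 + 0 * 0); last first.
    by apply/funext => x; rewrite mul0r addr0; exact: big_nil.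
  by rewrite (cc_lin _ _ _ L2_cst0 L2_cst0) !mul0r addr0.
rewrite monomial_sum_cons cc_lin; [|exact: L2_monomial|exact: L2_monomial_sum].
by rewrite big_cons IH mul1r cc_monomial.
Qed.

Lemma hardy_monomial_sum (T : Type) r (sv a : T -> C) x : (forall i, half_plane (sv i)) ->
  0 < x <= 1 ->
  hardy (monomial_sum r sv a) x = monomial_sum r sv (fun i => a i * (sv i + 1)^-1) x.
Proof.
move=> hs x01; have Ix : I x by case/andP: x01 => x0 x1; rewrite /unit_itv /= in_itv /= ltW.
elim: r => [|i r IH].
  rewrite /monomial_sum big_nil (_ : (fun x => _) = fun x => 0 * 0 + 0 * 0); last first.
    by apply/funext => y; rewrite mul0r addr0; exact: big_nil.
  by rewrite (hardy_lin _ _ L2_cst0 L2_cst0 Ix) !mul0r addr0.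
rewrite monomial_sum_cons hardy_lin//; [|exact: L2_monomial|exact: L2_monomial_sum].
by rewrite IH /monomial_sum big_cons mul1r hardy_monomial// mulrA.
Qed.

Lemma monomial_spanE (S : {fset C}) f : monomial_span S f <->
  L2 f /\ exists a : S -> C, eqL2 f (monomial_sum (index_enum S) (fun s : S => val s) a).
Proof. by []. Qed.

Lemma monomial_span_hardy (S : {fset C}) f : (forall s, s \in S -> half_plane s) ->
  monomial_span S f -> monomial_span S (hardy f).
Proof.
move=> hS /monomial_spanE[Lf [a fa]]; apply/monomial_spanE; split; first exact: L2_hardy.
have hs (s : S) : half_plane (val s) by apply: hS; exact: valP.
exists (fun s : S => a s * (val s + 1)^-1).
apply: ae_eq_trans (eqL2_hardy Lf (L2_monomial_sum _ _ hs) fa) _.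
by apply: eqL2_unit => x x01; exact: hardy_monomial_sum.
Qed.

Lemma nsqB_cc f g : L2 f -> L2 g -> nsq (f - g) = n2 (lc 1 (cc f) (-1) (cc g)).
Proof.
move=> Lf Lg.
have E : f - g = fun x => 1 * f x + (-1) * g x by apply/funext => x; rewrite mul1r mulN1r.
rewrite E -n2_cc; last exact: L2_lin.
by congr n2; apply/funext => k; rewrite cc_lin.
Qed.

Lemma L2B f g : L2 f -> L2 g -> L2 (f - g).
Proof.
move=> Lf Lg; rewrite (_ : f - g = fun x => 1 * f x + (-1) * g x); first exact: L2_lin.
by apply/funext => x; rewrite mul1r mulN1r.
Qed.

(** Replaces the infimum by nearby elements. Nonemptiness matters because [inf] of the empty set is
    0 by convention. *)
Lemma distL2_cvg0 f (Mn : nat -> set (R -> C)) : L2 f ->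
  (forall n, Mn n `<=` @L2 R) -> (forall n, Mn n !=set0) ->
  distL2 f (Mn n) @[n --> \oo] --> (0 : R) <->
  forall e : R, 0 < e -> exists N, forall n, (N <= n)%N -> exists2 g, Mn n g & nsq (f - g) <= e.
Proof.
move=> Lf ML M0.
pose D n := [set normL2 (f - g) | g in Mn n].
have Dlb n : has_lbound (D n) by exists 0 => _ [g _ <-]; exact: sqrtr_ge0.
have D0 n : D n !=set0 by have [g Mg] := M0 n; exists (normL2 (f - g)), g.
have d0 n : 0 <= distL2 f (Mn n).
  by apply: lb_le_inf; [exact: D0|move=> _ [g _ <-]; exact: sqrtr_ge0].
split=> [/cvgrPdist_lt H e e0|H].
  have se : 0 < Num.sqrt e by rewrite sqrtr_gt0.
  have [N _ HN] := H _ se; exists N => n Nn.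
  have := HN n Nn; rewrite /= sub0r normrN ger0_norm// => /(inf_lt (D0 n)).
  move=> [_ [g Mg <-]]; rewrite normL2E; last by apply: L2B => //; exact: ML Mg.
  by move=> H'; exists g => //; rewrite ltW// -(ltr_sqrt _ e0).
apply/cvgrPdist_le => e e0; have [N HN] := H _ (exprn_gt0 2 e0).
exists N => // n /= Nn; rewrite sub0r normrN ger0_norm//.
have [g Mg ge] := HN n Nn.
apply: (@le_trans _ _ (normL2 (f - g))); first by apply: (ge_inf (Dlb n)); exists g.
rewrite normL2E; last by apply: L2B => //; exact: ML Mg.
rewrite -[leRHS](ger0_norm (ltW e0)) -sqrtr_sqr; exact: ler_wsqrtr.
Qed.

Lemma monomial_span_neq0 (S : {fset C}) : monomial_span S !=set0.
Proof.
exists (fun=> 0); apply/monomial_spanE; split; first exact: L2_cst0.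
exists (fun=> 0); apply: eqL2_unit => x _.
by rewrite /monomial_sum big1// => i _; rewrite mul0r.
Qed.

Lemma monomial_space_hardy_invariant M : monomial_space M -> hardy_invariant M.
Proof.
move=> [_ [Mn fin ->]] f [Lf Hf].
have ML n : Mn n `<=` @L2 R by have [S _ ->] := fin n => g [].
have M0 n : Mn n !=set0 by have [S _ ->] := fin n; exact: monomial_span_neq0.
split; first exact: L2_hardy.
apply/distL2_cvg0 => //; first exact: L2_hardy.
move: Hf => /(distL2_cvg0 Lf ML M0) Hf e e0.
have e4 : 0 < e / 4 by rewrite divr_gt0.
have [N HN] := Hf _ e4; exists N => n /HN[g Mg ge].
have Lg := ML _ _ Mg.
exists (hardy g).
  by have [S hS MS] := fin n; rewrite MS in Mg *; exact: monomial_span_hardy.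
have -> : nsq (hardy f - hardy g) = nsq (hardy (f - g)).
  have E : f - g = fun x => 1 * f x + (-1) * g x by apply/funext => x; rewrite mul1r mulN1r.
  have H x : x \in I -> (hardy f - hardy g) x = hardy (f - g) x.
    by rewrite inE => Ix; rewrite E hardy_lin// mul1r mulN1r.
  by rewrite /nsq; congr (_ + _); apply: eq_sq => x xI; rewrite H.
have := nsq_hardy_le (L2B Lf Lg); lra.
Qed.

End Transfer.

(** * Closed invariant subspaces are monomial spaces *)

Section InvariantSubspaces.
Variable R : realType.
Local Notation C := (R[i]).
Local Notation Re := (@complex.Re R).
Implicit Types (f g : R -> C) (a b s w : C) (M : set (R -> C)).

(** The closure in l^2 of the coefficient image of [M]. It is closed by construction, without an
    appeal to completeness of L^2, and [cc_closureP] recovers [M] from it. *)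
Definition cc_closure M : set (nat -> C) := [set u | l2 u /\
  forall e : R, 0 < e -> exists2 f, M f & n2 (lc 1 u (-1) (cc f)) <= e].

Lemma subspaceL2_lin M f g a b : subspaceL2 M -> M f -> M g ->
  M (fun x => a * f x + b * g x).
Proof. by move=> [_ _ _ MD MZ] Mf Mg; exact: (MD _ _ (MZ a f Mf) (MZ b g Mg)). Qed.

Lemma n2_lc_le (u v : nat -> C) a b : l2 u -> l2 v ->
  n2 (lc a u b v) <= 2 * nq a * n2 u + 2 * nq b * n2 v.
Proof.
by move=> lu lv; apply/n2leP; [exact: l2_lc|apply: n2le_lc; exact: n2le_n2].
Qed.

Lemma cc_closure_subspace M : subspaceL2 M -> subspace_l2 (cc_closure M).
Proof.
move=> sM; have [ML _ M0 _ _] := sM; split.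
- by move=> u [].
- split; first by apply: (@l2_finite _ 0).
  move=> e e0; exists 0 => //; apply/n2leP.
    by apply: l2_lc; [exact: (@l2_finite _ 0)|exact/l2_cc/ML].
  have L0 := @L2_cst0 R.
  have E : lc 1 (fun=> 0) (-1) (cc (0 : R -> C)) = fun=> 0.
    apply/funext => k; have H := cc_lin 0 0 k L0 L0.
    have E0 : cc (0 : R -> C) = cc (fun x => 0 * 0 + 0 * 0).
      by congr cc; apply/funext => x; rewrite mul0r addr0.
    by rewrite /lc E0 H !mul0r addr0 !mulr0 addr0.
  by move=> n; rewrite E big1 ?ltW// => k _; rewrite nq0.
- move=> u v a b [lu Hu] [lv Hv]; split; first exact: l2_lc.
  move=> e e0; pose c := nq a + nq b + 1.
  have c0 : 0 < c by rewrite ltr_wpDl// addr_ge0 ?nq_ge0.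
  have d0 : 0 < e / (2 * c) by rewrite divr_gt0// mulr_gt0.
  have [f Mf fe] := Hu _ d0; have [g Mg ge] := Hv _ d0.
  exists (fun x => a * f x + b * g x); first exact: subspaceL2_lin.
  have -> : lc 1 (lc a u b v) (-1) (cc (fun x => a * f x + b * g x)) =
      lc a (lc 1 u (-1) (cc f)) b (lc 1 v (-1) (cc g)).
    by apply/funext => k; rewrite /lc cc_lin; [ring|exact: ML..].
  have l1 : l2 (lc 1 u (-1) (cc f)) by apply: l2_lc => //; exact/l2_cc/ML.
  have l1' : l2 (lc 1 v (-1) (cc g)) by apply: l2_lc => //; exact/l2_cc/ML.
  apply: (le_trans (n2_lc_le _ _ l1 l1')).
  apply: (@le_trans _ _ (2 * nq a * (e / (2 * c)) + 2 * nq b * (e / (2 * c)))).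
    by apply: lerD; rewrite ler_wpM2l// mulr_ge0 ?nq_ge0.
  rewrite -mulrDl -mulrDr mulrA ler_pdivrMr ?mulr_gt0// [leRHS]mulrCA -!mulrA ler_pM2l//.
  by rewrite mulrC ler_pM2l// ler_wpDr.
Qed.

Lemma cc_closure_closed M : subspaceL2 M -> closed_l2 (cc_closure M).
Proof.
move=> [ML _ _ _ _] u lu H; split => // e e0.
have e4 : 0 < e / 4 by rewrite divr_gt0.
have [v [lv Hv] uv] := H _ e4; have [f Mf vf] := Hv _ e4; exists f => //.
have lf := l2_cc (ML _ Mf).
have -> : lc 1 u (-1) (cc f) = lc 1 (lc 1 u (-1) v) 1 (lc 1 v (-1) (cc f)).
  by apply/funext => k; rewrite /lc; ring.
apply: (le_trans (n2_lc_le _ _ (l2_lc _ _ lu lv) (l2_lc _ _ lv lf))).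
rewrite nq1; move: uv vf; lra.
Qed.

(** The function [f - hardy f] belongs to [M], and its coefficients are those of [f] shifted. *)
Lemma cc_closure_shift M : subspaceL2 M -> hardy_invariant M ->
  forall u, cc_closure M u -> cc_closure M (bs 1 u).
Proof.
move=> sM hM u [lu H]; have [ML _ _ _ _] := sM; split; first exact: l2_bs.
move=> e e0; have [f Mf uf] := H _ e0.
have Lf := ML _ Mf; have Lh := L2_hardy Lf.
exists (fun x => 1 * f x + (-1) * hardy f x).
  by apply: subspaceL2_lin => //; exact: hM.
have l1 : l2 (lc 1 u (-1) (cc f)) by apply: l2_lc => //; exact: l2_cc.
have -> : lc 1 (bs 1 u) (-1) (cc (fun x => 1 * f x + (-1) * hardy f x)) =
    bs 1 (lc 1 u (-1) (cc f)).
  apply/funext => k; rewrite /lc /bs cc_lin// cc_hardy// add1n; ring.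
apply: le_trans uf; apply/n2leP; first exact: l2_bs.
by apply: n2le_bs; exact: n2le_n2.
Qed.

Lemma cc_closureP M f : subspaceL2 M -> closedL2 M -> L2 f ->
  M f <-> cc_closure M (cc f).
Proof.
move=> [ML _ _ _ _] cM Lf; split=> [Mf|[_ H]].
  split; first exact: l2_cc.
  move=> e e0; exists f => //; apply/n2leP; first by apply: l2_lc; exact: l2_cc.
  by move=> n; rewrite big1 ?ltW// => k _; rewrite /lc mul1r mulN1r subrr nq0.
apply: cM => // e e0.
(* Halving gives the strict inequality that [closedL2] demands of the norm. *)
have e2 : 0 < e ^+ 2 / 2 by rewrite divr_gt0// exprn_gt0.
have [g Mg fg] := H _ e2; exists g => //.
have Lg := ML _ Mg.
rewrite -nsqB_cc// in fg.
rewrite normL2E; last exact: L2B.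
rewrite -[ltRHS](ger0_norm (ltW e0)) -sqrtr_sqr ltr_sqrt ?exprn_gt0//.
by apply: le_lt_trans fg _; rewrite ltr_pdivrMr// ltr_pMr ?exprn_gt0// ltr1n.
Qed.

Lemma nq_sub1 w : nq (1 - w) = 1 - 2 * Re w + nq w.
Proof. by case: w => x y; rewrite /nq /=; ring. Qed.

(** This map inverts s |-> s/(s + 1). Its real part is (Re w - |w|^2) / |1 - w|^2, which exceeds
    -1/2 exactly when |w| < 1. *)
Lemma half_plane_cayley w : nq w < 1 -> half_plane (w / (1 - w)).
Proof.
move=> w1; have d0 : 0 < nq (1 - w).
  rewrite lt_neqAle nq_ge0 andbT eq_sym; apply/eqP => /nq_eq0 /eqP.
  by rewrite subr_eq0 => /eqP w1'; move: w1; rewrite -w1' nq1 ltxx.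
have : Re (w / (1 - w)) = (Re w - nq w) / nq (1 - w).
  have -> : w / (1 - w) = w * conjc (1 - w) / (nq (1 - w))%:C.
    have n0 : 1 - w != 0 by apply/eqP => H; rewrite H nq0 ltxx in d0.
    by rewrite -mulJ_nq -mulf_div mulfV ?conjc_eq0// mulr1.
  rewrite -fmorphV cReM /= mulr0 subr0 cReM; congr (_ / _).
  by case: (w) => x y; rewrite /nq /=; ring.
rewrite /half_plane /= => ->.
rewrite ltr_pdivlMr//; move: w1; rewrite nq_sub1; lra.
Qed.

Lemma cayleyK w : nq w < 1 -> w / (1 - w) + 1 = (1 - w)^-1 /\
  (w / (1 - w)) / (w / (1 - w) + 1) = w.
Proof.
move=> w1; have d0 : 1 - w != 0.
  rewrite subr_eq0; apply/eqP => w1'; move: w1.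
  by rewrite -w1' nq1 ltxx.
have H : w / (1 - w) + 1 = (1 - w)^-1 by field.
by split => //; rewrite H invrK divfK.
Qed.

Definition cayley_fset (ws : seq C) : {fset C} :=
  [fset s in [seq w / (1 - w) | w <- ws]]%fset.

Lemma cayley_fset_half_plane ws s : (forall w, w \in ws -> nq w < 1) ->
  s \in cayley_fset ws -> half_plane s.
Proof. by move=> H; rewrite !inE => /mapP[w /H w1 ->]; exact: half_plane_cayley. Qed.

Lemma big_cayley_fset (ws : seq C) (G : C -> C) : uniq ws ->
  (forall w, w \in ws -> nq w < 1) ->
  \sum_(s : cayley_fset ws) G (val s / (val s + 1)) = \sum_(w <- ws) G w.
Proof.
move=> uws H.
rewrite -(big_seq_fsetE _ (cayley_fset ws) xpredT (fun s => G (s / (s + 1)))) /=.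
have inj : {in ws &, injective (fun w : C => w / (1 - w))}.
  move=> w w' /H w1 /H w1' E.
  by rewrite -(cayleyK w1).2 -(cayleyK w1').2 E.
rewrite (perm_big [seq w / (1 - w) | w <- ws]) /=; last first.
  apply: uniq_perm; [exact: fset_uniq|by rewrite map_inj_in_uniq|].
  by move=> s; rewrite !inE.
by rewrite big_map; apply: eq_big_seq => w /H w1; rewrite (cayleyK w1).2.
Qed.

(** The coefficients of a combination of monomials form a combination of the sequences of powers of
    [s / (s + 1)], so by isometry the two approximation problems coincide. *)
Lemma cayley_span_cc (ws : seq C) f (e : R) : uniq ws -> (forall w, w \in ws -> nq w < 1) -> L2 f ->
  (exists a : C -> C, n2le (lc 1 (cc f) (-1) (geometric_combo ws a)) e) <->
  exists2 g, monomial_span (cayley_fset ws) g & nsq (f - g) <= e.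
Proof.
move=> uws H Lf; set S := cayley_fset ws.
have hs (s : S) : half_plane (val s) by apply: (cayley_fset_half_plane H); exact: valP.
have s1 (s : S) : val s + 1 != 0 by apply: half_plane_neq0.
split=> [[a aP]|[g /monomial_spanE[Lg [b gb]] fg]].
  (* The factor [val s + 1] cancels the one in [cc_monomial]. *)
  pose b (s : S) : C := a (val s / (val s + 1)) * (val s + 1).
  pose g := monomial_sum (index_enum S) (fun s : S => val s) b.
  have Lg : L2 g := L2_monomial_sum _ _ hs.
  exists g; first by apply/monomial_spanE; split => //; exists b; exact: eqL2_unit.
  rewrite nsqB_cc//; apply/n2leP; first by apply: l2_lc; exact: l2_cc.
  rewrite (_ : cc g = geometric_combo ws a)//.
  apply/funext => k; rewrite /g cc_monomial_sum// /geometric_combo.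
  rewrite -(big_cayley_fset (fun w => a w * w ^+ k) uws H).
  by apply: eq_bigr => s _; rewrite /b -mulrA mulVKf.
have LS : L2 (monomial_sum (index_enum S) (fun s : S => val s) b) :=
  L2_monomial_sum _ _ hs.
(* Each root [w] collects the coefficients of the exponents that map to it. *)
exists (fun w => \sum_(s : S | val s / (val s + 1) == w) b s * (val s + 1)^-1).
move: fg; rewrite nsqB_cc// => /(n2leP _ (l2_lc 1 (-1) (l2_cc Lf) (l2_cc Lg))).
have -> : cc g = geometric_combo ws
    (fun w => \sum_(s : S | val s / (val s + 1) == w) b s * (val s + 1)^-1).
  apply/funext => k; rewrite (cc_ae k Lg LS gb) cc_monomial_sum// /geometric_combo.
  under [RHS]eq_bigr do rewrite mulr_suml.
  rewrite (exchange_big_dep xpredT)//=; apply: eq_bigr => s _.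
  have sws : val s / (val s + 1) \in ws.
    have := valP s; rewrite !inE => /mapP[w ww ->].
    by rewrite (cayleyK (H _ ww)).2.
  rewrite (big_rem _ sws) /= eqxx big_seq_cond big1 ?addr0 ?mulrA// => w /andP[wr /eqP E].
  by move: wr; rewrite -E mem_rem_uniqF.
by [].
Qed.

Lemma hardy_invariant_monomial_space M : subspaceL2 M -> closedL2 M ->
  hardy_invariant M -> monomial_space M.
Proof.
move=> sM cM hM; split => //.
have [Lam [uL L1 HL]] := l2_spectral (cc_closure_subspace sM) (cc_closure_closed sM)
  (cc_closure_shift sM hM).
exists (fun n => monomial_span (cayley_fset (Lam n))).
  by move=> n; exists (cayley_fset (Lam n)) => // s; exact: cayley_fset_half_plane (L1 n).
have ML : M `<=` @L2 R by case: sM.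
have key f : L2 f -> (M f <-> distL2 f (monomial_span (cayley_fset (Lam n))) @[n --> \oo] --> (0 : R)).
  move=> Lf.
  have D := distL2_cvg0 (Mn := fun n => monomial_span (cayley_fset (Lam n))) Lf
    (fun n g => @proj1 _ _) (fun n => monomial_span_neq0 _).
  have P1 := cc_closureP sM cM Lf; have P2 := HL _ (l2_cc Lf).
  have E e n := cayley_span_cc e (uL n) (L1 n) Lf.
  split.
    move=> /P1 /P2 Hf; apply/D => e /Hf[N HN]; exists N => n /HN; exact: (E e n).1.
  move=> /D Hf; apply/P1/P2 => e /Hf[N HN]; exists N => n /HN; exact: (E e n).2.
apply/seteqP; split => f /=; first by move=> Mf; have Lf := ML _ Mf; split => //; exact: (key f Lf).1.
by move=> [Lf Hf]; exact: (key f Lf).2.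
Qed.

End InvariantSubspaces.

Theorem theorem1p4 (R : realType) (M : set (R -> R[i]))
    (M_subspace : subspaceL2 M) (M_closed : closedL2 M)
    (M_nonzero : exists2 f, M f & ~ eqL2 f 0) :
  hardy_invariant M <-> monomial_space M.
Proof.
split; first exact: hardy_invariant_monomial_space.
exact: monomial_space_hardy_invariant.
Qed.
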